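(* Consider a hull of Euclidean cut and project sets $\Omega=\Omega(\mathcal{S},W)$, $\mathcal{S}=(\mathbb{E},\mathbb{E}_\vee,\mathbb{E}_<,\Gamma)$, which consists of $L$-Sub patterns. Thus there is a linear map $M\colon\mathbb{E}\to\mathbb{E}$ with $M(\Gamma)=\Gamma$, $M(\mathbb{E}_\vee)=\mathbb{E}_\vee$, $M|_{\mathbb{E}_\vee}=L$, $M(\mathbb{E}_<)=\mathbb{E}_<$, $A:=M|_{\mathbb{E}_<}$, and such that some translate of $W$ is mutually constructable from $A(W)$. Moreover, suppose that the fibres of the torus parametrisation $\tau\colon\Omega\to\mathbb{T}=\mathbb{E}/\Gamma$ are all finite. Then, for each $s\in\mathbb{E}_<$, the following are equivalent: (A) for all $v\in\mathbb{E}_\vee$ and $\Lambda\in\Omega$ with $\tau(\Lambda)=[v+s]$, we have that $\Lambda$ is LIDS with respect to some power $L^m$ ($m\in\mathbb{N}$, $m\geq1$) of the inflation; (B) there exists some $v\in\mathbb{E}_\vee$ and some $\Lambda\in\Omega$ with $\tau(\Lambda)=[v+s]$ for which $\Lambda$ is LIDS with respect to some power $L^m$ ($m\geq1$) of the inflation; (4c) $W-s$ is mutually constructable from $A^p(W-s)$ for some $p\in\mathbb{N}$, $p\ge1$. If $L$ is expansive, (4c) may be replaced with the weaker condition (4d) $W-s$ is constructable from $A^p(W-s)$ for some $p\in\mathbb{N}$, $p\ge1$.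
   Context: **Patterns.** A Delone multiset in a finite-dimensional real normed space $E$ is a tuple $\Lambda=(\Lambda_1,\dots,\Lambda_\ell)$ of subsets of $E$ whose union is uniformly discrete and relatively dense. Translates $\Lambda+x$ and linear images $L\Lambda$ are taken componentwise. A patch of $\Lambda$ is a tuple $(\Lambda_i\cap U)_i$ with $U$ bounded. With $B(x,r)$ the closed ball, $\Lambda[x,r]:=((\Lambda_i\cap B(x,r))-x)_i$. $\mathcal{Q}$ is locally derivable (LD) from $\mathcal{P}$ if there is $c\ge0$ such that for all $x,y\in E$, $\mathcal{P}[x,c]=\mathcal{P}[y,c]$ implies $\mathcal{Q}[x,0]=\mathcal{Q}[y,0]$; MLD if each is LD from the other. $\mathcal{P}$ is locally indistinguishable (LI) from $\mathcal{Q}$ if every patch of $\mathcal{P}$ occurs, up to translation, in $\mathcal{Q}$; locally isomorphic if each is LI from the other. The hull $\Omega_{\mathcal{P}}$ is the set of all patterns LI from $\mathcal{P}$, with the local topology (two patterns are close if they agree on a large ball about the origin up to a small translation). For a linear automorphism $L$ of $E$, $\mathcal{P}$ is $L$-Sub if there is $\mathcal{P}'$, locally isomorphic to $\mathcal{P}$, with $L\mathcal{P}'$ and $\mathcal{P}$ MLD; $\mathcal{P}$ is LIDS with respect to $L$ if $L\mathcal{P}$ and $\mathcal{P}$ are MLD. A linear map is expansive if all its eigenvalues have modulus $>1$. **Cut and project.** A Euclidean cut and project scheme $\mathcal{S}=(\mathbb{E},\mathbb{E}_\vee,\mathbb{E}_<,\Gamma)$ consists of a $k$-dimensional real vector space $\mathbb{E}$,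 complementary subspaces $\mathbb{E}_\vee$ of dimension $d>0$ and $\mathbb{E}_<$ of dimension $k-d>0$, and a full rank lattice $\Gamma\subset\mathbb{E}$. Write $x_\vee,x_<$ for the projections of $x$ to $\mathbb{E}_\vee,\mathbb{E}_<$ along $\mathbb{E}=\mathbb{E}_\vee\oplus\mathbb{E}_<$. It is required that $\gamma\mapsto\gamma_\vee$, $\gamma\mapsto\gamma_<$ are injective on $\Gamma$ and $\Gamma_<$ is dense in $\mathbb{E}_<$. A window is a finite tuple $W=(W_i)_{i=1}^\ell$ of compact, topologically regular (equal to the closure of their interior) subsets of $\mathbb{E}_<$, not all empty; translates and linear images are componentwise. It is non-singular if $\Gamma_<\cap\partial W_i=\emptyset$ for all $i$; then $\Lambda(\mathcal{S},W)=(\Lambda_i)_i$, $\Lambda_i=\{\gamma_\vee:\gamma\in\Gamma,\gamma_<\in W_i\}$. For arbitrary $W$, $\Omega(\mathcal{S},W):=\Omega_{\Lambda(\mathcal{S},W+t)}$ for any $t\in\mathbb{E}_<$ with $W+t$ non-singular (independent of $t$). A point $x\in\mathbb{E}$ is non-singular if $x_<\notin\bigcup_i\bigcup_{g\in\Gamma_<}(\partial W_i+g)$. **Torus parametrisation.** $\tau\colon\Omega(\mathcal{S},W)\to\mathbb{T}=\mathbb{E}/\Gamma$ is the unique continuous map with $\tau(\Lambda_x)=[x]$ for all non-singular $x$, where $\Lambda_x\in\Omega(\mathcal{S},W)$ has $i$th component $\{(\gamma+x)_\vee:\gamma\in\Gamma,(\gamma+x)_<\in W_i\}$. It is surjective and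 $\tau(\Lambda+v)=\tau(\Lambda)+[v]$ for $v\in\mathbb{E}_\vee$. **Constructability.** Let $\mathscr{B}$ be the Boolean algebra of topologically regular subsets of $\mathbb{E}_<$, with $U\wedge V=\mathrm{cl}(\mathrm{int}(U\cap V))$, $U\vee V=\mathrm{cl}(\mathrm{int}(U\cup V))$, $\neg U=\mathrm{cl}(\mathrm{int}(\mathbb{E}_<\setminus U))$. $\mathscr{B}(W)$ is the Boolean subalgebra generated by all $W_i+g$, $g\in\Gamma_<$. $W'$ is constructable from $W$ if $\mathscr{B}(W')\subseteq\mathscr{B}(W)$, mutually constructable if equality holds. *)

(* Defs.v *)
From HB Require Import structures.
From mathcomp Require Import all_boot all_order all_algebra.
From mathcomp Require Import all_classical all_reals all_analysis.
From mathcomp Require Import complex.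

Set Implicit Arguments.
Unset Strict Implicit.
Unset Printing Implicit Defensive.

Import Order.TTheory GRing.Theory Num.Theory.
Import numFieldNormedType.Exports.

Set Warnings "-redundant-canonical-projection".

Local Open Scope classical_set_scope.
Local Open Scope ring_scope.

#[short(type="normedVectType")]
HB.structure Definition NormedVector (R : numDomainType) :=
  {E of NormedModule R E & Vector R E}.

(* A subspace, seen as a vector space in its own right, carries the norm (hence
   the topology) induced by the ambient space. *)
Section SubspaceNorm.
Context (R : realType) (E : normedVectType R) (U : {vspace E}).

Definition subvs_norm (x : subvs_of U) : R := `|vsval x|.

Lemma subvs_normD x y : subvs_norm (x + y) <= subvs_norm x + subvs_norm y.
Proof. exact: ler_normD. Qed.

Lemma subvs_normZ (a : R) x : subvs_norm (a *: x) = `|a| * subvs_norm x.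
Proof. exact: normrZ. Qed.

Lemma subvs_norm0_eq0 x : subvs_norm x = 0 -> x = 0.
Proof. by move=> /normr0_eq0 x0; apply: val_inj; rewrite /= x0. Qed.

HB.instance Definition _ := Lmodule_isNormed.Build R (subvs_of U)
  subvs_normD subvs_normZ subvs_norm0_eq0.

End SubspaceNorm.

(* Tuples of subsets: used both for patterns and for windows. *)
Definition stuple (l : nat) (T : Type) := 'I_l -> set T.

Definition stuple_image (l : nat) (T T' : Type) (f : T -> T')
  (P : stuple l T) : stuple l T' := fun i => f @` P i.

Definition stuple_restrict (l : nat) (T : Type) (P : stuple l T)
  (U : set T) : stuple l T := fun i => P i `&` U.

Definition translate (E : zmodType) (t : E) (A : set E) : set E :=
  [set a + t | a in A].

Definition stuple_translate (l : nat) (E : zmodType) (t : E)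
  (P : stuple l E) : stuple l E := fun i => translate t (P i).

Section Patterns.
Context (R : realType) (E : normedVectType R).

Definition uniformly_discrete (A : set E) : Prop :=
  exists2 r : R, 0 < r & forall x y, A x -> A y -> x <> y -> r <= `|x - y|.

Definition relatively_dense (A : set E) : Prop :=
  exists r : R, forall x, exists2 y, A y & `|x - y| <= r.

Definition delone (l : nat) (P : stuple l E) : Prop :=
  uniformly_discrete (\bigcup_i P i) /\ relatively_dense (\bigcup_i P i).

(* The library's [closed_ball x 0] is empty, whereas B(x, 0) must be {x}. *)
Definition cball (x : E) (r : R) : set E := [set y | `|x - y| <= r].

Definition patch_at (l : nat) (P : stuple l E) (x : E) (r : R) : stuple l E :=
  stuple_translate (- x) (stuple_restrict P (cball x r)).

(* [locally_derivable Q P]: Q is LD from P. *)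
Definition locally_derivable (l' l : nat) (Q : stuple l' E) (P : stuple l E) :=
  exists2 c : R, 0 <= c &
    forall x y, patch_at P x c = patch_at P y c ->
                patch_at Q x 0 = patch_at Q y 0.

Definition mld (l' l : nat) (Q : stuple l' E) (P : stuple l E) : Prop :=
  locally_derivable Q P /\ locally_derivable P Q.

(* P is LI from Q.  An occurrence in Q of the patch of P on U is a translate
   of U on which Q shows exactly the translated patch, so that the empty places
   of a patch count as much as its points. *)
Definition locally_indistinguishable (l : nat) (P Q : stuple l E) : Prop :=
  forall U : set E, bounded_set U -> exists t : E,
    stuple_translate t (stuple_restrict P U) = stuple_restrict Q (translate t U).

Definition locally_isomorphic (l : nat) (P Q : stuple l E) : Prop :=
  locally_indistinguishable P Q /\ locally_indistinguishable Q P.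

Definition hull (l : nat) (P : stuple l E) : set (stuple l E) :=
  [set Q | delone Q /\ locally_indistinguishable Q P].

(* Basic neighbourhoods of the local topology, shrinking as e tends to 0. *)
Definition locally_close (l : nat) (e : R) (P Q : stuple l E) : Prop :=
  exists v w : E, [/\ `|v| <= e, `|w| <= e &
    patch_at (stuple_translate v P) 0 e^-1 =
    patch_at (stuple_translate w Q) 0 e^-1].

Definition lsub (L : 'End(E)) (l : nat) (P : stuple l E) : Prop :=
  exists P' : stuple l E,
    [/\ delone P', locally_isomorphic P' P & mld (stuple_image L P') P].

Definition lids (f : E -> E) (l : nat) (P : stuple l E) : Prop :=
  mld (stuple_image f P) P.

(* The eigenvalues are the complex ones, read off a matrix of L over R[i]. *)
Definition expansive (L : 'End(E)) : Prop :=
  let b := vbasis {:E} in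
  forall z : R[i],
    eigenvalue (map_mx (real_complex R) (passmx.mxof b b L)) z -> 1 < `|z|.

Definition full_rank_lattice (G : set E) : Prop :=
  exists2 b : (\dim {:E}).-tuple E, basis_of {:E} b &
    G = range (fun z : 'I_(\dim {:E}) -> int => \sum_i tnth b i *~ z i).

End Patterns.

Section RegularSets.
Context (T : topologicalType).

Definition boundary (U : set T) : set T := closure U `\` interior U.

Definition rmeet (U V : set T) : set T := closure (interior (U `&` V)).
Definition rjoin (U V : set T) : set T := closure (interior (U `|` V)).
Definition rneg (U : set T) : set T := closure (interior (~` U)).

Definition boolean_subalgebra (S : set (set T)) : Prop :=
  [/\ S `<=` @regclosed T, S set0, S setT & [/\
      forall U V, S U -> S V -> S (rmeet U V),
      forall U V, S U -> S V -> S (rjoin U V) &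
      forall U, S U -> S (rneg U)]].

End RegularSets.

(* The component of x in U along E = U (+) U'. *)
Definition proj_along (R : realType) (E : normedVectType R)
  (U U' : {vspace E}) (x : E) : subvs_of U := vsproj U (daddv_pi U U' x).

Record cp_scheme (R : realType) := CPScheme {
  ambient : normedVectType R;
  phys : {vspace ambient};
  internal : {vspace ambient};
  lattice : set ambient;
  cp_disjoint : (phys :&: internal = 0)%VS;
  cp_span : (phys + internal = fullv)%VS;
  cp_dim_phys : (0 < \dim phys)%N;
  cp_dim_internal : (0 < \dim internal)%N;
  cp_lattice : full_rank_lattice lattice;
  cp_inj_phys : set_inj lattice (proj_along phys internal);
  cp_inj_internal : set_inj lattice (proj_along internal phys);
  cp_dense : dense (proj_along internal phys @` lattice)
}.

Arguments lattice {R} c _.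

Definition proj_phys (R : realType) (S : cp_scheme R) :
  ambient S -> subvs_of (phys S) := proj_along (phys S) (internal S).

Definition proj_int (R : realType) (S : cp_scheme R) :
  ambient S -> subvs_of (internal S) := proj_along (internal S) (phys S).

Arguments proj_phys {R} S x.
Arguments proj_int {R} S x.

Section CutAndProject.
Context (R : realType) (S : cp_scheme R) (l : nat).

Local Notation E := (ambient S).
Local Notation V := (subvs_of (phys S)).
Local Notation H := (subvs_of (internal S)).

Definition window (W : stuple l H) : Prop :=
  (forall i, compact (W i) /\ regclosed (W i)) /\ exists i, W i !=set0.

Definition nonsingular_window (W : stuple l H) : Prop :=
  forall i, (proj_int S @` lattice S) `&` boundary (W i) = set0.

Definition cp_pattern (W : stuple l H) : stuple l V :=
  fun i => [set proj_phys S g | g in [set g | lattice S g /\ W i (proj_int S g)]].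

Definition cp_hull (W : stuple l H) : set (stuple l V) :=
  [set P | exists2 t : H, nonsingular_window (stuple_translate t W) &
                          hull (cp_pattern (stuple_translate t W)) P].

Definition nonsingular_point (W : stuple l H) (x : E) : Prop :=
  ~ (\bigcup_i \bigcup_(g in proj_int S @` lattice S)
       translate g (boundary (W i))) (proj_int S x).

Definition cp_pattern_at (W : stuple l H) (x : E) : stuple l V :=
  fun i => [set proj_phys S (g + x) |
            g in [set g | lattice S g /\ W i (proj_int S (g + x))]].

(* The point [x] of the torus E / Gamma, as a coset. *)
Definition torus_class (x : E) : set E := [set x + g | g in lattice S].

(* The third clause is continuity on the hull for the local topology and the
   quotient topology of the torus. *)
Definition torus_param (W : stuple l H) (tau : stuple l V -> set E) : Prop :=
  [/\ forall P, cp_hull W P -> exists x, tau P = torus_class x,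
      forall x, nonsingular_point W x -> tau (cp_pattern_at W x) = torus_class x &
      forall P x, cp_hull W P -> tau P = torus_class x ->
        forall e : R, 0 < e -> exists2 d : R, 0 < d &
          forall Q, cp_hull W Q -> locally_close d P Q ->
            exists2 y, tau Q = torus_class y & `|x - y| < e].

End CutAndProject.

Section Constructability.
Context (R : realType) (S : cp_scheme R).

Local Notation H := (subvs_of (internal S)).

Definition window_algebra (l : nat) (W : stuple l H) : set (set H) :=
  smallest (@boolean_subalgebra H)
    [set U | exists i, exists2 g, lattice S g &
             U = translate (proj_int S g) (W i)].

(* [constructable W' W]: W' is constructable from W. *)
Definition constructable (l' l : nat) (W' : stuple l' H) (W : stuple l H) :=
  window_algebra W' `<=` window_algebra W.

Definition mutually_constructable (l' l : nat)
    (W' : stuple l' H) (W : stuple l H) : Prop :=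
  window_algebra W' = window_algebra W.

End Constructability.

(* Main.v *)
(* A pattern of the hull over the point [v + s] of the torus is, up to the
   translation v, a limit of non-singular patterns with windows W - s + t as t
   tends to 0; such a pattern agrees with the window W - s at every lattice point
   whose internal coordinate avoids the boundary.  Two limits along the same
   parameters t are related by a local rule as soon as one window is constructable
   from the other, and conversely a local rule between two patterns forces
   constructability of the windows, since the boundaries are nowhere dense and the
   projected lattice is dense.  Hence (B) gives (4c) with p = m.

   Given (4c), joint limits define an injection f of the finite fibre over [s]
   into itself with f P MLD to L^p P; all points of a finite set are periodic
   under an injection, whence (A).  Given only (4d), f still has a periodic point
   P, which is locally derivable from L^m P for arbitrarily large multiples m of
   the period; when L is expansive, a pigeonhole argument on pairs of patches
   (recognizability) shows that L^m P is then locally derivable from P. *)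

Require Import Defs.
From HB Require Import structures.
From mathcomp Require Import all_boot all_order all_algebra.
From mathcomp Require Import all_classical all_reals all_analysis.
From mathcomp Require Import complex zify ring lra.

Set Implicit Arguments.
Unset Strict Implicit.
Unset Printing Implicit Defensive.

Import Order.TTheory GRing.Theory Num.Theory.
Import numFieldNormedType.Exports.

Local Open Scope classical_set_scope.
Local Open Scope ring_scope.

(** * Finite-dimensional normed spaces *)

(** The obstacle is the singular case: when a lattice point projects into the boundary of W - s, the
    window alone no longer decides whether it belongs to the pattern, and a fibre has several
    elements. Limits are therefore defined by approximations in which every lattice point of a ball
    is strictly inside or strictly outside the shifted window. That condition survives a small
    change of t, so t can be moved to a value that is generic for a second window too; an
    ultrafilter on such values of t then decides all boundary points of the second window
    coherently. This is what makes joint limits exist.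

    Injectivity of f comes from recovering L^p P from f P, that is, from A^p(W - s) being
    constructable from W - s. Under (4d) only the opposite direction is available, so f is merely
    eventually periodic on the finite fibre, and the missing derivability must come from
    expansiveness.

    Both passages between windows and patterns are finite: an element of the Boolean algebra depends
    on finitely many generators, and a local rule sees finitely many lattice points. *)

HB.instance Definition _ (R : realType) (m n : nat) :=
  Uniform_isComplete.Build 'M[R]_(m, n) cauchy_cvg.

Lemma translate_continuous (R : realType) (E : normedModType R) (h : E) :
  continuous (fun y : E => y + h).
Proof.
move=> y; apply: (@continuousD _ _ _ idfun (cst h)) => //; exact: cst_continuous.
Qed.

Lemma ltranslate_continuous (R : realType) (E : normedModType R) (h : E) :
  continuous (fun y : E => h + y).
Proof.
under eq_fun do rewrite addrC; exact: translate_continuous.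
Qed.

Lemma reflect_continuous (R : realType) (E : normedModType R) (h : E) :
  continuous (fun y : E => h - y).
Proof.
move=> y; apply: (@continuousB _ _ _ (cst h) idfun) => //; exact: cst_continuous.
Qed.

Section FiniteDimension.
Context {R : realType}.
Import VectorInternalTheory.

Lemma lipschitz0_continuous (E F : normedModType R) (f : {linear E -> F})
    (C : R) :
  (forall x, `|f x| <= C * `|x|) -> continuous f.
Proof.
move=> hC; apply: bounded_linear_continuous; apply/linear_boundedP.
exists C; split; first exact: num_real.
by move=> r Cr x; apply: le_trans (hC x) _; rewrite ler_wpM2r// ltW.
Qed.

Lemma row_linear_bounded n (F : normedModType R) (f : {linear 'rV[R]_n -> F}) :
  exists2 C : R, 0 < C & forall x, `|f x| <= C * `|x|.
Proof.
exists (1 + \sum_i `|f (delta_mx 0 i)|) => [|x].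
  by rewrite ltr_pwDl// sumr_ge0.
rewrite {1}(row_sum_delta x) linear_sum/=.
apply: le_trans (ler_norm_sum _ _ _) _.
rewrite mulrDl mul1r mulr_suml.
apply: ler_wpDl => //; apply: ler_sum => i _.
rewrite linearZ/= normrZ mulrC ler_wpM2l//.
rewrite [leRHS]/Num.norm/= mx_normrE.
by apply: le_trans (le_bigmax _ _ (0, i)).
Qed.

(** Equivalence of norms, in its nontrivial direction: the image under [r2v] of the unit sphere of
    coordinates is compact and misses 0, hence stays at distance at least e from 0; rescaling gives
    the constant e^-1. *)
Lemma v2r_bounded (E : normedVectType R) :
  exists2 C : R, 0 < C & forall x : E, `|v2r x| <= C * `|x|.
Proof.
have [C C0 hC] := @row_linear_bounded _ E r2v.
pose Sph := [set y : 'rV[R]_(dim E) | `|y| = 1].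
have cS : compact Sph.
  apply: bounded_closed_compact.
    exists 1; split; first exact: num_real.
    by move=> x x1 y; rewrite /Sph/= => ->; exact: ltW.
  rewrite (_ : Sph = (fun y => `|y|) @^-1` [set 1])//.
  apply: closed_comp; last exact: closed_eq.
  by move=> y _; exact: norm_continuous.
have rc : continuous (r2v : 'rV[R]_(dim E) -> E) := lipschitz0_continuous hC.
have cI : closed (r2v @` Sph : set E).
  apply: compact_closed; first exact: norm_hausdorff.
  by apply: continuous_compact => //; exact: continuous_subspaceT.
have /nbhs_ballP[e /= e0 he] : nbhs (0 : E) (~` (r2v @` Sph)).
  apply: open_nbhs_nbhs; split; first exact: closed_openC.
  case=> y /= y1 /(congr1 v2r); rewrite r2vK linear0 => y0.
  by move: y1; rewrite /Sph/= y0 normr0 => /eqP; rewrite eq_sym oner_eq0.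
exists e^-1 => [|x]; first by rewrite invr_gt0.
have [->|x0] := eqVneq x 0; first by rewrite !raddf0 !normr0 mulr0.
have v0 : 0 < `|v2r x|.
  by rewrite normr_gt0 -(inj_eq (@r2v_inj _ _)) v2rK linear0.
rewrite -ler_pdivrMl ?invr_gt0// invrK leNgt; apply/negP => lte.
have := he (`|v2r x|^-1 *: x); rewrite -ball_normE/= sub0r normrN.
rewrite normrZ normfV normr_id ltr_pdivrMl// mulrC => /(_ lte); apply.
exists (`|v2r x|^-1 *: v2r x); last by rewrite linearZ/= v2rK.
by rewrite /Sph/= normrZ normfV normr_id mulVf// gt_eqF.
Qed.

Lemma linear_bounded (E : normedVectType R) (F : normedModType R)
    (f : {linear E -> F}) :
  exists2 C : R, 0 < C & forall x, `|f x| <= C * `|x|.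
Proof.
have [C C0 hC] := v2r_bounded E.
have [D D0 hD] := @row_linear_bounded _ F (f \o r2v).
exists (D * C) => [|x]; first exact: mulr_gt0.
rewrite -{1}(v2rK x); apply: le_trans (hD _) _.
by rewrite -mulrA ler_pM2l.
Qed.

Lemma linear_continuous (E : normedVectType R) (F : normedModType R)
    (f : {linear E -> F}) : continuous f.
Proof.
have [C C0 hC] := linear_bounded f.
exact: lipschitz0_continuous hC.
Qed.

Lemma cball_compact (E : normedVectType R) (x : E) (r : R) :
  compact (cball x r).
Proof.
have [C C0 hC] := v2r_bounded E.
have [D D0 hD] := @row_linear_bounded _ E r2v.
pose K := [set y : 'rV[R]_(dim E) | `|x - r2v y| <= r].
have rc : continuous (r2v : 'rV[R]_(dim E) -> E) := lipschitz0_continuous hD.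
rewrite (_ : cball x r = r2v @` K); last first.
  apply/seteqP; split => [z zr|z [y yr <-//]].
  by exists (v2r z); rewrite /K/= v2rK.
apply: continuous_compact; first exact: continuous_subspaceT.
apply: bounded_closed_compact.
  exists (C * (`|x| + r)); split; first exact: num_real.
  move=> M hM y yr; apply: ltW; apply: le_lt_trans hM.
  rewrite -(r2vK y); apply: le_trans (hC _) _.
  rewrite ler_pM2l// -(subrK x (r2v y)) addrC.
  by apply: le_trans (ler_normD _ _) _; rewrite lerD2l distrC.
rewrite (_ : K = r2v @^-1` cball x r)//.
by apply: closed_comp => [y _|]; [exact: rc|exact: closed_closed_ball_].
Qed.

(** Baire's theorem, transported from row vectors along the homeomorphism [r2v]. *)
Lemma dense_open_bigcap (E : normedVectType R) (F : (set E)^nat) :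
  (forall i, open (F i)) -> (forall i, dense (F i)) -> dense (\bigcap_i F i).
Proof.
have [C C0 hC] := v2r_bounded E.
have [D D0 hD] := @row_linear_bounded _ E r2v.
move=> oF dF.
have rc : continuous (r2v : 'rV[R]_(dim E) -> E) := lipschitz0_continuous hD.
have vc : continuous (v2r : E -> 'rV[R]_(dim E)) := @linear_continuous E _ v2r.
have odG i : open (r2v @^-1` F i) /\ dense (r2v @^-1` F i : set 'rV[R]_(dim E)).
  split; first by apply: open_comp => // y _; exact: rc.
  move=> O [y Oy] oO.
  have [||x [/= Ox Fx]] := dF i (v2r @^-1` O).
    by exists (r2v y); rewrite /= r2vK.
    by apply: open_comp => // z _; exact: vc.
  by exists (v2r x); split => //=; rewrite v2rK.
move=> O [x Ox] oO.
have [||y [/= Oy Gy]] := @Baire R 'rV[R]_(dim E) (fun i => r2v @^-1` F i) odG (r2v @^-1` O).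
- by exists (v2r x); rewrite /= v2rK.
- by apply: open_comp => // z _; exact: rc.
by exists (r2v y); split.
Qed.

End FiniteDimension.

(** * Regular closed sets *)

Section RegularClosedSets.
Context {T : topologicalType}.
Implicit Types (U V X C : set T) (x y : T).

Lemma open_sub_interior (O : set T) U : open O -> O `<=` U -> O `<=` interior U.
Proof. by move=> oO; rewrite -open_subsetE. Qed.

Lemma regclosed_closed U : regclosed U -> closed U.
Proof. by move=> <-; exact: closed_closure. Qed.

Lemma closure_int_regclosed U : regclosed (closure (interior U)).
Proof. exact/closure_open_regclosed/open_interior. Qed.

Lemma closure_int_sub U : closed U -> closure (interior U) `<=` U.
Proof.
move=> cU; rewrite [X in _ `<=` X](closure_id U).1//.
by apply: closureS; exact: interior_subset.
Qed.

Lemma rmeet_sub U V : closed U -> closed V -> rmeet U V `<=` U `&` V.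
Proof. by move=> cU cV; apply: closure_int_sub; exact: closedI. Qed.

Lemma open_sub_rmeet U V (O : set T) :
  open O -> O `<=` U `&` V -> O `<=` interior (rmeet U V).
Proof.
move=> oO OUV; apply: (open_sub_interior oO) => x Ox; apply: subset_closure.
exact: (open_sub_interior oO OUV Ox).
Qed.

Lemma rneg_disjoint U x : regclosed U -> interior (rneg U) x -> ~ U x.
Proof.
move=> rU inx Ux; move: (Ux); rewrite -{1}rU => /(_ _ inx)[y [iUy nUy]].
have [z [nUz Uz]] := nUy _ iUy.
exact: (interior_subset nUz).
Qed.

Lemma rneg_interior U x : closed U -> ~ U x -> interior (rneg U) x.
Proof.
move=> cU nUx; have oU : open (~` U) by exact: closed_openC.
apply: (open_sub_interior oU) => [y nUy|//].
apply: subset_closure; exact: (open_sub_interior oU (fun _ => id) nUy).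
Qed.

(** An open set inside X and C either meets the interior of U, or misses it and then misses U
    altogether because U is the closure of its interior; in both cases it contains a nonempty open
    part of one of the two pieces. *)
Lemma rmeet_split X C U : regclosed X -> regclosed C -> regclosed U ->
  rmeet X C = rjoin (rmeet X (rmeet C U)) (rmeet X (rmeet C (rneg U))).
Proof.
move=> rX rC rU.
have [[cX cC] cU] := (regclosed_closed rX, regclosed_closed rC,
                    regclosed_closed rU).
have cN : closed (rneg U) by exact: closed_closure.
have cM A B : closed (rmeet A B : set T) by exact: closed_closure.
apply/seteqP; split; last first.
  apply: closureS; apply: interiorS; rewrite subUset; split => x.
    by move=> /(rmeet_sub cX (cM _ _))[? /(rmeet_sub cC cU)[]].
  by move=> /(rmeet_sub cX (cM _ _))[? /(rmeet_sub cC cN)[]].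
apply: (subset_trans (B := closure (closure (interior
    (rmeet X (rmeet C U) `|` rmeet X (rmeet C (rneg U))))))); last first.
  by rewrite -(closure_id _).1//; exact: closed_closure.
apply: closureS => x; rewrite interiorI => -[iXx iCx] N Nx.
pose N' := interior N `&` (interior X `&` interior C).
have oN' : open N' by apply: openI; [|apply: openI]; exact: open_interior.
have N'x : N' x by [].
have sub Z : open Z -> Z `<=` N' -> Z `<=` U \/ Z `<=` ~` U -> Z !=set0 ->
    interior (rmeet X (rmeet C U) `|` rmeet X (rmeet C (rneg U))) `&` N !=set0.
  move=> oZ ZN' ZU [z Zz]; exists z; split; last first.
    by have [/interior_subset ? _] := ZN' _ Zz.
  case: ZU => ZU; [apply: (interiorS (@subsetUl _ _ _)) |
                   apply: (interiorS (@subsetUr _ _ _))].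
    apply: (@open_sub_rmeet _ _ Z) => // w Zw.
    have [_ [/interior_subset ? iCw]] := ZN' _ Zw; split => //.
    apply: subset_closure; rewrite interiorI; split => //.
    exact: (open_sub_interior oZ ZU Zw).
  apply: (@open_sub_rmeet _ _ Z) => // w Zw.
  have [_ [/interior_subset ? iCw]] := ZN' _ Zw; split => //.
  apply: subset_closure; rewrite interiorI; split => //.
  by apply: rneg_interior => //; exact: ZU.
have [[y [N'y Uy]]|N'U] := pselect (N' `&` interior U !=set0).
  apply: (sub (N' `&` interior U)); last by exists y.
  - by apply: openI => //; exact: open_interior.
  - by move=> ? [].
  - by left => ? [_ /interior_subset].
apply: (sub N') => //; last by exists x.
right => y N'y; rewrite -rU => /(_ N').
rewrite setIC => UN'; apply: N'U; apply: UN'.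
exact: open_nbhs_nbhs.
Qed.

(** A boundary point agrees with nothing, not even with itself. This strictness is what lets the
    relation pass through the regularised Boolean operations. *)
Definition agree U x y :=
  (interior U x /\ interior U y) \/ (~ U x /\ ~ U y).

Lemma agree_sym U x y : agree U x y -> agree U y x.
Proof. by move=> [[]|[]]; [left|right]. Qed.

Lemma agree_rmeet U V x y : closed U -> closed V ->
  agree U x y -> agree V x y -> agree (rmeet U V) x y.
Proof.
move=> cU cV aU aV.
have nn z : ~ U z \/ ~ V z -> ~ rmeet U V z.
  by move=> + /(rmeet_sub cU cV)[]; case.
case: aU => [[Ux Uy]|[Ux Uy]]; last by right; split; apply: nn; left.
case: aV => [[Vx Vy]|[Vx Vy]]; last by right; split; apply: nn; right.
left; split; apply: (@open_sub_rmeet _ _ (interior (U `&` V))).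
- exact: open_interior.
- exact: interior_subset.
- by rewrite interiorI.
- exact: open_interior.
- exact: interior_subset.
- by rewrite interiorI.
Qed.

Lemma agree_rneg U x y : regclosed U -> agree U x y -> agree (rneg U) x y.
Proof.
move=> rU [[Ux Uy]|[Ux Uy]].
  right; split=> /(_ U); [move=> /(_ Ux)|move=> /(_ Uy)];
    by move=> [z [/interior_subset]].
by left; split; apply: rneg_interior => //; exact: regclosed_closed.
Qed.

Lemma agree_rjoin U V x y : closed U -> closed V ->
  agree U x y -> agree V x y -> agree (rjoin U V) x y.
Proof.
move=> cU cV aU aV.
have sub A z : A `<=` U `|` V -> interior A z -> interior (rjoin U V) z.
  move=> AUV Az; have oA := open_interior A.
  apply: (open_sub_interior oA) Az => w Aw.
  by apply: subset_closure; exact: interiorS Aw.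
have nn z : ~ U z -> ~ V z -> ~ rjoin U V z.
  by move=> nU nV /(closure_int_sub (closedU cU cV))[].
case: aU => [[Ux Uy]|[Ux Uy]].
  by left; split; [exact: sub Ux|exact: sub Uy].
case: aV => [[Vx Vy]|[Vx Vy]]; last by right; split; apply: nn.
by left; split; [exact: sub Vx|exact: sub Vy].
Qed.

Lemma rmeet_sub_id U V : regclosed U -> U `<=` V -> rmeet U V = U.
Proof. by move=> rU UV; rewrite /rmeet (setIidl UV). Qed.

(* Split the cell C along f j for each j in js, so that X is constant on the
   dense set D within every piece. *)
Lemma boolean_subalgebra_agree (B : set (set T)) (D X : set T) (J : eqType)
    (f : J -> set T) (js : seq J) C :
  boolean_subalgebra B -> dense D -> regclosed X ->
  (forall j, j \in js -> B (f j)) -> B C ->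
  (forall x y, D x -> D y -> interior C x -> interior C y ->
     (forall j, j \in js -> agree (f j) x y) -> X x -> X y) ->
  B (rmeet X C).
Proof.
move=> [Breg B0 BT [BI BU BN]] dD rX.
elim: js C => [|j js IH] C Bf BC hX.
  have rC := Breg _ BC.
  (* With no generator left, X is constant on the dense points inside C: either X contains C, and
     the meet is C, or X and C have no common interior, and the meet is empty. *)
  have [[x [Dx Cx Xx]]|no] := pselect (exists x, [/\ D x, interior C x & X x]).
    have CX : C `<=` X.
      rewrite -rC (closure_id X).1; last exact: regclosed_closed.
      rewrite [X in _ `<=` X](closure_id _).1; last exact: closed_closure.
      apply: closureS => z Cz N Nz.
      have [||w [[Nw Cw] Dw]] := dD (interior N `&` interior C).
      - by exists z.
      - by apply: openI; exact: open_interior.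
      exists w; split; last exact: interior_subset.
      exact: hX Xx.
    by rewrite /rmeet setIC -/(rmeet C X) rmeet_sub_id.
  suff -> : rmeet X C = set0 by [].
  suff iXC : interior (X `&` C) = set0 by rewrite /rmeet iXC closure0.
  apply/seteqP; split => // w iw.
  have [||v [iv Dv]] := dD (interior (X `&` C)).
  - by exists w.
  - exact: open_interior.
  by apply: no; exists v; move: iv; rewrite interiorI => -[/interior_subset].
have Bj := Bf _ (mem_head _ _); have rf := Breg _ Bj; have rC := Breg _ BC.
have [cf cC] := (regclosed_closed rf, regclosed_closed rC).
have cN : closed (rneg (f j)) by exact: closed_closure.
have Bf' k : k \in js -> B (f k) by move=> kj; apply: Bf; rewrite inE kj orbT.
rewrite (rmeet_split rX rC rf); apply: BU; apply: IH => //.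
- exact: BI.
- move=> x y Dx Dy /(interiorS (rmeet_sub cC cf)) + /(interiorS (rmeet_sub cC cf)).
  rewrite interiorI => -[Cx Ux] [Cy Uy] hag; apply: hX => // k.
  by rewrite inE => /predU1P[->|]; [left|exact: hag].
- by apply: BI => //; exact: BN.
- move=> x y Dx Dy /(interiorS (rmeet_sub cC cN)) + /(interiorS (rmeet_sub cC cN)).
  rewrite interiorI => -[Cx Ux] [Cy Uy] hag; apply: hX => // k.
  rewrite inE => /predU1P[->|]; last exact: hag.
  by right; split; exact: rneg_disjoint.
Qed.

Definition off_boundary U := interior U `|` ~` U.

Lemma boundaryE U : closed U -> boundary U = ~` off_boundary U.
Proof.
move=> cU; rewrite /boundary /off_boundary -(closure_id U).1//.
by rewrite setCU setCK setIC.
Qed.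

Lemma off_boundary_open U : closed U -> open (off_boundary U).
Proof.
by move=> cU; apply: openU; [exact: open_interior|exact: closed_openC].
Qed.

Lemma off_boundary_dense U : dense (off_boundary U).
Proof.
move=> O [x Ox] oO.
have [OU|/existsNP[y /not_implyP[Oy nUy]]] := pselect (O `<=` U).
  by exists x; split => //; left; exact: (open_sub_interior oO OU Ox).
by exists y; split => //; right.
Qed.

Lemma dense_seq_bigcap (J : eqType) (f : J -> set T) (js : seq J) :
  (forall j, j \in js -> open (f j) /\ dense (f j)) ->
  open [set x | forall j, j \in js -> f j x] /\
  dense [set x | forall j, j \in js -> f j x].
Proof.
elim: js => [_|j js IH h].
  rewrite (_ : mkset _ = setT); last by apply/seteqP; split.
  by split; [exact: openT|move=> O [x Ox] oO; exists x].
have hjs k : k \in js -> open (f k) /\ dense (f k).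
  by move=> kj; apply: h; rewrite inE kj orbT.
have [oj dj] := IH hjs.
have [ofj dfj] := h _ (mem_head _ _).
rewrite (_ : mkset _ = f j `&` [set x | forall j, j \in js -> f j x]).
  by split; [exact: openI|exact: denseI].
apply/seteqP; split => x hx.
  by split; [exact/hx/mem_head|move=> k kj; apply: hx; rewrite inE kj orbT].
by move=> k; rewrite inE => /predU1P[->|]; [case: hx|exact: hx.2].
Qed.

Lemma near_seq (J : eqType) (F : set_system T) (FF : Filter F)
    (Q : J -> set T) (js : seq J) :
  (forall j, j \in js -> F (Q j)) ->
  F [set x | forall j, j \in js -> Q j x].
Proof.
elim: js => [_|j js IH h]; first by apply: filterS filterT.
have : F [set x | forall j, j \in js -> Q j x].
  by apply: IH => k kj; apply: h; rewrite inE kj orbT.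
apply: filterS2 (h _ (mem_head _ _)) => x Qx hx k.
by rewrite inE => /predU1P[->|/hx].
Qed.

End RegularClosedSets.

Section HomeomorphicImages.
Context {T T' : topologicalType} (f : T -> T') (g : T' -> T).
Hypotheses (fK : cancel f g) (gK : cancel g f).

Lemma can_image_preimage (A : set T) : f @` A = g @^-1` A.
Proof.
apply/seteqP; split => [_ [x Ax <-]/=|y Ay]; first by rewrite fK.
by exists (g y).
Qed.

Hypotheses (cf : continuous f) (cg : continuous g).

Lemma interior_homeo (A : set T) : interior (f @` A) = f @` interior A.
Proof.
apply/seteqP; split => [y|_ [x Ax <-]].
  move=> iy; exists (g y) => //.
  have h : nbhs (g y) (f @^-1` (f @` A)) by apply: cf; rewrite gK.
  by apply: filterS h => z /= [w Aw /(can_inj fK) <-].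
rewrite /interior can_image_preimage; apply: cg; rewrite fK.
exact: Ax.
Qed.

Lemma closure_homeo (A : set T) : closure (f @` A) = f @` closure A.
Proof.
have fC B : f @` (~` B) = ~` (f @` B) by rewrite !can_image_preimage.
have := interior_homeo (~` A).
by rewrite fC !interiorC fC => /(congr1 setC); rewrite !setCK.
Qed.

Lemma regclosed_homeo (A : set T) : regclosed A -> regclosed (f @` A).
Proof. by rewrite /regclosed interior_homeo closure_homeo => ->. Qed.

End HomeomorphicImages.

(** * Lattices *)

Section Lattices.
Context {R : realType} {E : normedVectType R} (G : set E).
Hypothesis latG : full_rank_lattice G.

Lemma lattice0 : G 0.
Proof.
have [b _ ->] := latG; exists (fun=> 0) => //.
by rewrite big1// => i _; rewrite mulr0z.
Qed.

Lemma latticeB x y : G x -> G y -> G (x - y).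
Proof.
have [b _ ->] := latG => -[z1 _ <-] [z2 _ <-].
exists (fun i => z1 i - z2 i) => //; rewrite -sumrB.
by apply: eq_bigr => i _; rewrite mulrzBr.
Qed.

Lemma latticeN x : G x -> G (- x).
Proof. by move=> Gx; rewrite -sub0r; apply: latticeB => //; exact: lattice0. Qed.

Lemma latticeD x y : G x -> G y -> G (x + y).
Proof. by move=> Gx Gy; rewrite -[y]opprK; apply: latticeB => //; exact: latticeN. Qed.

Lemma lattice_sum_coord (b : (\dim {:E}).-tuple E) (z : 'I_(\dim {:E}) -> int) i :
  basis_of {:E} b -> coord b i (\sum_j tnth b j *~ z j) = (z i)%:~R.
Proof.
move=> bb; rewrite -(coord_sum_free (fun j => (z j)%:~R) i (basis_free bb)).
by congr (coord b i); apply: eq_bigr => j _; rewrite scaler_int -tnth_nth.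
Qed.

Lemma lattice_finite (r : R) : finite_set [set g | G g /\ `|g| <= r].
Proof.
have [b bb ->] := latG.
have /choice[C hC] : forall i : 'I_(\dim {:E}), exists C : R,
    forall x : E, `|coord b i x| <= C * `|x|.
  by move=> i; have [C _ hC] := @linear_bounded R E R (coord b i); exists C.
pose N := \max_i `|Num.ceil (`|C i| * `|r|)|%N.
(* Integer coordinates in [-N, N] are stored as naturals in [0, 2N]. *)
pose f (p : {ffun 'I_(\dim {:E}) -> 'I_(N + N).+1}) : E :=
  \sum_i tnth b i *~ ((p i)%:Z - N%:Z).
apply: (@sub_finite_set _ _ (f @` setT)); last exact/finite_image/finite_finset.
move=> g /= [[z _ <-]] gr.
have zN i : (`|z i| <= N)%N.
  have : `|coord b i (\sum_j tnth b j *~ z j)| <= `|C i| * `|r|.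
    apply: le_trans (hC i _) _; apply: le_trans (ler_norm _) _.
    rewrite normrM normr_id ler_wpM2l//.
    by apply: le_trans gr _; exact: ler_norm.
  rewrite lattice_sum_coord// => zi.
  apply: leq_trans (leq_bigmax i).
  rewrite -lez_nat !abszE.
  have c0 : 0 <= Num.ceil (`|C i| * `|r|) by rewrite ceil_ge0 (lt_le_trans (ltrN10 _))// mulr_ge0.
  rewrite (ger0_norm c0) -(ler_int R) (le_trans _ (ceil_ge _))//.
  by rewrite intr_norm.
exists [ffun i => inord (absz (z i + N%:Z)%R)] => //.
apply: eq_bigr => i _; rewrite ffunE inordK; last first.
  by move: (zN i); lia.
by congr (_ *~ _); move: (zN i); lia.
Qed.

Lemma lattice_relatively_dense :
  exists2 r : R, 0 < r & forall x, exists2 g, G g & `|x - g| <= r.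
Proof.
have [b bb Gb] := latG.
exists (1 + \sum_i `|tnth b i|) => [|x]; first by rewrite ltr_pwDl// sumr_ge0.
exists (\sum_i tnth b i *~ Num.floor (coord b i x)).
  by rewrite Gb; exists (fun i => Num.floor (coord b i x)).
rewrite {1}(coord_basis bb (memvf x)) -sumrB.
apply: le_trans (ler_norm_sum _ _ _) _.
apply: ler_wpDl => //; apply: ler_sum => i _.
rewrite -scaler_int -tnth_nth -scalerBl normrZ ler_piMl//.
have := floor_le (coord b i x); have := floorD1_gt (coord b i x).
rewrite intrD => h1 h2; rewrite ger0_norm ?subr_ge0//.
lra.
Qed.

Lemma lattice_countable : countable G.
Proof.
rewrite (_ : G = \bigcup_n [set g | G g /\ `|g| <= n%:R]).
  by apply: bigcup_countable => // n _; apply: finite_set_countable; exact: lattice_finite.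
apply/seteqP; split => [g Gg|g [n _ []]//].
exists (Num.bound `|g|) => //; split => //.
exact/ltW/archi_boundP.
Qed.

End Lattices.

(** * Local derivability *)

Section LocalDerivability.
Context {R : realType} {E : normedVectType R}.
Implicit Types (x y u v : E) (c r : R).

Definition agree_at l (P : stuple l E) x (Q : stuple l E) y r :=
  forall k u, `|u| <= r -> (P k (x + u) <-> Q k (y + u)).

Lemma translateE v (A : set E) x : translate v A x <-> A (x - v).
Proof.
split => [[a Aa <-]|Axv]; first by rewrite addrK.
by exists (x - v) => //; rewrite subrK.
Qed.

Lemma patch_at_eqP l (P Q : stuple l E) x y r :
  patch_at P x r = patch_at Q y r <-> agree_at P x Q y r.
Proof.
have eqP' (P' : stuple l E) z k u :
    patch_at P' z r k u <-> P' k (z + u) /\ `|u| <= r.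
  rewrite /patch_at /stuple_translate translateE opprK addrC /stuple_restrict/=.
  by rewrite /cball/= opprD addNKr normrN.
split => [ePQ k u ur|aPQ].
  have h := eqP' P x k u; have h' := eqP' Q y k u; rewrite ePQ in h.
  split => hu.
    by have /h/h'[] : P k (x + u) /\ `|u| <= r by [].
  by have /h'/h[] : Q k (y + u) /\ `|u| <= r by [].
apply/funext => k; apply/seteqP; split => u /eqP' [Pu ur]; apply/eqP'; split => //.
  exact/(aPQ k u ur).
exact/(aPQ k u ur).
Qed.

Lemma agree_at0 l (P Q : stuple l E) x y :
  agree_at P x Q y 0 <-> forall k, P k x <-> Q k y.
Proof.
split => [h k|h k u]; first by rewrite -[x]addr0 -[y]addr0; apply: h; rewrite normr0.
by rewrite normr_le0 => /eqP ->; rewrite !addr0.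
Qed.

Lemma agree_at_sym l (P Q : stuple l E) x y r :
  agree_at P x Q y r -> agree_at Q y P x r.
Proof. by move=> h k u ur; apply: iff_sym; exact: h. Qed.

Lemma agree_at_trans l (P Q T : stuple l E) x y z r :
  agree_at P x Q y r -> agree_at Q y T z r -> agree_at P x T z r.
Proof. by move=> h1 h2 k u ur; rewrite (h1 k u ur); exact: h2. Qed.

Lemma agree_at_le l (P Q : stuple l E) x y r r' :
  r' <= r -> agree_at P x Q y r -> agree_at P x Q y r'.
Proof. by move=> rr h k u ur; apply: h; exact: le_trans rr. Qed.

Lemma agree_at_shift l (P Q : stuple l E) x y v c r :
  `|v| <= c -> agree_at P x Q y (r + c) -> agree_at P (x + v) Q (y + v) r.
Proof.
move=> vc h k u ur; rewrite -!addrA; apply: h.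
by rewrite addrC (le_trans (ler_normD _ _))// lerD.
Qed.

Lemma locally_derivableP l' l (Q : stuple l' E) (P : stuple l E) :
  locally_derivable Q P <->
  exists2 c : R, 0 <= c & forall x y, agree_at P x P y c ->
    forall k, Q k x <-> Q k y.
Proof.
split => -[c c0 h]; exists c => // x y.
  by move=> /patch_at_eqP /h /patch_at_eqP /agree_at0.
by move=> /patch_at_eqP /h ?; apply/patch_at_eqP/agree_at0.
Qed.

Lemma locally_derivable_agree l' l (Q : stuple l' E) (P : stuple l E) :
  locally_derivable Q P ->
  exists2 c : R, 0 <= c & forall x y r, 0 <= r ->
    agree_at P x P y (r + c) -> agree_at Q x Q y r.
Proof.
move=> /locally_derivableP[c c0 h]; exists c => // x y r r0 hP k u ur.
apply: h; apply: (@agree_at_shift _ _ _ _ _ _ r) => //.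
by rewrite addrC.
Qed.

Lemma locally_derivable_refl l (P : stuple l E) : locally_derivable P P.
Proof. by exists 0. Qed.

Lemma locally_derivable_trans l1 l2 l3 (P : stuple l1 E) (Q : stuple l2 E)
    (T : stuple l3 E) :
  locally_derivable P Q -> locally_derivable Q T -> locally_derivable P T.
Proof.
move=> /locally_derivableP[c c0 h] /locally_derivable_agree[c' c'0 h'].
apply/locally_derivableP; exists (c + c'); first exact: addr_ge0.
by move=> x y hT; apply: h; apply: h'.
Qed.

Lemma locally_derivable_translate l' l (Q : stuple l' E) (P : stuple l E) u v :
  locally_derivable Q P ->
  locally_derivable (stuple_translate u Q) (stuple_translate v P).
Proof.
move=> /locally_derivableP[c c0 h].
apply/locally_derivableP; exists (c + `|v - u|); first exact: addr_ge0.
move=> x y hT k; rewrite /stuple_translate !translateE; apply: h => j w wc.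
have := hT j (w + (v - u)).
rewrite /stuple_translate !translateE.
have e z : z + (w + (v - u)) - v = z - u + w.
  by rewrite (addrCA w) (addrCA z) addrAC subrr add0r addrA addrAC.
rewrite !e; apply.
by apply: le_trans (ler_normD _ _) _; rewrite lerD2r.
Qed.

Lemma mld_refl l (P : stuple l E) : mld P P.
Proof. by split; exact: locally_derivable_refl. Qed.

Lemma mld_trans l1 l2 l3 (P : stuple l1 E) (Q : stuple l2 E) (T : stuple l3 E) :
  mld P Q -> mld Q T -> mld P T.
Proof. by move=> [? ?] [? ?]; split; exact: (locally_derivable_trans (Q := Q)). Qed.

Lemma mld_translate l' l (Q : stuple l' E) (P : stuple l E) u v :
  mld Q P -> mld (stuple_translate u Q) (stuple_translate v P).
Proof. by move=> [? ?]; split; exact: locally_derivable_translate. Qed.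

Lemma translate0 (A : set E) : translate 0 A = A.
Proof. by apply/seteqP; split => x; rewrite translateE subr0. Qed.

Lemma stuple_translate0 l (P : stuple l E) : stuple_translate 0 P = P.
Proof. by apply/funext => k; exact: translate0. Qed.

Lemma stuple_translateD l (P : stuple l E) u v :
  stuple_translate u (stuple_translate v P) = stuple_translate (u + v) P.
Proof.
apply/funext => k; apply/seteqP; split => x;
  by rewrite /stuple_translate !translateE opprD addrA.
Qed.

Lemma stuple_translateK l (P : stuple l E) u :
  stuple_translate u (stuple_translate (- u) P) = P.
Proof. by rewrite stuple_translateD subrr stuple_translate0. Qed.

End LocalDerivability.

Section LinearImages.
Context {R : realType} {E : normedVectType R} (T : 'End(E)).
Hypothesis kT : lker T = 0%VS.

Let kT' : lker T == 0%VS. Proof. exact/eqP. Qed.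

Lemma stuple_imageE l (P : stuple l E) k x :
  stuple_image T P k x <-> P k ((T^-1)%VF x).
Proof.
rewrite /stuple_image; split => [[y Py <-]|Px]; first by rewrite lker0_lfunK.
by exists ((T^-1)%VF x) => //; rewrite lker0_lfunVK.
Qed.

Lemma locally_derivable_image l' l (Q : stuple l' E) (P : stuple l E) :
  locally_derivable Q P ->
  locally_derivable (stuple_image T Q) (stuple_image T P).
Proof.
have [C C0 hC] := @linear_bounded _ E E T.
move=> /locally_derivableP[c c0 h].
apply/locally_derivableP; exists (C * c); first by rewrite mulr_ge0// ltW.
move=> x y hP k; rewrite !stuple_imageE; apply: h => j u uc.
have := hP j (T u); rewrite !stuple_imageE !linearD/= lker0_lfunK//; apply.
by apply: le_trans (hC _) _; rewrite ler_pM2l.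
Qed.

Lemma mld_image l' l (Q : stuple l' E) (P : stuple l E) :
  mld Q P -> mld (stuple_image T Q) (stuple_image T P).
Proof. by move=> [? ?]; split; exact: locally_derivable_image. Qed.

Lemma stuple_image_translate l (P : stuple l E) u :
  stuple_image T (stuple_translate u P) = stuple_translate (T u) (stuple_image T P).
Proof.
apply/funext => k; apply/seteqP; split => x.
  move=> /stuple_imageE; rewrite /stuple_translate !translateE => h.
  by apply/stuple_imageE; rewrite linearB/= lker0_lfunK.
rewrite /stuple_translate translateE => /stuple_imageE.
rewrite linearB/= lker0_lfunK// => h; apply/stuple_imageE.
by rewrite translateE.
Qed.

End LinearImages.

Section LinearPowers.
Context {R : realType} {E : normedVectType R}.

(** [iter p T] is a bare function; here it is a linear map, to which the results on kernels and
    images apply. *)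
Definition lfun_iter p (T : 'End(E)) : 'End(E) := iter p (comp_lfun T) \1%VF.

Lemma lfun_iterE p T : lfun_iter p T =1 iter p T.
Proof.
by elim: p => [|p IH] x; rewrite /lfun_iter/= ?id_lfunE// comp_lfunE -IH.
Qed.

Lemma lfun_iter_ker p (T : 'End(E)) : lker T = 0%VS -> lker (lfun_iter p T) = 0%VS.
Proof.
move=> /eqP/lker0P iT; apply/eqP/lker0P; elim: p => [|p IH] x y.
  by rewrite !id_lfunE.
by rewrite !comp_lfunE => /iT/IH.
Qed.

Lemma stuple_image_iter p (T : 'End(E)) l (P : stuple l E) :
  stuple_image (iter p T) P = stuple_image (lfun_iter p T) P.
Proof. by congr stuple_image; apply/funext => x; rewrite lfun_iterE. Qed.

Lemma stuple_image_comp l (f g : E -> E) (P : stuple l E) :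
  stuple_image f (stuple_image g P) = stuple_image (f \o g) P.
Proof. by apply/funext => k; rewrite /stuple_image image_comp. Qed.

End LinearPowers.

(** * Projections of the lattice *)

Section Projections.
Context {R : realType} (S : cp_scheme R).
Local Notation E := (ambient S).
Local Notation V := (subvs_of (phys S)).
Local Notation H := (subvs_of (internal S)).

Lemma proj_phys_is_linear : linear (proj_phys S).
Proof. by move=> a x y; rewrite /proj_phys /proj_along !linearP. Qed.

Lemma proj_int_is_linear : linear (proj_int S).
Proof. by move=> a x y; rewrite /proj_int /proj_along !linearP. Qed.

HB.instance Definition _ := GRing.isLinear.Build R E V _ (proj_phys S)
  proj_phys_is_linear.
HB.instance Definition _ := GRing.isLinear.Build R E H _ (proj_int S)
  proj_int_is_linear.

Lemma proj_sum (x : E) : vsval (proj_phys S x) + vsval (proj_int S x) = x.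
Proof.
rewrite /proj_phys /proj_int /proj_along !vsprojK ?memv_pi//.
by rewrite daddv_pi_add ?cp_span ?memvf ?cp_disjoint.
Qed.

Lemma phys_int_eq (v v' : V) (h h' : H) :
  vsval v + vsval h = vsval v' + vsval h' -> v = v' /\ h = h'.
Proof.
move=> e.
have : vsval (v - v') = vsval (h' - h).
  by rewrite !linearB/=; apply/eqP; rewrite subr_eq addrAC eq_sym subr_eq addrC e addrC.
move=> vh; have : vsval (v - v') \in (phys S :&: internal S)%VS.
  by rewrite memv_cap subvsP vh subvsP.
rewrite cp_disjoint memv0 => /eqP v0.
have e0 : v - v' = 0 by apply: subvs_inj; rewrite v0 linear0.
have h0 : h' - h = 0 by apply: subvs_inj; rewrite -vh v0 linear0.
by rewrite (subr0_eq e0) (subr0_eq h0).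
Qed.

Lemma proj_phys_add (v : V) (h : H) : proj_phys S (vsval v + vsval h) = v.
Proof. by have [] := phys_int_eq (proj_sum (vsval v + vsval h)). Qed.

Lemma proj_int_add (v : V) (h : H) : proj_int S (vsval v + vsval h) = h.
Proof. by have [] := phys_int_eq (proj_sum (vsval v + vsval h)). Qed.

Lemma proj_phys_phys (v : V) : proj_phys S (vsval v) = v.
Proof. by rewrite -[vsval v]addr0 -(linear0 (vsval : H -> E)) proj_phys_add. Qed.

Lemma proj_int_phys (v : V) : proj_int S (vsval v) = 0.
Proof. by rewrite -[vsval v]addr0 -(linear0 (vsval : H -> E)) proj_int_add. Qed.

Lemma proj_int_int (h : H) : proj_int S (vsval h) = h.
Proof. by rewrite -[vsval h]add0r -(linear0 (vsval : V -> E)) proj_int_add. Qed.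

Lemma proj_phys_int (h : H) : proj_phys S (vsval h) = 0.
Proof. by rewrite -[vsval h]add0r -(linear0 (vsval : V -> E)) proj_phys_add. Qed.

Lemma norm_proj_le (x : E) : `|x| <= `|proj_phys S x| + `|proj_int S x|.
Proof. by rewrite -{1}(proj_sum x); exact: ler_normD. Qed.

Lemma proj_bounded : exists2 C : R, 0 < C &
  forall x, `|proj_phys S x| <= C * `|x| /\ `|proj_int S x| <= C * `|x|.
Proof.
have [C C0 hC] := linear_bounded (proj_phys S).
have [D D0 hD] := linear_bounded (proj_int S).
exists (C + D) => [|x]; first exact: addr_gt0.
split; rewrite mulrDl.
  by apply: ler_wpDr; [rewrite mulr_ge0// ltW|exact: hC].
by apply: ler_wpDl; [rewrite mulr_ge0// ltW|exact: hD].
Qed.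

End Projections.

Section SchemeLattice.
Context {R : realType} {S : cp_scheme R}.
Local Notation E := (ambient S).
Local Notation V := (subvs_of (phys S)).
Local Notation H := (subvs_of (internal S)).
Local Notation G := (lattice S).
Local Notation pv := (proj_phys S).
Local Notation ph := (proj_int S).
Local Notation latG := (@cp_lattice R S).

Lemma lattice_phys_inj (g g' : E) : G g -> G g' -> pv g = pv g' -> g = g'.
Proof. by move=> Gg Gg' e; apply: (@cp_inj_phys _ S) => //; exact/mem_set. Qed.

Lemma lattice_box (r r' : R) :
  exists s : seq E, (forall g, g \in s -> G g) /\
    forall g, G g -> `|pv g| <= r -> `|ph g| <= r' -> g \in s.
Proof.
have /finite_seqP[s hs] := lattice_finite latG (r + r').
exists s; split => [g gs|g Gg gr gr'].
  by have : [set` s] g by []; rewrite -hs => -[].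
have : [set g | G g /\ `|g| <= r + r'] g.
  by split => //; apply: le_trans (norm_proj_le _) _; exact: lerD.
by rewrite hs.
Qed.

Lemma lattice_int_dense (O : set H) (h : H) : open O -> O !=set0 ->
  exists2 g, G g & O (ph g + h).
Proof.
move=> oO [x Ox].
have [||y [Oy [g Gg gy]]] := @cp_dense R S [set y | O (y + h)].
- by exists (x - h); rewrite /= subrK.
- exact: (open_comp (f := fun y : H => y + h)
    (fun y _ => @translate_continuous R H h y) oO).
by exists g => //; rewrite /proj_int gy.
Qed.

(** A lattice point near v in the whole space has internal coordinate in a fixed compact ball.
    Finitely many lattice translations suffice to carry every point of that ball into O, and their
    physical parts bound the extra displacement. *)
Lemma lattice_strip_dense (O : set H) : open O -> O !=set0 ->
  exists2 r : R, 0 < r & forall v : V, exists g,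
    [/\ G g, O (ph g) & `|v - pv g| <= r].
Proof.
move=> oO O0.
have [r0 r00 hr0] := lattice_relatively_dense latG.
have [C C0 hC] := proj_bounded S.
have := @cball_compact R H 0 (C * r0); rewrite compact_cover => cover.
have [||D DG hD] := cover _ G (fun g => [set h | O (ph g + h)]).
- move=> g Gg; exact: (open_comp (f := fun y : H => ph g + y) (fun y _ => @ltranslate_continuous R H (ph g) y) oO).
- move=> h _; have [g Gg Og] := lattice_int_dense h oO O0.
  by exists g.
pose M := \sum_(g <- (finmap.enum_fset D)) `|pv g|.
have M0 : 0 <= M by rewrite sumr_ge0.
exists (C * r0 + M) => [|v]; first by rewrite ltr_pwDl// mulr_gt0.
have [g0 Gg0 vg0] := hr0 (vsval v).
have [hv hh] := hC (vsval v - g0).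
have : cball (0 : H) (C * r0) (ph g0).
  rewrite /cball/= sub0r -[- ph g0]add0r -(proj_int_phys v) -linearB/=.
  by apply: le_trans hh _; rewrite ler_pM2l.
move=> /hD[g gD Og]; have Gg : G g by have := DG _ gD; rewrite inE.
exists (g + g0); split; first exact: (latticeD latG).
  by rewrite linearD.
rewrite linearD/= opprD addrCA (le_trans (ler_normD _ _))// [leRHS]addrC lerD//; last first.
  rewrite -{1}(proj_phys_phys v) -linearB/=.
  by apply: le_trans hv _; rewrite ler_pM2l.
rewrite normrN /M.
have : g \in (finmap.enum_fset D) by [].
elim: (finmap.enum_fset D) => //= a s IH; rewrite inE big_cons => /predU1P[->|/IH ?].
  by rewrite lerDl sumr_ge0.
by apply: ler_wpDl.
Qed.

(* Join 0 to the internal coordinate of g by a chain of lattice points with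
   small steps. *)
Lemma lattice_small_generate (P : E -> Prop) (e : R) : 0 < e ->
  (forall x y, G x -> G y -> P x -> P y -> P (x + y)) ->
  (forall g, G g -> `|ph g| < e -> P g) -> forall g, G g -> P g.
Proof.
move=> e0 PD Psmall g Gg.
(* The segment from 0 to [ph g] is cut into n steps shorter than e / 3. With lattice points within e
   / 3 of the subdivision points, consecutive differences stay below e. *)
pose n := (Num.bound (3 * `|ph g| / e)).
have n0 : (0 < n%:R :> R).
  by apply: le_lt_trans (archi_boundP _); rewrite ?divr_ge0 ?mulr_ge0// ltW.
have hn : 3 * `|ph g| < n%:R * e.
  rewrite -ltr_pdivrMr//; apply: archi_boundP.
  by rewrite divr_ge0 ?mulr_ge0// ltW.
have e3 : 0 < e / 3 by rewrite divr_gt0.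
have ex k : exists g', [/\ G g', P g' & `|ph g' - (k%:R / n%:R) *: ph g| < e / 3].
  elim: k => [|k [g' [Gg' Pg' hg']]].
    exists 0; split; first exact: (lattice0 latG).
      by apply: Psmall; [exact: (lattice0 latG)|rewrite linear0 normr0].
    by rewrite mul0r scale0r subr0 linear0 normr0.
  have [||g'' Gg'' hg''] := @lattice_int_dense
      (ball ((k.+1%:R / n%:R) *: ph g) (e / 3)) 0.
  - exact: ball_open.
  - by exists ((k.+1%:R / n%:R) *: ph g); exact: ballxx.
  move: hg''; rewrite addr0 -ball_normE/= distrC => hg''.
  exists g''; split => //.
  rewrite -(subrK g' g''); apply: PD => //; first exact: (latticeB latG).
  apply: Psmall; first exact: (latticeB latG).
  rewrite linearB/=.
  have -> : ph g'' - ph g' = (ph g'' - (k.+1%:R / n%:R) *: ph g) -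
      (ph g' - (k%:R / n%:R) *: ph g) + n%:R^-1 *: ph g.
    by rewrite -natr1 mulrDl mul1r scalerDl opprB addrAC opprD
      !addrA !subrK.
  have h3 : `|n%:R^-1 *: ph g| < e / 3.
    rewrite normrZ normfV ger0_norm 1?ltW// mulrC ltr_pdivrMr//.
    by move: hn; lra.
  apply: le_lt_trans (ler_normD _ _) _.
  apply: (@lt_trans _ _ (`|ph g'' - (k.+1%:R / n%:R) *: ph g -
    (ph g' - (k%:R / n%:R) *: ph g)| + e / 3)); first by rewrite ltrD2l.
  have := ler_normB (ph g'' - (k.+1%:R / n%:R) *: ph g)
    (ph g' - (k%:R / n%:R) *: ph g).
  move: hg' hg''; lra.
have [g' [Gg' Pg' hg']] := ex n.
rewrite -(subrK g' g); apply: PD => //; first exact: (latticeB latG).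
apply: Psmall; first exact: (latticeB latG).
rewrite linearB/= distrC; move: hg'; rewrite divff ?gt_eqF// scale1r.
move=> h; apply: lt_trans h _; lra.
Qed.

End SchemeLattice.

(** * Constructability and local derivability *)

Section TranslatedSets.
Context {R : realType} {E : normedModType R}.
Implicit Types (t x : E) (A : set E).

Lemma interior_translate t A : interior (translate t A) = translate t (interior A).
Proof.
apply: (interior_homeo (f := fun y => y + t) (g := fun y => y - t)).
- by move=> x; rewrite addrK.
- by move=> x; rewrite subrK.
- exact: translate_continuous.
- exact: translate_continuous.
Qed.

Lemma regclosed_translate t A : regclosed A -> regclosed (translate t A).
Proof.
apply: (regclosed_homeo (f := fun y => y + t) (g := fun y => y - t)).
- by move=> x; rewrite addrK.
- by move=> x; rewrite subrK.
- exact: translate_continuous.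
- exact: translate_continuous.
Qed.

End TranslatedSets.

Section Constructability.
Context {R : realType} {S : cp_scheme R}.
Local Notation E := (ambient S).
Local Notation V := (subvs_of (phys S)).
Local Notation H := (subvs_of (internal S)).
Local Notation G := (lattice S).
Local Notation pv := (proj_phys S).
Local Notation ph := (proj_int S).
Local Notation latG := (@cp_lattice R S).

Lemma window_regclosed l (W : stuple l H) k : window W -> regclosed (W k).
Proof. by case=> /(_ k)[]. Qed.

Lemma window_closed l (W : stuple l H) k : window W -> closed (W k).
Proof. by move=> wW; apply: regclosed_closed; exact: window_regclosed. Qed.

Lemma window_bounded l (W : stuple l H) : window W ->
  exists2 r : R, 0 < r & forall k h, W k h -> `|h| <= r.
Proof.
move=> [cW _].
have /choice[f hf] : forall k, exists r : R, forall h, W k h -> `|h| <= r.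
  move=> k; have [/compact_bounded[M [_ hM]] _] := cW k.
  by exists (M + 1) => h Wh; apply: (hM (M + 1)) => //; rewrite ltrDl.
exists (1 + \sum_k `|f k|) => [|k h Wh]; first by rewrite ltr_pwDl// sumr_ge0.
apply: ler_wpDl => //; rewrite (bigD1 k)//=; apply: ler_wpDr; first exact: sumr_ge0.
by apply: le_trans (hf k h Wh) _; exact: ler_norm.
Qed.

Lemma regclosed_interior0 (U : set H) : regclosed U -> U !=set0 ->
  interior U !=set0.
Proof.
move=> rU [x]; rewrite -{1}rU => /(_ setT filterT)[y [iy _]].
by exists y.
Qed.

Lemma window_interior l (W : stuple l H) : window W ->
  exists k, interior (W k) !=set0.
Proof.
move=> wW; have [_ [k Wk]] := wW; exists k.
exact: regclosed_interior0 (window_regclosed k wW) Wk.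
Qed.

Lemma window_algebra_gen l (W : stuple l H) k g :
  G g -> window_algebra W (translate (ph g) (W k)).
Proof. by move=> Gg; apply: sub_gen_smallest; exists k, g. Qed.

Lemma window_algebra_boolean l (W : stuple l H) :
  (forall k, regclosed (W k)) -> boolean_subalgebra (window_algebra W).
Proof.
move=> rW; split.
- apply: smallest_sub => [|U [k [g Gg ->]]]; last exact: regclosed_translate.
  split => //.
  + by rewrite /regclosed interior0 closure0.
  + by rewrite /regclosed interiorT closureT.
  + by split => *; exact: closure_int_regclosed.
- by move=> B [[_ B0 _ _] _].
- by move=> B [[_ _ BT _] _].
- split => [U V hU hV B hB|U V hU hV B hB|U hU B hB]; have [[_ _ _ [BI BU BN]] _] := hB.
  + by apply: BI; [exact: hU|exact: hV].
  + by apply: BU; [exact: hU|exact: hV].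
  + by apply: BN; exact: hU.
Qed.

(** The regular closed sets decided by finitely many generators contain the generators and form a
    Boolean subalgebra, so minimality applies. *)
Lemma window_algebra_agree l (W : stuple l H) U :
  (forall k, regclosed (W k)) -> window_algebra W U ->
  exists2 js : seq ('I_l * E), (forall j, j \in js -> G j.2) &
    forall x y, (forall j, j \in js ->
      agree (translate (ph j.2) (W j.1)) x y) -> agree U x y.
Proof.
move=> rW; pose P := [set U | regclosed U /\
  exists2 js : seq ('I_l * E), (forall j, j \in js -> G j.2) &
    forall x y, (forall j, j \in js ->
      agree (translate (ph j.2) (W j.1)) x y) -> agree U x y].
suff : window_algebra W `<=` P by move=> h /h[].
have cat2 (js js' : seq ('I_l * E)) (Q : 'I_l * E -> Prop) :
    (forall j, j \in js -> Q j) -> (forall j, j \in js' -> Q j) ->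
    forall j, j \in js ++ js' -> Q j.
  by move=> h h' j; rewrite mem_cat => /orP[/h|/h'].
have catl (js js' : seq ('I_l * E)) (Q : 'I_l * E -> Prop) :
    (forall j, j \in js ++ js' -> Q j) ->
    (forall j, j \in js -> Q j) /\ (forall j, j \in js' -> Q j).
  by move=> h; split => j jj; apply: h; rewrite mem_cat jj ?orbT.
apply: smallest_sub; last first.
  move=> _ [k [g Gg ->]]; split; first exact: regclosed_translate.
  exists [:: (k, g)] => [j|x y]; first by rewrite inE => /eqP ->.
  by move=> h; exact: (h (k, g) (mem_head _ _)).
split.
- by move=> ? [].
- split; first by rewrite /regclosed interior0 closure0.
  by exists [::] => // x y _; right; split.
- split; first by rewrite /regclosed interiorT closureT.
  by exists [::] => // x y _; left; rewrite interiorT.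
- split.
  + move=> U1 U2 [r1 [js1 G1 h1]] [r2 [js2 G2 h2]].
    split; first exact: closure_int_regclosed.
    exists (js1 ++ js2) => [|x y /catl[a1 a2]]; first exact: cat2.
    by apply: agree_rmeet; [exact: regclosed_closed|exact: regclosed_closed|exact: h1|exact: h2].
  + move=> U1 U2 [r1 [js1 G1 h1]] [r2 [js2 G2 h2]].
    split; first exact: closure_int_regclosed.
    exists (js1 ++ js2) => [|x y /catl[a1 a2]]; first exact: cat2.
    by apply: agree_rjoin; [exact: regclosed_closed|exact: regclosed_closed|exact: h1|exact: h2].
  + move=> U1 [r1 [js1 G1 h1]]; split; first exact: closure_int_regclosed.
    by exists js1 => // x y /h1; exact: agree_rneg.
Qed.

(** Provides a bounded cell from which to start [boolean_subalgebra_agree]; boundedness is what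
    leaves only finitely many relevant translates of the window. It is a finite join of translates
    of one component whose interiors cover the ball. *)
Lemma window_algebra_cover l (W : stuple l H) r : window W ->
  exists K, [/\ window_algebra W K, cball 0 r `<=` K &
    exists B : R, forall x, K x -> `|x| <= B].
Proof.
move=> wW; have [k [w0 iw0]] := window_interior wW.
have [Breg B0 BT [BI BU BN]] :=
  window_algebra_boolean (fun k => window_regclosed k wW).
have [B Bpos hB] := window_bounded wW.
have := @cball_compact R H 0 r; rewrite compact_cover => cover.
have [||D DG hD] := cover _ G (fun g => translate (ph g) (interior (W k))).
- by move=> g Gg; rewrite -interior_translate; exact: open_interior.
- move=> h _.
  have [||g Gg Og] := @lattice_int_dense R S [set y | interior (W k) (h - y)] 0.
  + exact: (open_comp (f := fun y : H => h - y)
      (fun y _ => @reflect_continuous R H h y) (open_interior (W k))).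
  + by exists (h - w0); rewrite /= subKr.
  by exists g => //; apply/translateE; move: Og; rewrite /= addr0.
suff [K [BK KD bK]] : exists K, [/\ window_algebra W K,
    forall g x, g \in finmap.enum_fset D -> translate (ph g) (interior (W k)) x -> K x &
    exists B : R, forall x, K x -> `|x| <= B].
  exists K; split => // x /hD[g gD gx].
  by apply: KD gx; exact: gD.
have DG' g : g \in finmap.enum_fset D -> G g by move=> /DG; rewrite inE.
elim: (finmap.enum_fset D) DG' => [_|g s IH sG].
  by exists set0; split => //; exists 0.
have [|K [BK hK [b hb]]] := IH; first by move=> g' g's; apply: sG; rewrite inE g's orbT.
have Bg := @window_algebra_gen l W k g (sG _ (mem_head _ _)).
exists (rjoin (translate (ph g) (W k)) K); split; first exact: BU.
  move=> g' x; rewrite inE => /predU1P[->|g's] xg.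
    have : translate (ph g) (W k) x.
      by move: xg; rewrite -interior_translate => /interior_subset.
    rewrite -{1}(Breg _ Bg); apply: closureS; apply: interiorS; exact: subsetUl.
  have : K x by exact: hK xg.
  by rewrite -{1}(Breg _ BK); apply: closureS; apply: interiorS; exact: subsetUr.
exists (B + `|ph g| + `|b|) => x /closure_int_sub[].
- by apply: closedU; apply: regclosed_closed; exact: Breg.
- move=> /translateE /hB xB; rewrite -(subrK (ph g) x).
  apply: ler_wpDr => //; apply: le_trans (ler_normD _ _) _; exact: lerD.
- move=> /hb xb; apply: ler_wpDl; first by rewrite addr_ge0// ltW.
  exact: le_trans (ler_norm _).
Qed.

(* The pattern with window W shifted by h, without control of what it does
   at the lattice points whose internal coordinate hits the boundary. *)
Definition model l (W : stuple l H) (h : H) (P : stuple l V) :=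
  (forall k v, P k v -> exists g, [/\ G g, v = pv g & W k (ph g + h)]) /\
  (forall k g, G g -> interior (W k) (ph g + h) -> P k (pv g)).

(** A bounded cell is cut along the finitely many translates of W1 that determine the patch of P1 of
    radius c. Two lattice points on the same side of all cuts see the same patch, hence the same
    value of P2, hence lie on the same side of X; [boolean_subalgebra_agree] concludes. *)
Lemma constructable_of_locally_derivable l1 l2 (W1 : stuple l1 H)
    (W2 : stuple l2 H) h P1 P2 :
  window W1 -> window W2 -> model W1 h P1 -> model W2 h P2 ->
  locally_derivable P2 P1 -> constructable W2 W1.
Proof.
move=> wW1 wW2 [mP1 mP1'] [mP2 mP2'] /locally_derivableP[c c0 hc].
have bW1 := window_algebra_boolean (fun k => window_regclosed k wW1).
apply: smallest_sub => // _ [k [g Gg ->]].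
set X := translate _ _.
have rX : regclosed X by exact/regclosed_translate/window_regclosed.
have [B2 B20 hB2] := window_bounded wW2.
have [B1 B10 hB1] := window_bounded wW1.
have [K [BK hK [BKb hKb]]] := window_algebra_cover (B2 + `|ph g|) wW1.
have XK : X `<=` K.
  move=> x /translateE /hB2 xB; apply: hK; rewrite /cball/= sub0r normrN.
  by rewrite -(subrK (ph g) x) (le_trans (ler_normD _ _))// lerD2r.
rewrite -(rmeet_sub_id rX XK).
(* The internal bound is that of z - [ph g] - ([ph m] + h), where z lies in K and [ph m] + h lies in
   the window W1. *)
have [s [sG hs]] := @lattice_box R S c (BKb + `|ph g| + B1).
pose f (j : 'I_l1 * E) := translate (ph (g + j.2)) (W1 j.1).
pose js := [seq (k, g) | k <- enum 'I_l1, g <- s].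
(* Boundary points of X are left out, because a model guarantees membership only for interior points
   of its window. *)
pose D := [set x | (exists2 q, G q & x = ph q + h) /\ off_boundary X x].
apply: (@boolean_subalgebra_agree _ _ D X _ f js) => //.
- move=> O O0 oO.
  have [y [Oy offy]] := @off_boundary_dense _ X O O0 oO.
  have [||q Gq [Oq oq]] := @lattice_int_dense R S (O `&` off_boundary X) h.
  + by apply: openI => //; apply: off_boundary_open; exact: regclosed_closed.
  + by exists y.
  by exists (ph q + h); split => //; split => //; exists q.
- move=> j /allpairsP[[k' g'] /= [_ gs ->]].
  by apply: window_algebra_gen; apply: (latticeD latG) => //; exact: sG.
move=> x y [[q Gq xq] offx] [[q' Gq' yq'] offy] Kx Ky hag Xx.
have half p p' z z' (Gp : G p) (Gp' : G p') (zp : z = ph p + h)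
    (z'p : z' = ph p' + h) (Kz : interior K z)
    (ag : forall j, j \in js -> agree (f j) z z') j u : `|u| <= c ->
    P1 j (pv (p - g) + u) -> P1 j (pv (p' - g) + u).
  move=> uc /mP1[m [Gm um Wm]].
  (* A point m of the patch around [pv (p - g)] sits at displacement - [pv g1], and its window
     condition says exactly that z lies in the translate of W1 indexed by g1. *)
  have [g1 g1E] : exists g1, g1 = p - g - m by eexists.
  have Gg1 : G g1 by rewrite g1E; do 2 (apply: (latticeB latG) => //).
  have pg1 : pv g1 = - u by rewrite g1E linearB/= -um opprD addNKr.
  have mg1 : m = p - g - g1 by rewrite g1E subKr.
  have hg1 : ph m + h = z - ph (g + g1).
    by rewrite mg1 zp !linearB linearD/= opprD !addrA [LHS]addrAC; congr (_ - _); rewrite addrAC.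
  have jg1 : (j, g1) \in js.
    apply/allpairsP; exists (j, g1); rewrite mem_enum; split => //=.
    apply: hs => //; first by rewrite pg1 normrN.
    have -> : ph g1 = z - ph g - (ph m + h).
      by rewrite hg1 opprB linearD/= !addrA subrK addrAC subrr add0r.
    apply: le_trans (ler_normB _ _) _; apply: lerD; last exact: hB1 Wm.
    apply: le_trans (ler_normB _ _) _; apply: lerD => //.
    by apply: hKb; exact: interior_subset.
  have [[_ iz']|[nz _]] := ag _ jg1; last first.
    by exfalso; apply: nz; apply/translateE; rewrite -hg1.
  have -> : pv (p' - g) + u = pv (p' - (g + g1)).
    by rewrite opprD addrA [in RHS]linearB/= pg1 opprK.
  apply: mP1'; first by apply: (latticeB latG) => //; exact: (latticeD latG).
  move: iz'; rewrite interior_translate translateE z'p.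
  by rewrite linearB/= addrAC.
have agP : agree_at P1 (pv (q - g)) P1 (pv (q' - g)) c.
  move=> j u uc; split; first exact: (half q q' x y).
  by apply: (half q' q y x) => // i /hag /agree_sym.
have ix : interior X x by case: offx.
have : P2 k (pv (q - g)).
  apply: mP2'; first exact: (latticeB latG).
  by move: ix; rewrite interior_translate translateE xq linearB/= addrAC.
move=> /(hc _ _ agP)/mP2[m [Gm mq Wm]].
have {}mq : m = q' - g by apply: lattice_phys_inj => //; exact: (latticeB latG).
by apply/translateE; rewrite yq' addrAC -linearB -mq.
Qed.

End Constructability.

(** * Patterns as limits of non-singular patterns *)

Section LimitPatterns.
Context {R : realType} {S : cp_scheme R}.
Local Notation E := (ambient S).
Local Notation V := (subvs_of (phys S)).
Local Notation H := (subvs_of (internal S)).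
Local Notation G := (lattice S).
Local Notation pv := (proj_phys S).
Local Notation ph := (proj_int S).
Local Notation latG := (@cp_lattice R S).

Definition in_lattice l (P : stuple l V) :=
  forall k v, P k v -> exists2 g, G g & v = pv g.

(* On the ball of radius r around the origin, P is the pattern of the window
   W + t, which is non-singular there. *)
Definition approx l (W : stuple l H) (P : stuple l V) (r : R) (t : H) :=
  forall g, G g -> `|pv g| <= r -> forall k,
    (interior (W k) (ph g - t) /\ P k (pv g)) \/
    (~ W k (ph g - t) /\ ~ P k (pv g)).

(** These are the elements of the fibre over the origin of the torus, as [torus_fibreP] makes
    precise. [in_lattice] excludes points about which [approx] is silent. *)
Definition limit_pattern l (W : stuple l H) (P : stuple l V) :=
  in_lattice P /\
  forall r e, 0 < e -> exists2 t, `|t| < e & approx W P r t.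

(** The same t serves both windows; this is what allows one pattern to be read off the other at
    singular points. *)
Definition joint_limit l1 l2 (W1 : stuple l1 H) (P1 : stuple l1 V)
    (W2 : stuple l2 H) (P2 : stuple l2 V) :=
  [/\ in_lattice P1, in_lattice P2 &
  forall r e, 0 < e ->
    exists t, [/\ `|t| < e, approx W1 P1 r t & approx W2 P2 r t]].

Lemma joint_limit1 l1 l2 (W1 : stuple l1 H) P1 (W2 : stuple l2 H) P2 :
  joint_limit W1 P1 W2 P2 -> limit_pattern W1 P1.
Proof.
by move=> [i1 _ h]; split => // r e e0; have [t []] := h r e e0; exists t.
Qed.

Lemma joint_limit2 l1 l2 (W1 : stuple l1 H) P1 (W2 : stuple l2 H) P2 :
  joint_limit W1 P1 W2 P2 -> limit_pattern W2 P2.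
Proof.
by move=> [_ i2 h]; split => // r e e0; have [t []] := h r e e0; exists t.
Qed.

Lemma joint_limit_sym l1 l2 (W1 : stuple l1 H) P1 (W2 : stuple l2 H) P2 :
  joint_limit W1 P1 W2 P2 -> joint_limit W2 P2 W1 P1.
Proof.
by move=> [i1 i2 h]; split => // r e e0; have [t []] := h r e e0; exists t.
Qed.

Lemma approx_le l (W : stuple l H) P r r' t :
  r' <= r -> approx W P r t -> approx W P r' t.
Proof. by move=> rr h g Gg gr; apply: h => //; exact: le_trans rr. Qed.

(** For shifts within 1 of t only finitely many lattice points can reach the window inside the ball,
    and for each of these being interior or exterior is an open condition. *)
Lemma approx_open l (W : stuple l H) P r t : window W ->
  approx W P r t -> \forall t' \near t, approx W P r t'.
Proof.
move=> wW hP; have [B B0 hB] := window_bounded wW.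
have [s [sG hs]] := @lattice_box R S r (B + (`|t| + 1)).
have sr k g : nbhs t [set t' | G g -> `|pv g| <= r ->
   (interior (W k) (ph g - t') /\ P k (pv g)) \/
    (~ W k (ph g - t') /\ ~ P k (pv g))].
  have [[Gg gr]|ng] := pselect (G g /\ `|pv g| <= r); last first.
    by apply: (@filterE _ (nbhs t) (nbhs_filter t)) => t' Gg gr; case: ng.
  have op (O : set H) : open O -> O (ph g - t) -> nbhs t [set t' | O (ph g - t')].
    move=> oO Ot; apply: open_nbhs_nbhs; split => //.
    exact: (open_comp (f := fun y : H => ph g - y)
      (fun y _ => @reflect_continuous R H (ph g) y) oO).
  have [[iW Pg]|[nW nP]] := hP g Gg gr k.
    have := op _ (open_interior _) iW.
    by apply: filterS => t' ? _ _; left.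
  have := op _ (closed_openC (@window_closed _ _ _ W k wW)) nW.
  by apply: filterS => t' ? _ _; right.
have near1 : nbhs t [set t' | `|t - t'| < 1].
  by apply/nbhs_ballP; exists 1 => //=; rewrite -ball_normE.
have near2 := near_seq (nbhs_filter t)
  (js := [seq (k, g) | k <- enum 'I_l, g <- s]) (fun j _ => sr j.1 j.2).
apply: filterS2 near1 near2 => t' /= tt' hs' g Gg gr k.
have [gs|ngs] := boolP (g \in s).
  apply: (hs' (k, g)) => //; apply/allpairsP; exists (k, g).
  by rewrite mem_enum.
have bg : B + (`|t| + 1) < `|ph g|.
  by rewrite ltNge; apply: contra ngs => ?; exact: hs.
have far t1 : `|t - t1| < 1 -> ~ W k (ph g - t1).
  move=> tt1 /hB; have := lerB_dist (ph g) t1.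
  have := lerB_dist t1 t; rewrite (distrC t1 t); lra.
right; split; first exact: far.
have [[/interior_subset iW _]|[]//] := hP g Gg gr k.
by case: (@far t) => //; rewrite subrr normr0.
Qed.

(** Each lattice point imposes an open dense condition on t, and the lattice is countable. *)
Lemma generic_dense l (W : stuple l H) : window W ->
  dense [set t | forall g k, G g -> off_boundary (W k) (ph g - t)].
Proof.
move=> wW; have /countable_injP[f finj] := @lattice_countable R E G latG.
pose F n := [set t : H | forall g k, G g -> f g = n -> off_boundary (W k) (ph g - t)].
rewrite (_ : mkset _ = \bigcap_n F n); last first.
  apply/seteqP; split => [t ht n _ g k Gg _|t ht g k Gg]; first exact: ht.
  exact: (ht (f g)).
have FE n : (open (F n) /\ dense (F n)).
  have [[g0 [Gg0 fg0]]|no] := pselect (exists g, G g /\ f g = n); last first.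
    rewrite (_ : F n = setT); first by split; [exact: openT|move=> O [x Ox] oO; exists x].
    by apply/seteqP; split => // t _ g k Gg fg; case: no; exists g.
  have -> : F n = [set t | forall k, k \in enum 'I_l -> off_boundary (W k) (ph g0 - t)].
    apply/seteqP; split => t ht.
      by move=> k _; exact: ht.
    move=> g k Gg fg; suff -> : g = g0 by apply: ht; rewrite mem_enum.
    by apply: finj; rewrite ?inE// fg0.
  apply: (dense_seq_bigcap (f := fun k => [set t | off_boundary (W k) (ph g0 - t)])).
  move=> k _; split.
    exact: (open_comp (f := fun y : H => ph g0 - y)
      (fun y _ => @reflect_continuous R H (ph g0) y)
      (off_boundary_open (@window_closed _ _ _ W k wW))).
  move=> O [x Ox] oO.
  have [||y [Oy offy]] := @off_boundary_dense _ (W k) [set y | O (ph g0 - y)].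
  - by exists (ph g0 - x); rewrite /= subKr.
  - exact: (open_comp (f := fun y : H => ph g0 - y)
      (fun y _ => @reflect_continuous R H (ph g0) y) oO).
  by exists (ph g0 - y); split => //=; rewrite subKr.
by apply: dense_open_bigcap => n; have [] := FE n.
Qed.

Lemma limit_model l (W : stuple l H) P : window W ->
  limit_pattern W P -> model W 0 P.
Proof.
move=> wW [iP hP]; split => [k v Pv|k g Gg].
  have [g Gg vg] := iP _ _ Pv; exists g; split => //; rewrite addr0.
  apply: (@window_closed _ _ _ W k wW) => N /nbhs_ballP[e /= e0 eN].
  have [t te /(_ g Gg)] := hP `|pv g| e e0.
  move=> /(_ (lexx _) k)[[/interior_subset Wg _]|[_]]; last by rewrite -vg.
  exists (ph g - t); split => //; apply: eN.
  by rewrite -ball_normE/= subKr.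
rewrite addr0 => /nbhs_ballP[e /= e0 eW].
have [t te /(_ g Gg (lexx _) k)] := hP `|pv g| e e0.
case=> -[//]; case; apply: eW.
by rewrite -ball_normE/= subKr.
Qed.

Section Ultrafilter.
Context l (W : stuple l H) (U : set_system H).
Hypotheses (wW : window W) (FU : UltraFilter U) (U1 : U (ball 0 1))
  (UW : U [set t | forall g k, G g -> off_boundary (W k) (ph g - t)]).

(** A lattice point is kept when it lies in the window for U-almost every shift; the ultrafilter
    thus also settles the boundary points. *)
Definition ultra_pattern : stuple l V := fun k =>
  [set v | exists g, [/\ G g, v = pv g & U [set t | W k (ph g - t)]]].

(** Finitely many lattice points matter in a given ball, so the U-almost sure decisions about them
    hold simultaneously; genericity turns membership in the window into membership in its
    interior. *)
Lemma ultra_pattern_approx r : U (approx W ultra_pattern r).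
Proof.
have PU : ProperFilter U by exact: ultra_proper.
have [B B0 hB] := window_bounded wW.
have [s [sG hs]] := @lattice_box R S r (B + 1).
have far g t k : g \notin s -> G g -> `|pv g| <= r -> ball 0 1 t -> ~ W k (ph g - t).
  move=> gs Gg gr; rewrite -ball_normE/= sub0r normrN => t1 /hB.
  have : B + 1 < `|ph g| by rewrite ltNge; apply: contra gs => ?; exact: hs.
  have := lerB_dist (ph g) t; lra.
have memP g k : G g -> ultra_pattern k (pv g) -> U [set t | W k (ph g - t)].
  by move=> Gg [g' [Gg' /(lattice_phys_inj Gg Gg') ->]].
have sr j : U [set t | G j.2 ->
   (interior (W j.1) (ph j.2 - t) /\ ultra_pattern j.1 (pv j.2)) \/
    (~ W j.1 (ph j.2 - t) /\ ~ ultra_pattern j.1 (pv j.2))].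
  case: j => k g /=.
  have [Gg|nG] := pselect (G g); last first.
    by apply: (@filterE _ U) => t Gg.
  have [UWk|UnW] := in_ultra_setVsetC [set t | W k (ph g - t)] FU.
    apply: filterS2 (UWk) UW => t Wt /(_ g k Gg)[it|//] _; left; split => //.
    by exists g.
  apply: filterS (UnW) => t nWt _; right; split => // /(memP _ _ Gg) UWk.
  by have [t' [? ?]] := filter_ex (filterI UnW UWk).
have Uj := near_seq (@filter_filter _ _ PU) (js := [seq (k, g) | k <- enum 'I_l, g <- s]) (fun j _ => sr j).
apply: filterS2 (U1) Uj => t t1 hj g Gg gr k.
have [gs|ngs] := boolP (g \in s).
  by apply: (hj (k, g)) => //; apply/allpairsP; exists (k, g); rewrite mem_enum.
right; split; first exact: far.
move=> /(memP _ _ Gg) UWk; have [t' [Wt' t'1]] := filter_ex (filterI UWk U1).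
exact: (far g t' k).
Qed.

End Ultrafilter.

(** The small shifts that approximate P1 on a given ball and are generic for W2 form a filter base:
    the approximating shifts are open, the generic ones dense. An ultrafilter refining it defines
    P2. *)
Lemma joint_limit_exists l1 l2 (W1 : stuple l1 H) (W2 : stuple l2 H) P1 :
  window W1 -> window W2 -> limit_pattern W1 P1 ->
  exists P2, joint_limit W1 P1 W2 P2.
Proof.
move=> wW1 wW2 [iP hP].
pose gen := [set t | forall g k, G g -> off_boundary (W2 k) (ph g - t)].
pose F := filter_from [set p : R * R | 0 < p.2]
  (fun p => [set t : H | [/\ `|t| < p.2, approx W1 P1 p.1 t & gen t]]).
have FF : ProperFilter F.
  apply: filter_from_proper.
    apply: filter_from_filter; first by exists (0, 1) => /=.
    move=> [r e] [r' e'] /= e0 e0'; exists (Num.max r r', Num.min e e') => /=.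
      by rewrite lt_min e0.
    move=> t /= [te at_ gt]; move: te; rewrite lt_min => /andP[te te'].
    split; split => //; apply: approx_le at_; rewrite le_max lexx ?orbT//.
  move=> [r e] /= e0; have [t te at_] := hP r e e0.
  have O := approx_open wW1 at_.
  have te' : nbhs t [set t' | `|t'| < e].
    apply: open_nbhs_nbhs; split => //.
    rewrite (_ : mkset _ = ball 0 e); first exact: ball_open.
    by apply/seteqP; split => z; rewrite -ball_normE/= sub0r normrN.
  have [||t' [Ot' gt']] := generic_dense wW2
      (O := interior [set t' | approx W1 P1 r t' /\ `|t'| < e]).
  - by exists t; exact: filterI.
  - exact: open_interior.
  by have /= [? ?] := interior_subset Ot'; exists t'.
have [U [UU FU]] := ultraFilterLemma FF.
have PU : ProperFilter U by exact: ultra_proper.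
have UF r e : 0 < e -> U [set t : H | [/\ `|t| < e, approx W1 P1 r t & gen t]].
  by move=> e0; apply: FU; exists (r, e).
have U1 : U (ball 0 1).
  apply: filterS (UF 0 1 ltr01) => t [t1 _ _].
  by rewrite -ball_normE/= sub0r normrN.
have Ug : U gen by apply: filterS (UF 0 1 ltr01) => t [].
exists (ultra_pattern W2 U); split => //.
  by move=> k v [g [Gg -> _]]; exists g.
move=> r e e0.
have [t [[te a1 _] a2]] := filter_ex (filterI (UF r e e0)
  (ultra_pattern_approx wW2 UU U1 Ug r)).
by exists t.
Qed.

Lemma limit_pattern_exists l (W : stuple l H) : window W ->
  exists P, limit_pattern W P.
Proof.
move=> wW; pose gen := [set t | forall g k, G g -> off_boundary (W k) (ph g - t)].
have FF : ProperFilter (within gen (nbhs (0 : H))).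
  apply: Build_ProperFilter_ex => A A0.
  have [||t [At gt]] := generic_dense wW (O := interior [set x | gen x -> A x]).
  - by exists 0; exact: A0.
  - exact: open_interior.
  by exists t; exact: (interior_subset At).
have [U [UU FU]] := ultraFilterLemma FF.
have PU : ProperFilter U by exact: ultra_proper.
have Ub e : 0 < e -> U (ball 0 e).
  move=> e0; apply: FU; have := nbhsx_ballx (0 : H) e e0.
  by apply: filterS => t bt _.
have Ug : U gen by apply: FU; exact: withinT.
exists (ultra_pattern W U); split; first by move=> k v [g [Gg -> _]]; exists g.
move=> r e e0; have [t [te at_]] := filter_ex (filterI (Ub e e0)
  (ultra_pattern_approx wW UU (Ub 1 ltr01) Ug r)).
by exists t => //; move: te; rewrite -ball_normE/= sub0r normrN.
Qed.

(* The window W2 is a Boolean combination of finitely many translates of W1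
   away from their boundaries, so membership in P2 is read off P1 at finitely
   many neighbouring lattice points.  The same finite rule serves all limits. *)
Lemma constructable_local_rule l1 l2 (W1 : stuple l1 H) (W2 : stuple l2 H) :
  window W1 -> window W2 -> constructable W2 W1 ->
  exists2 c : R, 0 <= c & forall P1 P2 P1' P2',
    joint_limit W1 P1 W2 P2 -> joint_limit W1 P1' W2 P2' ->
    forall x y, agree_at P1 x P1' y c -> forall k, P2 k x -> P2' k y.
Proof.
move=> wW1 wW2 cW.
have /choice[js hjs] : forall k, exists js : seq ('I_l1 * E),
    (forall j, j \in js -> G j.2) /\ forall x y, (forall j, j \in js ->
      agree (translate (ph j.2) (W1 j.1)) x y) -> agree (W2 k) x y.
  move=> k; have : window_algebra W1 (W2 k).
    apply: cW; rewrite -[W2 k]translate0 -(linear0 ph).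
    exact: (window_algebra_gen _ (lattice0 latG)).
  move=> /window_algebra_agree[|js Gjs hjs]; last by exists js.
  by move=> j; exact: window_regclosed.
have [k0 ik0] := window_interior wW1.
have [rho rho0 hrho] := lattice_strip_dense (open_interior (W1 k0)) ik0.
(* [rho] guarantees a point of P1 in the patch; the sum reaches every lattice displacement used by
   the Boolean combinations. *)
pose c := rho + \sum_k \sum_(j <- js k) `|pv j.2|.
have c1 k j : j \in js k -> `|pv j.2| <= c.
  move=> jk; apply: ler_wpDl; first exact: ltW.
  rewrite (bigD1 k)//= ler_wpDr//; first by apply: sumr_ge0 => i _; exact: sumr_ge0.
  elim: (js k) jk => //= a s IH; rewrite inE big_cons => /predU1P[->|/IH h].
    by rewrite lerDl sumr_ge0.
  by apply: ler_wpDl.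
have c2 : rho <= c.
  by rewrite lerDl; apply: sumr_ge0 => i _; exact: sumr_ge0.
exists c => [|P1 P2 P1' P2' J J' x y ag k P2x].
  by apply: le_trans c2; exact: ltW.
have [i1 i2 hJ] := J; have [i1' i2' hJ'] := J'.
have [g0 Gg0 xg0] := i2 _ _ P2x.
(* Nothing is assumed of y, so it must first be located in the projected lattice: a point of P1 near
   x has a counterpart in P1' near y, at the same displacement. *)
have [g0' Gg0' yg0'] : exists2 g, G g & y = pv g.
  have [g1 [Gg1 ig1 xg1]] := hrho x.
  have P1g1 : P1 k0 (pv g1).
    by apply: (limit_model wW1 (joint_limit1 J)).2 => //; rewrite addr0.
  have : P1' k0 (y + (pv g1 - x)).
    by apply/ag; [rewrite distrC (le_trans xg1)|rewrite addrC subrK].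
  move=> /i1'[g2 Gg2 e2]; exists (g2 - g1 + g0).
    by apply: (latticeD latG) => //; exact: (latticeB latG).
  by rewrite linearD linearB/= -e2 -xg0 addrA addrAC addrK subrK.
pose r := `|x| + `|y| + c.
have [t [_ a1 a2]] := hJ r 1 ltr01.
have [t' [_ a1' a2']] := hJ' r 1 ltr01.
have [Gjs agjs] := hjs k.
have : agree (W2 k) (ph g0 - t) (ph g0' - t').
  apply: agjs => j jk; have Gj := Gjs _ jk; have cj := c1 _ _ jk.
  have G1 : G (g0 - j.2) by exact: (latticeB latG).
  have G1' : G (g0' - j.2) by exact: (latticeB latG).
  have b : `|pv (g0 - j.2)| <= r.
    rewrite linearB/= -xg0 (le_trans (ler_normB _ _))// /r.
    by apply: lerD => //; rewrite lerDl.
  have b' : `|pv (g0' - j.2)| <= r.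
    rewrite linearB/= -yg0' (le_trans (ler_normB _ _))// /r.
    by apply: lerD => //; rewrite lerDr.
  have agj : P1 j.1 (pv (g0 - j.2)) <-> P1' j.1 (pv (g0' - j.2)).
    by rewrite !linearB/= -xg0 -yg0'; apply: ag; rewrite normrN.
  rewrite /agree interior_translate !translateE.
  have -> : ph g0 - t - ph j.2 = ph (g0 - j.2) - t by rewrite linearB/= addrAC.
  have -> : ph g0' - t' - ph j.2 = ph (g0' - j.2) - t' by rewrite linearB/= addrAC.
  have := a1 _ G1 b j.1; have := a1' _ G1' b' j.1.
  by move=> [[? ?]|[? ?]] [[? ?]|[? ?]]; [left|exfalso|exfalso|right]; tauto.
have := a2 g0 Gg0 _ k; rewrite -xg0 => /(_ _)[|[iW _]|[_ //]].
  by rewrite /r -addrA lerDl addr_ge0// (le_trans _ c2)// ltW.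
case=> [[_ iW']|[nW _]]; last by have := interior_subset iW.
have := a2' g0' Gg0' _ k; rewrite -yg0' => /(_ _)[|[_ //]|[nW' _]].
  by rewrite /r addrAC lerDr addr_ge0// (le_trans _ c2)// ltW.
by have := interior_subset iW'.
Qed.

End LimitPatterns.

(** * Derivability between joint limits, and transport along lattice automorphisms *)

Section LimitConsequences.
Context {R : realType} {S : cp_scheme R}.
Local Notation E := (ambient S).
Local Notation V := (subvs_of (phys S)).
Local Notation H := (subvs_of (internal S)).
Local Notation G := (lattice S).
Local Notation pv := (proj_phys S).
Local Notation ph := (proj_int S).
Local Notation latG := (@cp_lattice R S).

Lemma joint_limit_derivable l1 l2 (W1 : stuple l1 H) (W2 : stuple l2 H) P1 P2 :
  window W1 -> window W2 -> constructable W2 W1 -> joint_limit W1 P1 W2 P2 ->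
  locally_derivable P2 P1.
Proof.
move=> wW1 wW2 cW J; have [c c0 hc] := constructable_local_rule wW1 wW2 cW.
apply/locally_derivableP; exists c => // x y ag k; split; first exact: (hc _ _ _ _ J J).
by apply: (hc _ _ _ _ J J); exact: agree_at_sym.
Qed.

(** The two limits may run along different shifts t; the common local rule, applied at x = y, still
    identifies them. *)
Lemma joint_limit_unique l1 l2 (W1 : stuple l1 H) (W2 : stuple l2 H) P1 P2 P2' :
  window W1 -> window W2 -> constructable W2 W1 ->
  joint_limit W1 P1 W2 P2 -> joint_limit W1 P1 W2 P2' -> P2 = P2'.
Proof.
move=> wW1 wW2 cW J J'; have [c c0 hc] := constructable_local_rule wW1 wW2 cW.
apply/funext => k; apply/seteqP; split => x.
  exact: (hc _ _ _ _ J J').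
exact: (hc _ _ _ _ J' J).
Qed.

(** T and A are the two diagonal blocks of M; invariance of the subspaces is expressed by
    commutation with the projections. *)
Definition cp_automorphism (M : 'End(E)) (T : 'End(V)) (A : 'End(H)) :=
  [/\ [/\ M @` G = G, lker T = 0%VS & lker A = 0%VS],
      forall x, pv (M x) = T (pv x) & forall x, ph (M x) = A (ph x)].

Lemma cp_automorphism_iter M T A p : cp_automorphism M T A ->
  cp_automorphism (lfun_iter p M) (lfun_iter p T) (lfun_iter p A).
Proof.
move=> [[MG kT kA] vM hM]; split; first split.
- elim: p => [|p IH].
    by rewrite (_ : fun_of_lfun _ = id) ?image_id//; apply/funext => x; rewrite lfun_iterE.
  rewrite -[RHS]MG -[in RHS]IH image_comp; congr (_ @` _).
  by apply/funext => x; rewrite /comp !lfun_iterE.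
- exact: lfun_iter_ker.
- exact: lfun_iter_ker.
- by move=> x; rewrite !lfun_iterE; elim: p => //= p <-.
- by move=> x; rewrite !lfun_iterE; elim: p => //= p <-.
Qed.

Lemma window_image l (W : stuple l H) (A : 'End(H)) : lker A = 0%VS ->
  window W -> window (stuple_image A W).
Proof.
move=> /eqP kA [cW [k0 [x0 Wx0]]]; split; last by exists k0, (A x0), x0.
move=> k; have [cWk rWk] := cW k; split.
  apply: continuous_compact => //; apply: continuous_subspaceT.
  exact: linear_continuous.
apply: (regclosed_homeo (lker0_lfunK kA) (lker0_lfunVK kA)) => //.
  exact: linear_continuous.
exact: linear_continuous.
Qed.

Lemma interior_stuple_image l (W : stuple l H) (A : 'End(H)) k x :
  lker A = 0%VS -> interior (stuple_image A W k) (A x) <-> interior (W k) x.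
Proof.
move=> /eqP kA; rewrite /stuple_image (interior_homeo (lker0_lfunK kA) (lker0_lfunVK kA)).
- split => [[y Wy /(congr1 (A^-1)%VF)]|Wx]; last by exists x.
  by rewrite !lker0_lfunK// => <-.
- exact: linear_continuous.
- exact: linear_continuous.
Qed.

Lemma limit_pattern_image l (W : stuple l H) P M T A :
  cp_automorphism M T A -> limit_pattern W P ->
  limit_pattern (stuple_image A W) (stuple_image T P).
Proof.
move=> [[MG kT kA] vM hM] [iP hP]; split.
  move=> k _ [v /iP[g Gg ->] <-]; exists (M g) => //.
  by rewrite -MG; exists g.
move=> r e e0.
have [C C0 hC] := linear_bounded A.
have [D D0 hD] := linear_bounded (T^-1)%VF.
(* D * r covers the preimage under T of the ball of radius r, and e / C keeps the new shift A t
   below e. *)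
have [t te at_] := hP (D * r) (e / C) (divr_gt0 e0 C0).
exists (A t).
  by apply: le_lt_trans (hC t) _; rewrite mulrC -ltr_pdivlMr.
move=> g; rewrite -{1}MG => -[g' Gg' <-]; rewrite vM hM -linearB => gr k.
have kT' : lker T == 0%VS by exact/eqP.
rewrite interior_stuple_image//.
rewrite !stuple_imageE// !lker0_lfunK//; last exact/eqP.
apply: at_ => //; rewrite -(lker0_lfunK kT' (pv g')).
by apply: le_trans (hD _) _; rewrite ler_pM2l.
Qed.

End LimitConsequences.

(** * The torus parametrisation *)

Section LocalIndistinguishability.
Context {R : realType} {E : normedVectType R}.

Lemma locally_indistinguishableP l (P Q : stuple l E) :
  locally_indistinguishable P Q <->
  forall r : R, exists t, agree_at P 0 Q t r.
Proof.
split => [h r|h U [M [_ hM]]].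
  have [|t ht] := h (cball 0 r).
    exists r; split; first exact: num_real.
    move=> M rM x /=; rewrite /cball/= sub0r normrN => xr.
    exact: le_trans (ltW rM).
  exists t => k u ur; rewrite add0r.
  have e : stuple_translate t (stuple_restrict P (cball 0 r)) k (t + u) =
    stuple_restrict Q (translate t (cball 0 r)) k (t + u) by rewrite ht.
  have tu : t + u - t = u by rewrite addrAC subrr add0r.
  have cu : cball 0 r u by rewrite /cball/= sub0r normrN.
  split => [Pu|Qu].
    have : stuple_translate t (stuple_restrict P (cball 0 r)) k (t + u).
      by apply/translateE; rewrite tu.
    by rewrite e => -[].
  have : stuple_restrict Q (translate t (cball 0 r)) k (t + u).
    by split => //; apply/translateE; rewrite tu.
  by rewrite -e => /translateE; rewrite tu => -[].
have [t ht] := h (M + 1); exists t.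
have UM u : U u -> `|u| <= M + 1 by apply: (hM (M + 1)); rewrite ltrDl.
apply/funext => k; apply/seteqP; split => x.
  move=> /translateE[Px Ux]; split; last exact/translateE.
  by have := ht k _ (UM _ Ux); rewrite add0r (addrC t) subrK => <-.
move=> [Qx /translateE Ux]; apply/translateE; split => //.
by have := ht k _ (UM _ Ux); rewrite add0r (addrC t) subrK => ->.
Qed.

Lemma locally_indistinguishable_trans l (P Q T : stuple l E) :
  locally_indistinguishable P Q -> locally_indistinguishable Q T ->
  locally_indistinguishable P T.
Proof.
move=> /locally_indistinguishableP h1 /locally_indistinguishableP h2.
apply/locally_indistinguishableP => r.
have [t ht] := h1 r; have [t' ht'] := h2 (r + `|t|).
exists (t' + t); apply: (agree_at_trans ht).
by have := agree_at_shift (lexx `|t|) ht'; rewrite add0r.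
Qed.

Lemma locally_indistinguishable_translate l (P : stuple l E) v :
  locally_indistinguishable (stuple_translate v P) P.
Proof.
apply/locally_indistinguishableP => r; exists (- v) => k u ur.
by rewrite /stuple_translate translateE add0r addrC.
Qed.

Lemma delone_translate l (P : stuple l E) v :
  delone P -> delone (stuple_translate v P).
Proof.
have mem x : (\bigcup_i stuple_translate v P i) x -> (\bigcup_i P i) (x - v).
  by move=> [k _ /translateE Px]; exists k.
move=> [[r r0 hr] [r' hr']]; split.
  exists r => // x y /mem Px /mem Py xy.
  have -> : x - y = (x - v) - (y - v) by rewrite opprB addrA subrK.
  by apply: hr => // /addIr.
exists r' => x; have [y [k _ Py] xy] := hr' (x - v).
exists (y + v); first by exists k => //; apply/translateE; rewrite addrK.
by rewrite opprD addrA addrAC.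
Qed.

Lemma seq_pos_lower_bound (J : eqType) (f : J -> R) (s : seq J) :
  exists2 d : R, 0 < d & forall j, j \in s -> 0 < f j -> d <= f j.
Proof.
elim: s => [|j s [d d0 hd]]; first by exists 1.
have [fj|fj] := ltP 0 (f j); last first.
  exists d => // k; rewrite inE => /predU1P[->|/hd//].
  by rewrite ltNge fj.
exists (Num.min d (f j)) => [|k]; first by rewrite lt_min d0.
rewrite inE ge_min => /predU1P[->|/hd h /h ->//].
by rewrite lexx orbT.
Qed.

End LocalIndistinguishability.

Section TorusParametrisation.
Context {R : realType} {S : cp_scheme R}.
Local Notation E := (ambient S).
Local Notation V := (subvs_of (phys S)).
Local Notation H := (subvs_of (internal S)).
Local Notation G := (lattice S).
Local Notation pv := (proj_phys S).
Local Notation ph := (proj_int S).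
Local Notation latG := (@cp_lattice R S).

Lemma model_near l (W : stuple l H) h P : window W -> model W h P ->
  exists2 r : R, 0 < r & forall v, exists k, exists2 w, P k w & `|v - w| <= r.
Proof.
move=> wW [_ mP]; have [k [y iy]] := window_interior wW.
have [||r r0 hr] := @lattice_strip_dense R S [set x | interior (W k) (x + h)].
- exact: (open_comp (f := fun y : H => y + h)
    (fun y _ => @translate_continuous R H h y) (open_interior (W k))).
- by exists (y - h); rewrite /= subrK.
exists r => // v; have [g [Gg ig vg]] := hr v.
by exists k, (pv g) => //; exact: mP.
Qed.

(** For uniform discreteness: two points closer than 1 differ by a lattice point with internal
    coordinate at most B + B, and there are finitely many of those. *)
Lemma model_delone l (W : stuple l H) h P : window W -> model W h P -> delone P.
Proof.
move=> wW mP; split; last first.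
  have [r r0 hr] := model_near wW mP; exists r => x.
  by have [k [w Pw xw]] := hr x; exists w => //; exists k.
have [B B0 hB] := window_bounded wW.
have [s [sG hs]] := @lattice_box R S 1 (B + B).
have [d d0 hd] := seq_pos_lower_bound (fun g => `|pv g|) s.
exists (Num.min 1 d); first by rewrite lt_min ltr01.
move=> x y [k _ /mP.1[g [Gg -> Wg]]] [k' _ /mP.1[g' [Gg' -> Wg']]] gg'.
rewrite -linearB ge_min; have [|lt1] := leP 1 `|pv (g - g')|; first by [].
apply: hd; last by rewrite normr_gt0 linearB/= subr_eq0; apply/eqP.
apply: hs; [exact: (latticeB latG)|exact: ltW|].
have -> : ph (g - g') = (ph g + h) - (ph g' + h).
  by rewrite linearB/= opprD addrACA subrr addr0.
by apply: le_trans (ler_normB _ _) _; apply: lerD; [exact: hB Wg|exact: hB Wg'].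
Qed.

Lemma window_translate l (W : stuple l H) t : window W ->
  window (stuple_translate t W).
Proof.
move=> [cW [k0 [x0 Wx0]]]; split; last by exists k0, (x0 + t), x0.
move=> k; have [cWk rWk] := cW k; split; last exact: regclosed_translate.
by apply: continuous_compact => //; apply: continuous_subspaceT => y;
  exact: translate_continuous.
Qed.

Lemma nonsingular_windowP l (W : stuple l H) t : window W ->
  nonsingular_window (stuple_translate t W) <->
  forall g k, G g -> off_boundary (W k) (ph g - t).
Proof.
move=> wW.
have e k x : boundary (stuple_translate t W k) x <-> ~ off_boundary (W k) (x - t).
  have cWt : closed (stuple_translate t W k).
    by apply: (@window_closed _ _ _ (stuple_translate t W)); exact: window_translate.
  rewrite boundaryE//.
  have oe : off_boundary (stuple_translate t W k) x <-> off_boundary (W k) (x - t).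
    rewrite /off_boundary /stuple_translate interior_translate.
    split => -[/translateE|nW]; [by left|right|by left|right].
      by move=> Wx; apply: nW; exact/translateE.
    by move=> /translateE.
  by rewrite -oe.
split => [ns g k Gg|h k].
  apply: contrapT => /e bg; have : (ph @` G `&` boundary (stuple_translate t W k)) (ph g).
    by split => //; exists g.
  by rewrite ns.
apply/seteqP; split => // _ [[g Gg <-]] /e; apply.
exact: h.
Qed.

Lemma nonsingular_pointP l (W : stuple l H) x : window W ->
  nonsingular_point W x <-> forall g k, G g -> off_boundary (W k) (ph (g + x)).
Proof.
move=> wW.
have e k y : boundary (W k) y <-> ~ off_boundary (W k) y.
  by rewrite boundaryE//; exact: window_closed.
split => [ns g k Gg|h [k _ [_ [g Gg <-] /translateE /e]]].
  apply: contrapT => /e bg; apply: ns; exists k => //.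
  exists (ph (- g)); first by exists (- g) => //; exact: (latticeN latG).
  by apply/translateE; rewrite -linearB/= opprK addrC.
apply; rewrite -linearB/= addrC; apply: h; exact: (latticeN latG).
Qed.

Lemma cp_patternE l (W : stuple l H) t k v :
  cp_pattern (stuple_translate t W) k v <->
  exists g, [/\ G g, v = pv g & W k (ph g - t)].
Proof.
split => [[g [Gg /translateE Wg] <-]|[g [Gg -> Wg]]]; first by exists g.
by exists g => //; split => //; exact/translateE.
Qed.

Lemma cp_pattern_model l (W : stuple l H) t :
  model W (- t) (cp_pattern (stuple_translate t W)).
Proof.
split => [k v /cp_patternE//|k g Gg /interior_subset Wg].
by apply/cp_patternE; exists g.
Qed.

Lemma torus_class_lattice (x g : E) : G g -> torus_class (x + g) = torus_class x.
Proof.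
move=> Gg; apply/seteqP; split => _ [g' Gg' <-].
  by exists (g + g'); [exact: (latticeD latG)|rewrite addrA].
exists (g' - g); first exact: (latticeB latG).
by rewrite addrA addrAC addrK.
Qed.

Lemma torus_class_eq (x y : E) : torus_class x = torus_class y ->
  exists2 g, G g & x = y + g.
Proof.
move=> e; have : torus_class x x by exists 0; [exact: (lattice0 latG)|rewrite addr0].
by rewrite e => -[g Gg <-]; exists g.
Qed.

Lemma cp_pattern_at_lattice l (W : stuple l H) x g : G g ->
  cp_pattern_at W (x + g) = cp_pattern_at W x.
Proof.
move=> Gg; apply/funext => k; apply/seteqP; split => _ [g' [Gg' Wg'] <-].
  have e : g + g' + x = g' + (x + g) by rewrite (addrC x) addrA (addrC g).
  exists (g + g'); last by rewrite e.
  by split; [exact: (latticeD latG)|rewrite e].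
have e : g' - g + (x + g) = g' + x by rewrite (addrC x) addrA subrK.
exists (g' - g); last by rewrite e.
by split; [exact: (latticeB latG)|rewrite e].
Qed.

(** By regularity the whole of W k is carried into itself by d, so the points w + n d all stay in a
    bounded set. *)
Lemma window_translate_eq0 l (W : stuple l H) d : window W ->
  (forall k z, interior (W k) z -> W k (z + d)) -> d = 0.
Proof.
move=> wW hd; have [_ [k [w Ww]]] := wW.
have cl z : W k z -> W k (z + d).
  move=> Wz; apply: (@window_closed _ _ _ W k wW) => N Nz.
  have N' : nbhs z [set y | N (y + d)] by exact: translate_continuous.
  move: Wz; rewrite -{1}(@window_regclosed _ _ _ W k wW) => /(_ _ N')[y [iy Ny]].
  by exists (y + d); split => //; exact: hd.
have [B B0 hB] := window_bounded wW.
have it n : W k (w + d *+ n).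
  by elim: n => [|n IH]; rewrite ?mulr0n ?addr0// mulrSr addrA; exact: cl.
apply/eqP; rewrite -normr_eq0; apply/eqP.
have [//|d0] := eqVneq `|d| 0; exfalso.
have dp : 0 < `|d| by rewrite lt_neqAle eq_sym d0/=.
pose n := Num.bound ((B + B) / `|d|).
have : (B + B) / `|d| < n%:R by apply: archi_boundP; rewrite divr_ge0// addr_ge0// ltW.
rewrite ltr_pdivrMr// => hn.
have : `|d *+ n| <= B + B.
  have -> : d *+ n = (w + d *+ n) - w by rewrite addrAC subrr add0r.
  by apply: le_trans (ler_normB _ _) _; apply: lerD; [exact: hB (it n)|exact: hB Ww].
by rewrite normrMn -mulr_natl leNgt hn.
Qed.

(** Density of the projected lattice and closedness of the window turn the hypothesis on lattice
    points into an inclusion under translation by h' - h. *)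
Lemma window_offset_unique l (W : stuple l H) h h' : window W ->
  (forall k g, G g -> interior (W k) (ph g + h) -> W k (ph g + h')) -> h = h'.
Proof.
move=> wW hW; apply/eqP; rewrite eq_sym -subr_eq0; apply/eqP.
apply: (window_translate_eq0 wW) => k z iz.
apply: (@window_closed _ _ _ W k wW) => N Nz.
have N' : nbhs z [set y | N (y + (h' - h))] by exact: translate_continuous.
have [||g Gg [ig Ng]] := @lattice_int_dense R S
    (interior (W k) `&` interior [set y | N (y + (h' - h))]) h.
- by apply: openI; exact: open_interior.
- by exists z.
exists (ph g + h'); split; last first.
  by have := interior_subset Ng; rewrite /= addrA addrAC addrK.
exact: hW.
Qed.

Lemma model_offset_unique l (W : stuple l H) h h' P : window W ->
  model W h P -> model W h' P -> h = h'.
Proof.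
move=> wW [_ m1] [m2 _]; apply: (window_offset_unique wW) => k g Gg ig.
by have [g' [Gg' /(lattice_phys_inj Gg Gg') ->]] := m2 _ _ (m1 _ _ Gg ig).
Qed.

End TorusParametrisation.

(** * Fibres of the torus parametrisation as sets of limit patterns *)

Section TorusFibres.
Context {R : realType} {S : cp_scheme R} {l : nat}.
Local Notation E := (ambient S).
Local Notation V := (subvs_of (phys S)).
Local Notation H := (subvs_of (internal S)).
Local Notation G := (lattice S).
Local Notation pv := (proj_phys S).
Local Notation ph := (proj_int S).
Local Notation latG := (@cp_lattice R S).
Variables (W : stuple l H) (tau : stuple l V -> set E).
Hypotheses (wW : window W) (tauP : torus_param W tau).

Lemma proj_phys_addl g (u : V) (t : H) : pv (g + (vsval u + vsval t)) = pv g + u.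
Proof. by rewrite linearD; congr (_ + _); exact: proj_phys_add. Qed.

Lemma proj_int_addl g (u : V) (t : H) : ph (g + (vsval u + vsval t)) = ph g + t.
Proof. by rewrite linearD; congr (_ + _); exact: proj_int_add. Qed.

Lemma cp_pattern_at_translate (u : V) (t : H) :
  cp_pattern_at W (vsval (- u) + vsval (- t)) =
  stuple_translate (- u) (cp_pattern (stuple_translate t W)).
Proof.
have ev g : pv (g + (vsval (- u) + vsval (- t))) = pv g - u.
  exact: proj_phys_addl.
have eh g : ph (g + (vsval (- u) + vsval (- t))) = ph g - t.
  exact: proj_int_addl.
apply/funext => k; apply/seteqP; split => [_ [g [Gg Wg] <-]|x].
  apply/translateE/cp_patternE; exists g; split => //; last by rewrite -eh.
  by rewrite ev opprK subrK.
move=> /translateE/cp_patternE[g [Gg xg Wg]].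
by exists g; [split => //; rewrite eh|rewrite ev -xg opprK addrK].
Qed.

(** P agrees on a large ball with a translate of a non-singular pattern; continuity of [tau] puts
    the class of that translate near [x], and a lattice translation moves its parameter near x
    itself. *)
Lemma hull_agree_nonsingular P (x : E) (r e : R) :
  cp_hull W P -> tau P = torus_class x -> 0 < e ->
  exists y, [/\ `|x - y| < e, nonsingular_point W y &
                agree_at P 0 (cp_pattern_at W y) 0 r].
Proof.
move=> hP tP e0; have [_ tau2 tau3] := tauP.
have [d d0 hd] := tau3 P x hP tP e e0.
have [t nst [dP liP]] := hP.
(* d^-1 is the radius on which [locally_close d] compares patterns. *)
have [u hu] := (locally_indistinguishableP _ _).1 liP (Num.max r d^-1).
pose y0 := vsval (- u) + vsval (- t).
pose Q := stuple_translate (- u) (cp_pattern (stuple_translate t W)).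
have Qy0 : cp_pattern_at W y0 = Q by exact: cp_pattern_at_translate.
have agPQ : agree_at P 0 Q 0 (Num.max r d^-1).
  move=> k w wr; rewrite (hu k w wr) /Q /stuple_translate translateE opprK add0r.
  by rewrite (addrC w).
have nsy0 : nonsingular_point W y0.
  apply/(nonsingular_pointP _ wW) => g k Gg.
  rewrite proj_int_addl.
  by move: nst => /(nonsingular_windowP _ wW); exact.
have hQ : cp_hull W Q.
  exists t => //; split; last exact: locally_indistinguishable_translate.
  by apply: delone_translate; apply: (model_delone wW); exact: cp_pattern_model.
have [|y tQ xy] := hd Q hQ.
  exists 0, 0; rewrite !normr0 !stuple_translate0; split; [exact: ltW|exact: ltW|].
  by apply/patch_at_eqP; apply: agree_at_le agPQ; rewrite le_max lexx orbT.
move: tQ; rewrite -Qy0 tau2// => /torus_class_eq[g Gg y0y].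
have eQ : cp_pattern_at W y0 = cp_pattern_at W y.
  by rewrite y0y cp_pattern_at_lattice.
exists y; split => //; last first.
  by rewrite -eQ Qy0; apply: agree_at_le agPQ; rewrite le_max lexx.
apply/(nonsingular_pointP _ wW) => g' k Gg'.
have := (nonsingular_pointP _ wW).1 nsy0 (g' - g) k (latticeB latG Gg' Gg).
by rewrite y0y (addrC y) addrA subrK.
Qed.

(** The approximating parameters y have physical part near v, but exactly v is required. A fixed
    point p0 of P forces [pv y] = p0 - [pv g] with g from a finite set, so [pv y] equals v as soon
    as it is close enough; only the internal part still varies, and it gives the shift t. *)
Lemma hull_torus_limit P (v : V) (s : H) :
  cp_hull W P -> tau P = torus_class (vsval v + vsval s) ->
  limit_pattern (stuple_translate (- s) W) (stuple_translate (- v) P).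
Proof.
move=> hP tP; set x := vsval v + vsval s in tP.
have [C C0 hC] := proj_bounded S.
have [B B0 hB] := window_bounded wW.
have [t _ [[_ [rd hrd]] _]] := hP.
have [p0 [k0 _ Pp0] _] := hrd 0.
pose D := C * (`|x| + 1).
have [s0 [s0G hs0]] := @lattice_box R S (`|p0| + D) (B + D).
have [d d0 hd] := seq_pos_lower_bound (fun g => `|p0 - pv g - v|) s0.
(* The bound 1 keeps g inside the finite set [s0]; d / C brings [pv y] closer to v than any
   candidate other than v. *)
pose e1 := Num.min 1 (d / C).
have e10 : 0 < e1 by rewrite lt_min ltr01 divr_gt0.
have key r e : `|p0| <= r -> 0 < e -> e <= e1 ->
    exists y, [/\ `|x - y| < e, nonsingular_point W y, pv y = v &
                agree_at P 0 (cp_pattern_at W y) 0 r].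
  move=> pr e0 ee1; have [y [xy nsy ag]] := hull_agree_nonsingular r hP tP e0.
  exists y; split => //.
  have x1 : `|x - y| < 1 by apply: lt_le_trans xy _; rewrite (le_trans ee1)// ge_min lexx.
  have yx : `|y| <= `|x| + 1.
    by have := lerB_dist y x; rewrite distrC; lra.
  have [hCv hCh] := hC y.
  have yD : C * `|y| <= D by rewrite ler_pM2l.
  have [g [Gg Wg] p0g] : cp_pattern_at W y k0 p0.
    by move: Pp0; rewrite -{1}(add0r p0) (ag k0 p0 pr) add0r.
  have gs : g \in s0.
    apply: hs0 => //.
      have -> : pv g = p0 - pv y by rewrite -p0g linearD/= addrK.
      by apply: le_trans (ler_normB _ _) _; rewrite lerD// (le_trans hCv).
    have -> : ph g = ph (g + y) - ph y by rewrite linearD/= addrK.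
    apply: le_trans (ler_normB _ _) _; apply: lerD; first exact: hB Wg.
    exact: le_trans hCh _.
  have yg : pv y = p0 - pv g by rewrite -p0g linearD/= addrAC subrr add0r.
  apply/eqP; rewrite -subr_eq0 -normr_le0 leNgt yg; apply/negP => /(hd g gs).
  rewrite leNgt => /negP; apply; rewrite -yg.
  have -> : pv y - v = - pv (x - y) by rewrite linearB/= /x proj_phys_add opprB.
  rewrite normrN; have [h1 _] := hC (x - y); apply: le_lt_trans h1 _.
  rewrite mulrC -ltr_pdivlMr//; apply: lt_le_trans xy _.
  by rewrite (le_trans ee1)// ge_min lexx orbT.
have memy y k w : pv y = v -> cp_pattern_at W y k (w + v) <->
    exists g, [/\ G g, w = pv g & W k (ph (g + y))].
  move=> yv; split => [[g [Gg Wg]]|[g [Gg -> Wg]]].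
    by rewrite linearD/= yv => /addIr wg; exists g.
  by exists g => //; rewrite linearD/= yv.
split.
  move=> k w /translateE; rewrite opprK => Pw.
  have [|y [_ _ yv ag]] := key (`|p0| + `|w + v|) e1 _ e10 (lexx _).
    by rewrite lerDl.
  have : cp_pattern_at W y k (w + v).
    by move: Pw; rewrite -{1}(add0r (w + v)) ag ?add0r// lerDr.
  by move=> /(memy _ _ _ yv)[g [Gg wg _]]; exists g.
move=> r e e0.
have [|||y [xy nsy yv ag]] := key (`|p0| + (`|r| + `|v|)) (Num.min e1 (e / C)).
- by rewrite lerDl.
- by rewrite lt_min e10 divr_gt0.
- by rewrite ge_min lexx.
exists (s - ph y).
  have -> : s - ph y = ph (x - y) by rewrite linearB/= /x proj_int_add.
  have [_ h1] := hC (x - y); apply: le_lt_trans h1 _.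
  rewrite mulrC -ltr_pdivlMr//; apply: lt_le_trans xy _.
  by rewrite ge_min lexx orbT.
move=> g Gg gr k.
rewrite /stuple_translate interior_translate !translateE !opprK.
have -> : ph g - (s - ph y) + s = ph (g + y).
  by rewrite opprB addrA subrK linearD.
have Pe : P k (pv g + v) <-> W k (ph (g + y)).
  rewrite -[pv g + v]add0r ag; last first.
    rewrite (le_trans (ler_normD _ _))// ler_wpDl// lerD2r.
    by rewrite (le_trans gr)// ler_norm.
  rewrite add0r (memy _ _ _ yv); split => [[g' [Gg']]|Wg]; last by exists g.
  by move=> /(lattice_phys_inj Gg Gg') ->.
have := (nonsingular_pointP _ wW).1 nsy g k Gg.
by case=> [iW|nW]; [left|right]; rewrite Pe; split => //; exact: interior_subset.
Qed.

(** The admissible shifts for a given ball form an open set, so one of them has the form [ph g0] + s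
    + t0 with t0 non-singular. Up to the translation by g0 the patch of P then occurs in the pattern
    of window W + t0. *)
Lemma limit_cp_hull P (v : V) (s : H) :
  limit_pattern (stuple_translate (- s) W) (stuple_translate (- v) P) ->
  cp_hull W P.
Proof.
move=> [iP hP]; have wWs := window_translate (- s) wW.
have [||t0 [_ /(nonsingular_windowP _ wW) nst0]] := generic_dense wW (O := setT).
- by exists 0.
- exact: openT.
exists t0 => //; split.
  have -> : P = stuple_translate v (stuple_translate (- v) P).
    by rewrite stuple_translateK.
  by apply: delone_translate; apply: (model_delone wWs (limit_model wWs _)); split.
apply/locally_indistinguishableP => r.
have [t _ at_] := hP (`|r| + `|v|) 1 ltr01.
have O := approx_open wWs at_.
have [||g0 Gg0 /interior_subset] := @lattice_int_dense R S
  (interior [set t' | approx (stuple_translate (- s) W)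
    (stuple_translate (- v) P) (`|r| + `|v|) t']) (s + t0).
- exact: open_interior.
- by exists t.
move=> /= at0; exists (- v - pv g0) => k u ur; rewrite add0r.
have me g : G g -> (ph g - (ph g0 + (s + t0))) + s = ph (g - g0) - t0.
  by move=> Gg; rewrite linearB/= !opprD !addrA [LHS]addrAC subrK.
have at1 g : G g -> pv g = u - v -> P k u <-> W k (ph (g - g0) - t0).
  move=> Gg gu; have := at0 g Gg _ k.
  rewrite gu (le_trans (ler_normB _ _)) ?lerD//; last by rewrite (le_trans ur)// ler_norm.
  rewrite /stuple_translate interior_translate !translateE !opprK subrK me//.
  by move=> /(_ isT)[[/interior_subset ? ?]|[? ?]]; split.
split => [Pu|/cp_patternE[q [Gq uq Wq]]].
  have [|g Gg ug] := iP k (u - v).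
    by rewrite /stuple_translate translateE opprK subrK.
  apply/cp_patternE; exists (g - g0); split; first exact: (latticeB latG).
    by rewrite linearB/= -ug addrC addrA.
  exact/(at1 g Gg (esym ug)).
have Gg : G (q + g0) by exact: (latticeD latG).
apply/(at1 _ Gg); last by rewrite addrK.
by rewrite linearD/= -uq addrAC subrK addrC.
Qed.

(** If [tau P] = [x], then P is also a limit pattern for the coordinates of x. One common point of P
    yields a lattice point q with [pv x] = v + [pv q], and uniqueness of the internal offset of a
    model then gives [ph x] = s + [ph q]. *)
Lemma limit_torus P (v : V) (s : H) :
  limit_pattern (stuple_translate (- s) W) (stuple_translate (- v) P) ->
  tau P = torus_class (vsval v + vsval s).
Proof.
move=> lP; have hP := limit_cp_hull lP.
have [tau1 _ _] := tauP; have [x tx] := tau1 P hP.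
have lP' : limit_pattern (stuple_translate (- ph x) W) (stuple_translate (- pv x) P).
  by apply: hull_torus_limit => //; rewrite proj_sum.
have wWs t := window_translate t wW.
have shift t u : limit_pattern (stuple_translate (- t) W) (stuple_translate (- u) P) ->
    [/\ forall k w, P k w -> exists g, [/\ G g, w = pv g + u & W k (ph g + t)] &
     forall k g, G g -> interior (W k) (ph g + t) -> P k (pv g + u)].
  move=> /(limit_model (wWs _))[m1 m2]; split => [k w Pw|k g Gg iW].
    have [|g [Gg wg]] := m1 k (w - u).
      by rewrite /stuple_translate translateE opprK subrK.
    rewrite addr0 /stuple_translate translateE opprK => Wg; exists g.
    by rewrite -wg subrK.
  have := m2 k g Gg; rewrite addr0 /stuple_translate interior_translate !translateE.
  by rewrite !opprK; exact.
have [m1 m2] := shift _ _ lP; have [m1' m2'] := shift _ _ lP'.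
have [t _ [[_ [rd hrd]] _]] := hP; have [p0 [k0 _ Pp0] _] := hrd 0.
have [g [Gg pg _]] := m1 _ _ Pp0; have [g' [Gg' pg' _]] := m1' _ _ Pp0.
have [q qE] : exists q, q = g - g' by eexists.
have Gq : G q by rewrite qE; exact: (latticeB latG).
have vq : pv x = v + pv q.
  by rewrite qE linearB/= addrA (addrC v (pv g)) -pg pg' addrAC subrr add0r.
have sq : ph x = s + ph q.
  apply: (model_offset_unique wW (P := stuple_translate (- pv x) P)); split.
  - move=> k w; rewrite /stuple_translate translateE opprK => /m1'[a [Ga /addIr -> Wa]].
    by exists a.
  - move=> k a Ga iWa; rewrite /stuple_translate translateE opprK; exact: m2'.
  - move=> k w; rewrite /stuple_translate translateE opprK => /m1[a [Ga wa Wa]].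
    exists (a - q); split; first exact: (latticeB latG).
      rewrite linearB/=; apply: (@addIr _ (pv x)); rewrite wa vq.
      by rewrite (addrC v) addrA subrK.
    by rewrite linearB/= (addrC s) addrA subrK.
  - move=> k a Ga iWa; rewrite /stuple_translate translateE opprK vq.
    have -> : pv a + (v + pv q) = pv (a + q) + v.
      by rewrite linearD/= [LHS]addrCA [LHS]addrC.
    apply: m2; first exact: (latticeD latG).
    by move: iWa; rewrite linearD/= (addrC s) addrA.
rewrite tx -(proj_sum x) vq sq.
rewrite -[RHS](torus_class_lattice _ Gq) -[in RHS](proj_sum q).
by rewrite !linearD/= addrACA.
Qed.

End TorusFibres.

(** * The automorphism induced by the inflation *)

Section SmallReturns.
Context {R : realType} {S : cp_scheme R}.
Local Notation E := (ambient S).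
Local Notation V := (subvs_of (phys S)).
Local Notation H := (subvs_of (internal S)).
Local Notation G := (lattice S).
Local Notation pv := (proj_phys S).
Local Notation ph := (proj_int S).
Local Notation latG := (@cp_lattice R S).

(** Around a generic q, all finitely many lattice points that decide a patch avoid the boundary. A
    translation by g with small internal coordinate then changes none of these decisions, so the
    patches of P, and hence those of P2, agree at [pv q] and [pv (q + g)]. *)
Lemma small_return l l2 (W : stuple l H) h P (P2 : stuple l2 V) rho :
  window W -> model W h P -> 0 <= rho ->
  (forall v, exists k, exists2 w, P2 k w & `|v - w| <= rho) ->
  locally_derivable P2 P ->
  exists2 e : R, 0 < e & forall g, G g -> `|ph g| < e ->
    exists k, exists2 z, P2 k z & P2 k (z + pv g).
Proof.
move=> wW [m1 m2] rho0 hrho /locally_derivable_agree[c c0 hc].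
pose r := rho + c.
have [B B0 hB] := window_bounded wW.
(* The 2 accounts for [ph q] and [ph g], each of norm less than 1. *)
have [s [sG hs]] := @lattice_box R S r (B + `|h| + 2).
pose js := [seq (k, m) | k <- enum 'I_l, m <- s].
have jsP k m : G m -> `|pv m| <= r -> `|ph m| <= B + `|h| + 2 -> (k, m) \in js.
  move=> Gm mr mh; apply/allpairsP; exists (k, m); rewrite mem_enum; split => //.
  exact: hs.
have offP (j : 'I_l * E) :
    open [set y : H | off_boundary (W j.1) (y + (ph j.2 + h))] /\
    dense [set y : H | off_boundary (W j.1) (y + (ph j.2 + h))].
  set a := ph j.2 + h; split.
    exact: (open_comp (f := fun y : H => y + a)
      (fun y _ => @translate_continuous R H a y)
      (off_boundary_open (@window_closed _ _ _ W j.1 wW))).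
  move=> O [x Ox] oO.
  have [||y [Oy offy]] := @off_boundary_dense _ (W j.1) [set y | O (y - a)].
  - by exists (x + a); rewrite /= addrK.
  - exact: (open_comp (f := fun y : H => y - a)
      (fun y _ => @translate_continuous R H (- a) y) oO).
  by exists (y - a); split => //=; rewrite subrK.
have [||q Gq [qb qs]] := @lattice_int_dense R S (ball 0 1 `&`
    [set y | forall j, j \in js -> off_boundary (W j.1) (y + (ph j.2 + h))]) 0.
- apply: openI; first exact: ball_open.
  apply: (dense_seq_bigcap
    (f := fun j => [set y | off_boundary (W j.1) (y + (ph j.2 + h))]) _).1.
  by move=> j _; exact: offP.
- have [_ dj] := dense_seq_bigcap
    (f := fun j => [set y : H | off_boundary (W j.1) (y + (ph j.2 + h))])
    (js := js) (fun j _ => offP j).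
  by apply: dj; [exists 0; exact: ballxx|exact: ball_open].
rewrite addr0 in qb qs.
have near0 : nbhs (0 : H) [set d | forall j, j \in js ->
    agree (W j.1) (ph q + (ph j.2 + h)) (d + (ph q + (ph j.2 + h)))].
  apply: (near_seq (nbhs_filter (0 : H))) => j /qs.
  set y := ph q + _ => offy.
  have op (O : set H) : open O -> O y -> nbhs (0 : H) [set d | O (d + y)].
    move=> oO Oy; apply: open_nbhs_nbhs; split; last by rewrite /= add0r.
    exact: (open_comp (f := fun d : H => d + y)
      (fun d _ => @translate_continuous R H y d) oO).
  case: offy => [iy|ny].
    have := op _ (open_interior _) iy; apply: filterS => d id; by left.
  have := op _ (closed_openC (@window_closed _ _ _ W j.1 wW)) ny.
  by apply: filterS => d nd; right.
have [e /= e0 he] := (nbhs_ballP _ _).1 near0.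
exists (Num.min 1 e) => [|g Gg]; first by rewrite lt_min ltr01.
rewrite lt_min => /andP[g1 ge].
have ag j : j \in js -> agree (W j.1) (ph q + (ph j.2 + h)) (ph g + (ph q + (ph j.2 + h))).
  by apply: he; rewrite -ball_normE/= sub0r normrN.
have q1 : `|ph q| < 1 by move: qb; rewrite -ball_normE/= sub0r normrN.
have agP : agree_at P (pv q) P (pv (q + g)) r.
  move=> k u ur; split => [/m1[p [Gp pu Wp]]|/m1[p [Gp pu Wp]]].
    have [m [Gm pE]] : exists m, G m /\ p = q + m.
      by exists (p - q); split; [exact: (latticeB latG)|rewrite addrC subrK].
    have um : u = pv m by apply: (@addrI _ (pv q)); rewrite pu pE linearD.
    have e1 : ph q + (ph m + h) = ph p + h by rewrite pE linearD/= addrA.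
    have hm : `|ph m| <= B + `|h| + 2.
      have -> : ph m = ph p + h - h - ph q by rewrite addrK pE linearD/= addrAC subrr add0r.
      have := ler_normB (ph p + h - h) (ph q); have := ler_normB (ph p + h) h.
      have := hB _ _ Wp; lra.
    have [] := ag (k, m) (jsP _ _ Gm _ hm); rewrite -?um// /= e1.
      move=> [_ ip]; have -> : pv (q + g) + u = pv (g + p).
        by rewrite um pE !linearD/= [RHS]addrCA !addrA.
      apply: m2; first exact: (latticeD latG).
      by rewrite linearD/= -addrA.
    by case.
  have [m [Gm pE]] : exists m, G m /\ p = q + g + m.
    exists (p - (q + g)); split; last by rewrite addrC subrK.
    by apply: (latticeB latG) => //; exact: (latticeD latG).
  have um : u = pv m by apply: (@addrI _ (pv (q + g))); rewrite pu pE linearD.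
  have e1 : ph g + (ph q + (ph m + h)) = ph p + h.
    by rewrite pE !linearD/= !addrA (addrC (ph g)).
  have hm : `|ph m| <= B + `|h| + 2.
    have -> : ph m = ph p + h - h - ph q - ph g.
      by rewrite addrK pE !linearD/= -addrA -opprD addrAC subrr add0r.
    have := ler_normB (ph p + h - h - ph q) (ph g).
    have := ler_normB (ph p + h - h) (ph q); have := ler_normB (ph p + h) h.
    have := hB _ _ Wp; lra.
  have [] := ag (k, m) (jsP _ _ Gm _ hm); rewrite -?um// /= e1.
    move=> [iq _]; have -> : pv q + u = pv (q + m) by rewrite um linearD.
    apply: m2; first exact: (latticeD latG).
    by rewrite linearD/= -addrA.
  by case.
have [k [w Pw qw]] := hrho (pv q).
exists k, w => //.
have := hc _ _ rho rho0 agP k (w - pv q).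
rewrite distrC => /(_ qw); rewrite addrC subrK => -[/(_ Pw) h1 _].
by move: h1; rewrite linearD/= addrC addrA subrK.
Qed.

End SmallReturns.

Section LatticeSums.
Context {R : realType} {E : normedVectType R} (G : set E).
Hypothesis latG : full_rank_lattice G.

Lemma lattice_mulz x (n : int) : G x -> G (x *~ n).
Proof.
have [b _ ->] := latG => -[z _ <-]; exists (fun i => z i * n) => //.
by rewrite mulrz_suml; apply: eq_bigr => i _; rewrite mulrzA.
Qed.

Lemma lattice_lincomb n (f : 'I_n -> E) (z : 'I_n -> int) :
  (forall i, G (f i)) -> G (\sum_i f i *~ z i).
Proof.
move=> Gf; apply: (big_ind G); first exact: lattice0.
  by move=> x y; exact: latticeD.
by move=> i _; exact: lattice_mulz.
Qed.

Lemma lattice_extend (f : E -> E) : exists M : 'End(E),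
  forall (b : (\dim {:E}).-tuple E) i, b = sval (cid2 latG) -> M (tnth b i) = f (tnth b i).
Proof.
set b := sval (cid2 latG).
have bb : basis_of {:E} b by rewrite /b; case: cid2.
have [M hM] := linear_of_free b (map f b).
exists (linfun M) => _ i ->; rewrite lfunE/= -/b.
have /(congr1 (fun s => nth 0 s i)) := hM (basis_free bb) (size_map _ _).
by rewrite !(nth_map 0) ?size_tuple// -tnth_nth.
Qed.

End LatticeSums.

Lemma norm_bounded_linear0 (R : realType) (E F : normedModType R)
    (f : {linear E -> F}) (K : R) :
  (forall v, `|f v| <= K) -> forall v, f v = 0.
Proof.
move=> hK v; apply/eqP; rewrite -normr_eq0; apply/eqP.
have [//|f0] := eqVneq `|f v| 0; exfalso.
have fp : 0 < `|f v| by rewrite lt_neqAle eq_sym f0/=.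
have K0 : 0 <= K by apply: le_trans (hK 0).
have := hK (v *+ Num.bound (K / `|f v|)).
rewrite raddfMn normrMn -mulr_natl leNgt -ltr_pdivrMr//.
by rewrite archi_boundP// divr_ge0.
Qed.

Section InflationAutomorphism.
Context {R : realType} {S : cp_scheme R}.
Local Notation E := (ambient S).
Local Notation V := (subvs_of (phys S)).
Local Notation H := (subvs_of (internal S)).
Local Notation G := (lattice S).
Local Notation pv := (proj_phys S).
Local Notation ph := (proj_int S).
Local Notation latG := (@cp_lattice R S).

Lemma model_image l (W : stuple l H) h P M T A : cp_automorphism M T A ->
  model W h P -> model (stuple_image A W) (A h) (stuple_image T P).
Proof.
move=> [[MG kT kA] vM hM] [m1 m2]; split.
  move=> k _ [v /m1[g [Gg -> Wg]] <-]; exists (M g); split => //.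
    by rewrite -MG; exists g.
  by exists (ph g + h) => //; rewrite linearD hM.
move=> k g; rewrite -{1}MG => -[g' Gg' <-].
rewrite hM -linearD interior_stuple_image// => iW.
by rewrite vM; exists (pv g') => //; exact: m2.
Qed.

Lemma model_translate l (W : stuple l H) h P t :
  model W h P -> model (stuple_translate t W) (h + t) P.
Proof.
move=> [m1 m2]; split => [k v /m1[g [Gg -> Wg]]|k g Gg].
  by exists g; split => //; apply/translateE; rewrite addrA addrK.
rewrite /stuple_translate interior_translate => /translateE.
by rewrite addrA addrK; exact: m2.
Qed.

(* Lattice points of small internal coordinate are return vectors of large
   patches, and they generate the lattice.  As local derivability carries return
   vectors to return vectors, L preserves the projected lattice and thus lifts to
   M; the component N of M from the physical to the internal space is bounded on
   a relatively dense set, hence zero. *)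
Lemma inflation_automorphism l1 l2 (W1 : stuple l1 H) (W2 : stuple l2 H)
    h1 h2 P Q (L : 'End(V)) :
  window W1 -> window W2 -> model W1 h1 P -> model W2 h2 Q ->
  lker L = 0%VS -> mld (stuple_image L Q) P ->
  exists M A, [/\ cp_automorphism M L A,
     (M @: phys S = phys S)%VS /\ (forall v : V, M (vsval v) = vsval (L v)) &
     (M @: internal S = internal S)%VS /\ (forall w : H, M (vsval w) = vsval (A w))].
Proof.
move=> wW1 wW2 mP mQ kL [LQP PLQ].
have kL' : lker L == 0%VS by exact/eqP.
have kLV : lker (L^-1)%VF = 0%VS.
  by apply/eqP/lker0P; exact: (can_inj (lker0_lfunVK kL')).
have LVK l (X : stuple l V) : stuple_image (L^-1)%VF (stuple_image L X) = X.
  rewrite stuple_image_comp; apply/funext => k; rewrite /stuple_image.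
  by rewrite (_ : _ \o _ = id) ?image_id//; apply/funext => x /=; rewrite lker0_lfunK.
have memV l (X : stuple l V) k x : stuple_image (L^-1)%VF X k x <-> X k (L x).
  split => [[y Xy <-]|Xx]; first by rewrite lker0_lfunVK.
  by exists (L x) => //; rewrite lker0_lfunK.
have near_image l (X : stuple l V) (f : 'End(V)) : lker f = 0%VS ->
    (exists2 r : R, 0 < r & forall v, exists k, exists2 w, X k w & `|v - w| <= r) ->
    exists2 r : R, 0 <= r & forall v, exists k, exists2 w, stuple_image f X k w & `|v - w| <= r.
  move=> kf [r r0 hr]; have [C C0 hC] := linear_bounded f.
  exists (C * r) => [|v]; first by rewrite mulr_ge0// ltW.
  have [k [w Xw vw]] := hr ((f^-1)%VF v); exists k, (f w); first by exists w.
  rewrite -{1}(lker0_lfunVK (introT eqP kf) v) -linearB.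
  by apply: le_trans (hC _) _; rewrite ler_pM2l.
have [B B0 hB] := window_bounded wW1.
(* The bound on [ph g'] does not depend on the physical size of g; this uniformity later forces N to
   vanish. *)
have [e1 e10 he1] : exists2 e : R, 0 < e & forall g, G g -> `|ph g| < e ->
    exists g', [/\ G g', L (pv g) = pv g' & `|ph g'| <= B + B].
  have [r r0 hr] := near_image _ _ _ kLV (model_near wW1 mP).
  have [|e e0 he] := small_return wW2 mQ r0 hr.
    by rewrite -(LVK _ Q); exact: locally_derivable_image.
  exists e => // g Gg ge; have [k [z /memV Pz /memV]] := he g Gg ge.
  have [a [Ga za Wa]] := mP.1 _ _ Pz.
  rewrite linearD => /mP.1[a' [Ga' za' Wa']].
  exists (a' - a); split; first exact: (latticeB latG).
    by rewrite linearB/= -za' -za addrAC subrr add0r.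
  have -> : ph (a' - a) = (ph a' + h1) - (ph a + h1).
    by rewrite linearB/= opprD addrACA subrr addr0.
  by apply: le_trans (ler_normB _ _) _; apply: lerD; [exact: hB Wa'|exact: hB Wa].
have LG : forall g, G g -> exists2 g', G g' & L (pv g) = pv g'.
  apply: (lattice_small_generate e10) => [x y _ _ [x' Gx' ex] [y' Gy' ey]|g Gg ge].
    exists (x' + y'); first exact: (latticeD latG).
    by rewrite !linearD/= ex ey.
  by have [g' []] := he1 g Gg ge; exists g'.
have LVG : forall g, G g -> exists2 g', G g' & L (pv g') = pv g.
  have [r r0 hr] := near_image _ _ _ kL (model_near wW2 mQ).
  have [e e0 he] := small_return wW1 mP r0 hr LQP.
  apply: (lattice_small_generate e0) => [x y _ _ [x' Gx' ex] [y' Gy' ey]|g Gg ge].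
    exists (x' + y'); first exact: (latticeD latG).
    by rewrite !linearD/= ex ey.
  have [k [_ [z /mQ.1[a [Ga -> _]] <-] [z' /mQ.1[a' [Ga' -> _]] zz']]] := he g Gg ge.
  exists (a' - a); first exact: (latticeB latG).
  by rewrite !linearB/= zz' addrAC subrr add0r.
have /choice[f hf] : forall g, exists g', G g -> G g' /\ L (pv g) = pv g'.
  move=> g; have [Gg|nG] := pselect (G g); last by exists 0.
  by have [g' ? ?] := LG g Gg; exists g'.
have [M hM] := lattice_extend latG f.
set b := sval (cid2 latG) in hM.
have [bb Gb] : basis_of {:E} b /\
    G = range (fun z : 'I_(\dim {:E}) -> int => \sum_i tnth b i *~ z i).
  by rewrite /b; case: cid2.
have {}hM i : M (tnth b i) = f (tnth b i) by exact: hM.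
have Gbi i : G (tnth b i).
  rewrite Gb; exists (fun j => (j == i)%:Z) => //.
  by rewrite (bigD1 i)//= eqxx mulr1z big1 ?addr0// => j /negPf ->; rewrite mulr0z.
have vM x : pv (M x) = L (pv x).
  rewrite (coord_basis bb (memvf x)) !linear_sum; apply: eq_bigr => i _.
  by rewrite !linearZ/= -tnth_nth hM; congr (_ *: _); have [_ ->] := hf _ (Gbi i).
have MG1 g : G g -> G (M g).
  rewrite {1}Gb => -[z _ <-]; rewrite linear_sum/=.
  rewrite (eq_bigr (fun i => f (tnth b i) *~ z i)); last first.
    by move=> i _; rewrite raddfMz/= hM.
  by apply: (@lattice_lincomb _ _ _ latG _ (fun i => f (tnth b i)) z) => i; have [] := hf _ (Gbi i).
have MG : M @` G = G.
  apply/seteqP; split => [_ [g Gg <-]|g Gg]; first exact: MG1.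
  have [g' Gg' e] := LVG g Gg; exists g' => //.
  apply: lattice_phys_inj => //; first exact: MG1.
  by rewrite vM.
have kM : lker M = 0%VS.
  have MT : (M @: {:E} = {:E})%VS.
    apply/eqP; rewrite eqEsubv subvf -[X in (X <= _)%VS](span_basis bb)/=.
    apply/span_subvP => x /tnthP[i ->].
    have : G (tnth b i) by exact: Gbi.
    by rewrite -{1}MG => -[y _ <-]; exact/memv_img/memvf.
  have := limg_ker_dim M {:E}; rewrite MT -[X in _ = X]add0n => /addIn/eqP.
  by rewrite dimv_eq0 capfv => /eqP.
pose A : 'End(H) := linfun (ph \o M \o vsval).
have AE w : A w = ph (M (vsval w)) by rewrite lfunE.
pose N : {linear V -> H} := ph \o M \o vsval.
have NE v : N v = ph (M (vsval v)) by [].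
have hMx x : ph (M x) = N (pv x) + A (ph x).
  by rewrite AE NE -!linearD/= proj_sum.
have N0 : forall v, N v = 0.
  have [CN CN0 hCN] := linear_bounded N.
  have [CA CA0 hCA] := linear_bounded A.
  have [||rho rho0 hrho] := @lattice_strip_dense R S (ball 0 e1).
  - exact: ball_open.
  - by exists 0; exact: ballxx.
  (* With a lattice point g of small internal coordinate near v, N v = N (v - [pv g]) + [ph (M g)] -
     A ([ph g]), and each of the three terms is bounded. *)
  apply: (@norm_bounded_linear0 _ _ _ _ (CN * rho + (B + B + CA * e1))) => v.
  have [g [Gg ge vg]] := hrho v.
  have {}ge : `|ph g| < e1 by move: ge; rewrite -ball_normE/= sub0r normrN.
  have [g' [Gg' Lg' g'B]] := he1 g Gg ge.
  have Mg : M g = g' by apply: lattice_phys_inj => //; [exact: MG1|rewrite vM].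
  have -> : N v = N (v - pv g) + (ph g' - A (ph g)).
    by rewrite -Mg hMx addrK linearB/= subrK.
  apply: le_trans (ler_normD _ _) _; apply: lerD.
    by apply: le_trans (hCN _) _; rewrite ler_pM2l.
  apply: le_trans (ler_normB _ _) _; apply: lerD => //.
  by apply: le_trans (hCA _) _; rewrite ler_pM2l// ltW.
have hM' x : ph (M x) = A (ph x) by rewrite hMx N0 add0r.
have Mv v : M (vsval v) = vsval (L v).
  by rewrite -[LHS]proj_sum vM hM' proj_phys_phys proj_int_phys !linear0 addr0.
have Mw w : M (vsval w) = vsval (A w).
  by rewrite -[LHS]proj_sum vM hM' proj_phys_int proj_int_int !linear0 add0r.
have kA : lker A = 0%VS.
  apply/eqP/lker0P => x y Axy; apply: subvs_inj.
  by have /eqP/lker0P := kM; apply; rewrite !Mw Axy.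
have kA' : lker A == 0%VS by exact/eqP.
exists M, A; split => //; split => //.
  apply/vspaceP => x; apply/memv_imgP/idP => [[y yV ->]|xV].
    by rewrite -(vsprojK yV) Mv subvsP.
  exists (vsval ((L^-1)%VF (vsproj _ x))); first exact: subvsP.
  by rewrite Mv lker0_lfunVK// vsprojK.
apply/vspaceP => x; apply/memv_imgP/idP => [[y yV ->]|xV].
  by rewrite -(vsprojK yV) Mw subvsP.
exists (vsval ((A^-1)%VF (vsproj _ x))); first exact: subvsP.
by rewrite Mw lker0_lfunVK// vsprojK.
Qed.

End InflationAutomorphism.

(** * Expansive maps *)

Section Expansive.
Context {R : realType}.
Local Notation C := R[i].
Local Notation normc := (@ComplexField.Normc.normc R).

Lemma normc_ge0 (z : C) : 0 <= normc z.
Proof. by case: z => a b; rewrite sqrtr_ge0. Qed.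

Definition row_normc n (c : 'rV[C]_n) : R := \sum_i normc (c 0 i).

Lemma row_normc_ge0 n (c : 'rV[C]_n) : 0 <= row_normc c.
Proof. by apply: sumr_ge0 => i _; exact: normc_ge0. Qed.

Lemma row_normcD n (c d : 'rV[C]_n) : row_normc (c + d) <= row_normc c + row_normc d.
Proof.
by rewrite -big_split/=; apply: ler_sum => i _; rewrite mxE; exact: le_normcD.
Qed.

Lemma row_normcZ n a (c : 'rV[C]_n) : row_normc (a *: c) = normc a * row_normc c.
Proof.
by rewrite mulr_sumr; apply: eq_bigr => i _; rewrite mxE ComplexField.Normc.normcM.
Qed.

Definition tends0 (a : nat -> R) :=
  forall e, 0 < e -> exists J, forall j, (J <= j)%N -> a j <= e.

Lemma tends0_contract (a b : nat -> R) (q : R) : 0 <= q -> q < 1 ->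
  (forall j, 0 <= a j) -> tends0 b ->
  (forall j, a j.+1 <= q * (a j + b j.+1)) -> tends0 a.
Proof.
move=> q0 q1 a0 b0 hab e e0.
(* With this bound on b the error e / 2 reproduces itself in the recursion, since q (2 - q) <= 1. *)
have e2 : 0 < e * (1 - q) / 2 by rewrite divr_gt0// mulr_gt0// subr_gt0.
have [J hJ] := b0 _ e2.
have step k : a (J + k)%N <= q ^+ k * a J + e / 2.
  elim: k => [|k IH].
    by rewrite addn0 expr0 mul1r lerDl divr_ge0// ltW.
  rewrite addnS; apply: le_trans (hab _) _.
  have hb := hJ (J + k).+1 (leqW (leq_addr _ _)).
  rewrite exprS.
  apply: le_trans (ler_wpM2l q0 (lerD IH hb)) _.
  rewrite -(mulrA q); set t := _ * a J.
  have : q * (e / 2) + q * (e * (1 - q) / 2) <= e / 2 by nra.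
  lra.
have [K hK] : exists K, forall k, (K <= k)%N -> q ^+ k * a J <= e / 2.
  have := @cvg_expr R q; rewrite ger0_norm// => /(_ q1) /cvgrPdist_le.
  have ee : 0 < e / 2 / (a J + 1) by rewrite !divr_gt0// ltr_wpDl.
  move=> /(_ _ ee)[K _ hK]; exists K => k Kk.
  have := hK k Kk; rewrite /= sub0r normrN ger0_norm ?exprn_ge0//.
  rewrite ler_pdivlMr ?ltr_wpDl// => h; apply: le_trans h.
  by rewrite ler_wpM2l ?exprn_ge0// lerDl.
exists (J + K)%N => j JKj.
have := step (j - J)%N; rewrite subnKC; last by apply: leq_trans JKj; exact: leq_addr.
have := hK (j - J)%N; rewrite leq_subRL; last by apply: leq_trans JKj; exact: leq_addr.
move=> /(_ JKj); lra.
Qed.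

(* By induction on the factors of an annihilating polynomial: if
   d = c (A - mu) tends to 0, then so does c, since c_(j+1) = (c_j - d_(j+1)) / mu. *)
Lemma backward_orbit_tends0 n (A : 'M[C]_n.+1) (s : seq C) (c : nat -> 'rV[C]_n.+1) :
  (forall mu, mu \in s -> 1 < normc mu) ->
  (forall j, c j = c j.+1 *m A) ->
  (forall j, c j *m horner_mx A (\prod_(mu <- s) ('X - mu%:P)) = 0) ->
  tends0 (fun j => row_normc (c j)).
Proof.
elim: s c => [|mu s IH] c hs cA c0.
  move=> e e0; exists 0%N => j _.
  have := c0 j; rewrite big_nil rmorph1 mulmx1 => ->.
  rewrite /row_normc big1 ?ltW// => i _.
  by rewrite mxE; exact: ComplexField.Normc.normc0.
pose d j := c j *m (A - mu%:M).
have d0 : tends0 (fun j => row_normc (d j)).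
  apply: IH => [nu nus|j|j].
  - by apply: hs; rewrite inE nus orbT.
  - by rewrite /d -mulmxA mulmxBl -scalar_mxC -mulmxBr mulmxA -cA.
  - have := c0 j; rewrite big_cons rmorphM/= rmorphB/= horner_mx_X horner_mx_C.
    by rewrite -mulmxE mulmxA.
have mu1 : 1 < normc mu by apply: hs; exact: mem_head.
have mu0 : mu != 0.
  by apply: contraTneq mu1 => ->; rewrite ComplexField.Normc.normc0 ltr10.
apply: (@tends0_contract _ (fun j => row_normc (d j)) (normc mu)^-1) => //.
- by rewrite invr_ge0 normc_ge0.
- by rewrite invf_lt1// (lt_trans ltr01).
- by move=> j; exact: row_normc_ge0.
move=> j; have -> : c j.+1 = mu^-1 *: (c j - d j.+1).
  rewrite /d mulmxBr -cA opprB addrCA subrr addr0 mul_mx_scalar scalerA mulVf//.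
  by rewrite scale1r.
rewrite row_normcZ ComplexField.Normc.normcV.
apply: ler_wpM2l; first by rewrite invr_ge0 normc_ge0.
have -> : row_normc (d j.+1) = row_normc (- d j.+1).
  by apply: eq_bigr => i _; rewrite !mxE normcN.
exact: row_normcD.
Qed.

(** In complex coordinates the characteristic polynomial splits into factors X - mu with mu an
    eigenvalue, and it annihilates the matrix by Cayley-Hamilton, so [backward_orbit_tends0]
    applies. Dimension 0 is treated apart. *)
Lemma expansive_backward_orbit (E : normedVectType R) (L : 'End(E)) (y : nat -> E) :
  expansive L -> (forall j, y j = L (y j.+1)) -> tends0 (fun j => `|y j|).
Proof.
move=> exL yL.
pose b := vbasis {:E}.
have bb : basis_of {:E} b := vbasisP _.
pose A : 'M[C]_(\dim {:E}) := map_mx (real_complex R) (passmx.mxof b b L).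
pose c j : 'rV[C]_(\dim {:E}) := map_mx (real_complex R) (passmx.rVof b (y j)).
have cA j : c j = c j.+1 *m A.
  by rewrite /c /A -map_mxM/= passmx.mul_mxof passmx.rVofK// -yL.
have hc : tends0 (fun j => row_normc (c j)).
  have ev z : eigenvalue A z -> 1 < normc z.
    move=> /exL; rewrite normc_def => h.
    by move: h; rewrite -ltcR; case: z.
  move: (\dim {:E}) A c cA ev => [|n] A' c' cA' ev.
    move=> e e0; exists 0%N => j _; rewrite /row_normc big_ord0; exact: ltW.
  have [s hs] := closed_field_poly_normal (char_poly A').
  have lc : lead_coef (char_poly A') = 1.
    by have := char_poly_monic A'; rewrite monicE => /eqP.
  rewrite lc scale1r in hs.
  apply: (@backward_orbit_tends0 _ A' s) => // [mu mus|j].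
    by apply: ev; rewrite eigenvalue_root_char hs root_prod_XsubC.
  by rewrite -hs Cayley_Hamilton mulmx0.
pose K := 1 + \sum_i `|tnth b i|.
have K0 : 0 < K by rewrite ltr_pwDl// sumr_ge0.
move=> e e0; have [J hJ] := hc (e / K) (divr_gt0 e0 K0).
exists J => j Jj; apply: (@le_trans _ _ (row_normc (c j) * K)); last first.
  by rewrite -ler_pdivlMr//; exact: hJ.
rewrite {1}(coord_basis bb (memvf (y j))).
apply: le_trans (ler_norm_sum _ _ _) _; rewrite /row_normc mulr_suml.
apply: ler_sum => i _; rewrite normrZ !mxE/= expr0n/= addr0 sqrtr_sqr.
apply: ler_wpM2l => //; rewrite -tnth_nth.
rewrite /K (bigD1 i)//= addrCA ler_wpDr// addr_ge0// sumr_ge0//.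
Qed.

(** The spectral condition makes L^-1 contract the given norm only after enough iterations. Decay
    along the finitely many basis vectors gives decay uniform in x. *)
Lemma expansive_contract (E : normedVectType R) (L : 'End(E)) :
  lker L = 0%VS -> expansive L ->
  exists J, forall j, (J <= j)%N -> forall x, `|iter j (L^-1)%VF x| <= `|x| / 2.
Proof.
move=> kL exL; have kL' : lker L == 0%VS by exact/eqP.
pose b := vbasis {:E}; have bb : basis_of {:E} b := vbasisP _.
have /choice[D hD] : forall i : 'I_(\dim {:E}), exists D : R, forall x : E, `|coord b i x| <= D * `|x|.
  by move=> i; have [D _ hD] := @linear_bounded R E R (coord b i); exists D.
pose K := 1 + \sum_i `|D i|.
have K0 : 0 < K by rewrite ltr_pwDl// sumr_ge0.
have hx (i : 'I_(\dim {:E})) : exists J, forall j, (J <= j)%N ->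
    `|iter j (L^-1)%VF (tnth b i)| <= (2 * K)^-1.
  have := @expansive_backward_orbit E L (fun j => iter j (L^-1)%VF (tnth b i)) exL.
  move=> h; have {}h := h (fun j => esym (lker0_lfunVK kL' _)).
  by apply: h; rewrite invr_gt0 mulr_gt0.
have /choice[J hJ] := hx.
exists (\max_i J i) => j Jj x.
rewrite -lfun_iterE {1}(coord_basis bb (memvf x)) linear_sum/=.
apply: le_trans (ler_norm_sum _ _ _) _.
apply: (@le_trans _ _ (\sum_i `|D i| * `|x| * (2 * K)^-1)).
  apply: ler_sum => i _; rewrite linearZ/= normrZ -tnth_nth lfun_iterE.
  apply: ler_pM => //; last first.
    by apply: hJ; apply: leq_trans Jj; exact: leq_bigmax.
  by apply: le_trans (hD i x) _; rewrite ler_wpM2r// ler_norm.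
rewrite -!mulr_suml.
have hK : \sum_i `|D i| <= K by rewrite lerDr.
rewrite ler_pdivrMr ?mulr_gt0//.
have -> : `|x| / 2 * (2 * K) = K * `|x| by field.
by rewrite ler_wpM2r.
Qed.

End Expansive.

(** * Recognizability *)

Section CloseReturns.
Context {R : realType} {S : cp_scheme R}.
Local Notation E := (ambient S).
Local Notation V := (subvs_of (phys S)).
Local Notation H := (subvs_of (internal S)).
Local Notation G := (lattice S).
Local Notation pv := (proj_phys S).
Local Notation ph := (proj_int S).
Local Notation latG := (@cp_lattice R S).

(** Any two distinct points are separated by some lattice translation, by [window_offset_unique].
    Separation is an open condition, so compactness of the set of pairs at distance at least e
    bounds the physical size of the lattice points used. *)
Lemma separating_lattice_points (U : set H) (e : R) : compact U -> regclosed U ->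
  U !=set0 -> 0 < e -> exists r : R, forall w w', U w -> U w' -> e <= `|w - w'| ->
  exists g, [/\ G g, `|pv g| <= r, interior U (w + ph g) & ~ U (w' + ph g)].
Proof.
move=> cU rU U0 e0; have clU := regclosed_closed rU.
pose K := (U `*` U) `&` [set p : H * H | e <= `|p.1 - p.2|].
have cK : compact K.
  apply: compact_closedI; first exact: compact_setX.
  rewrite (_ : mkset _ = (fun p : H * H => `|p.1 - p.2|) @^-1` [set t | e <= t])//.
  apply: closed_comp; last exact: closed_ge.
  move=> p _; apply: cvg_norm; apply: cvgB; [exact: cvg_fst|exact: cvg_snd].
pose f g := [set p : H * H | interior U (p.1 + ph g) /\ ~ U (p.2 + ph g)].
have oF g : G g -> open (f g).
  move=> Gg; have tr : continuous (fun y : H => y + ph g) by exact: translate_continuous.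
  have -> : f g = (fst @^-1` [set y | interior U (y + ph g)]) `&`
                  (snd @^-1` [set y | (~` U) (y + ph g)]) by [].
  apply: openI.
    apply: (open_comp (f := fst)) => [p _|]; first exact: cvg_fst.
    exact: (open_comp (f := fun y : H => y + ph g) (fun y _ => tr y) (open_interior U)).
  apply: (open_comp (f := snd)) => [p _|]; first exact: cvg_snd.
  exact: (open_comp (f := fun y : H => y + ph g) (fun y _ => tr y) (closed_openC clU)).
have wU : window (fun _ : 'I_1 => U) by split; [split|exists ord0].
have covK : K `<=` \bigcup_(g in G) f g.
  move=> [w w'] [[/= Uw Uw'] ew]; apply: contrapT => nf.
  suff ww' : w = w' by move: ew; rewrite ww' subrr normr0 leNgt e0.
  apply: (window_offset_unique wU) => k g Gg iw.
  apply: contrapT => nW; apply: nf; exists g => //; split => /=; rewrite addrC//.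
have near_cov := (compact_near_coveringP K).1 cK nat \oo
  (fun n p => exists g, [/\ G g, `|pv g| <= n%:R & f g p]) _.
have [|N _ hN] := near_cov _.
  move=> p /covK[g Gg fp].
  exists (f g, [set n | (Num.bound `|pv g| <= n)%N]).
    split; last by exists (Num.bound `|pv g|).
    by apply: open_nbhs_nbhs; split => //; exact: oF.
  move=> [p' n] /= [fp' gn]; exists g; split => //.
  apply: (@le_trans _ _ (Num.bound `|pv g|)%:R); first exact/ltW/archi_boundP.
  by rewrite ler_nat.
exists N%:R => w w' Uw Uw' ew.
have [|g [Gg gN [iw nw]]] := hN N (leqnn N) (w, w'); first by split.
by exists g.
Qed.

(** A converse to [small_return]: if the internal coordinates of two occurrences of a large patch
    were far apart, a separating lattice point would lie in one occurrence and not in the other. *)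
Lemma close_return l (W : stuple l H) h P (e : R) : window W -> model W h P ->
  0 < e -> exists r : R, forall x y, agree_at P x P y r ->
  exists g, [/\ G g, y = x + pv g & `|ph g| <= e].
Proof.
move=> wW [m1 m2] e0; have [k [y0 iy]] := window_interior wW.
have [cW _] := wW; have [cWk rWk] := cW k.
have [||rho rho0 hrho] := @lattice_strip_dense R S [set x | interior (W k) (x + h)].
- exact: (open_comp (f := fun y : H => y + h)
    (fun y _ => @translate_continuous R H h y) (open_interior (W k))).
- by exists (y0 - h); rewrite /= subrK.
have [r hr] := separating_lattice_points cWk rWk
  (ex_intro _ y0 (interior_subset iy)) e0.
exists (rho + `|r|) => x y ag.
have [g [Gg /= ig xg]] := hrho x.
have : P k (y + (pv g - x)).
  apply/ag; first by rewrite distrC (le_trans xg)// lerDl.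
  by rewrite addrC subrK; exact: m2.
move=> /m1[g' [Gg' e' Wg']].
have yE : y = x + pv (g' - g).
  have -> : pv (g' - g) = y - x by rewrite linearB/= -e' (addrA y) addrAC addrK.
  by rewrite addrC subrK.
exists (g' - g); split => //; first exact: (latticeB latG).
rewrite leNgt; apply/negP => lt_e.
have [] := hr (ph g + h) (ph g' + h).
- exact: interior_subset.
- exact: Wg'.
- by rewrite opprD addrACA subrr addr0 distrC -linearB ltW.
move=> q [Gq qr iq]; apply.
have : P k (x + (pv g + pv q - x)).
  rewrite addrC subrK -linearD; apply: m2; first exact: (latticeD latG).
  by rewrite linearD/= addrAC.
rewrite ag; last first.
  rewrite addrAC (le_trans (ler_normD _ _))// lerD//; first by rewrite distrC.
  by rewrite (le_trans qr)// ler_norm.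
have -> : y + (pv g + pv q - x) = pv (g' + q).
  by rewrite addrAC addrA e' linearD.
move=> /m1[p [Gp pq Wp]].
have pE : p = g' + q by apply: lattice_phys_inj => //; exact: (latticeD latG).
by move: Wp; rewrite pE linearD/= addrAC.
Qed.

End CloseReturns.

Section Recognizability.
Context {R : realType} {S : cp_scheme R}.
Local Notation E := (ambient S).
Local Notation V := (subvs_of (phys S)).
Local Notation H := (subvs_of (internal S)).
Local Notation G := (lattice S).
Local Notation pv := (proj_phys S).
Local Notation ph := (proj_int S).
Local Notation latG := (@cp_lattice R S).

Lemma cp_automorphism_inv M T A : @cp_automorphism R S M T A ->
  cp_automorphism (M^-1)%VF (T^-1)%VF (A^-1)%VF.
Proof.
move=> [[MG kT kA] vM hM].
have kT' : lker T == 0%VS by exact/eqP.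
have kA' : lker A == 0%VS by exact/eqP.
have kM : lker M == 0%VS.
  apply/lker0P => x y Mxy; rewrite -(proj_sum x) -(proj_sum y).
  have -> : pv x = pv y by apply: (elimT lker0P kT'); rewrite -!vM Mxy.
  by have -> : ph x = ph y by apply: (elimT lker0P kA'); rewrite -!hM Mxy.
split; first split.
- apply/seteqP; split => [_ [g Gg <-]|g Gg].
    by move: Gg; rewrite -{1}MG => -[g' Gg' <-]; rewrite lker0_lfunK.
  by exists (M g); [rewrite -MG; exists g|rewrite lker0_lfunK].
- by apply/eqP/lker0P; exact: (can_inj (lker0_lfunVK kT')).
- by apply/eqP/lker0P; exact: (can_inj (lker0_lfunVK kA')).
- by move=> x; rewrite -{2}(lker0_lfunVK kM x) vM lker0_lfunK.
- by move=> x; rewrite -{2}(lker0_lfunVK kM x) hM lker0_lfunK.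
Qed.

Section IteratedLinear.
Context {F : normedVectType R} (f : 'End(F)).

Lemma iter_linD n x y : iter n f (x + y) = iter n f x + iter n f y.
Proof. by rewrite -!lfun_iterE linearD. Qed.

Lemma iter_linB n x y : iter n f (x - y) = iter n f x - iter n f y.
Proof. by rewrite -!lfun_iterE linearB. Qed.

Lemma iter_norm_le (C : R) n x : 0 <= C -> (forall y, `|f y| <= C * `|y|) ->
  `|iter n f x| <= C ^+ n * `|x|.
Proof.
move=> C0 hC; elim: n => [|n IH] /=; first by rewrite expr0 mul1r.
by apply: le_trans (hC _) _; rewrite exprS -mulrA ler_wpM2l.
Qed.

Lemma lker0_iterK n x : lker f == 0%VS -> iter n f (iter n (f^-1)%VF x) = x.
Proof.
by move=> kf; elim: n x => //= n IH x; rewrite -[X in iter n f X]iterS iterSr IH lker0_lfunVK.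
Qed.

Lemma lker0_iterVK n x : lker f == 0%VS -> iter n (f^-1)%VF (iter n f x) = x.
Proof.
by move=> kf; elim: n x => //= n IH x; rewrite -[X in iter n _ X]iterS iterSr IH lker0_lfunK.
Qed.

End IteratedLinear.

Variables (l : nat) (W : stuple l H) (P : stuple l V).
Variables (M : 'End(E)) (T : 'End(V)) (A : 'End(H)).
Hypotheses (wW : window W) (mP : model W 0 P) (aM : cp_automorphism M T A).
Hypothesis contrT : forall x, `|(T^-1)%VF x| <= `|x| / 2.

Local Notation Ti := (T^-1)%VF.

Let kT : lker T == 0%VS. Proof. by have [[_ /eqP]] := aM. Qed.

Let iter_contr n x : `|iter n Ti x| <= 2^-1 ^+ n * `|x|.
Proof. by apply: iter_norm_le => // y; rewrite mulrC. Qed.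

Let iter_contr1 n x : `|iter n Ti x| <= `|x|.
Proof.
apply: le_trans (iter_contr n x) _; rewrite ler_piMl// exprn_ile1// invf_le1//.
by rewrite ler1n.
Qed.

Variable c : R.
(** [rule] is the local derivability of P from T P with radius c, pulled back through T^-1. *)
Hypotheses (c0 : 0 <= c)
  (rule : forall x y, (forall k u, `|u| <= c -> (P k (Ti (x + u)) <-> P k (Ti (y + u)))) ->
     forall k, P k x <-> P k y).

(** Inflating a pair of equal patches loses only a bounded margin on the original scale: the radius
    c of the rule contributes c / 2 + c / 4 + ..., which never exceeds c. *)
Lemma inflate_agreement C x y n : agree_at P x P y C ->
  forall w, `|iter n Ti w| <= C - c -> forall k,
    P k (iter n T x + w) <-> P k (iter n T y + w).
Proof.
(* The bound is relaxed to one that the induction preserves: passing from level n + 1 to level n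
   costs exactly c 2^-(n + 1). *)
move=> ag w wC; have {wC} : `|iter n Ti w| <= C - c + c * 2^-1 ^+ n.
  by apply: le_trans wC _; rewrite lerDl mulr_ge0// exprn_ge0.
elim: n w => [|n IH] w /=.
  by rewrite expr0 mulr1 subrK => wC k; exact: ag.
rewrite -iterS iterSr => wC; apply: rule => k u uc.
have e z : Ti (T (iter n T z) + w + u) = iter n T z + Ti (w + u).
  by rewrite -addrA linearD/= lker0_lfunK.
rewrite !e; apply: IH; rewrite linearD/= iter_linD.
apply: le_trans (ler_normD _ _) _.
have uu : `|iter n Ti (Ti u)| <= c * 2^-1 ^+ n.+1.
  rewrite -iterSr; apply: le_trans (iter_contr n.+1 u) _.
  by rewrite mulrC ler_wpM2r// exprn_ge0.
apply: le_trans (lerD wC uu) _.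
rewrite -addrA lerD2l -mulrDr exprS ler_wpM2l//.
by rewrite -mulrDl -[X in _ <= X]mul1r ler_wpM2r ?exprn_ge0//; lra.
Qed.

(** Radius c reproduces itself: T^-1 contracts a displacement of norm at most c + c to one of norm
    at most c. *)
Lemma deflate_disagreement x y k j : ~ (P k (Ti x) <-> P k (Ti y)) ->
  ~ agree_at P (iter j.+1 Ti x) P (iter j.+1 Ti y) c.
Proof.
move=> nk; elim: j => [|j IH] ag.
  by apply: nk; have := ag k 0; rewrite normr0 !addr0; exact.
apply: IH => i w wc; apply: rule => k' u uc.
have e z : Ti (iter j.+1 Ti z + w + u) = iter j.+2 Ti z + Ti (w + u).
  by rewrite -addrA linearD.
rewrite !e; apply: ag; apply: le_trans (contrT _) _.
have := ler_normD w u; lra.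
Qed.

(* If T P is not locally derivable from P, there are points x, y whose large
   patches in P agree although P differs at T^-1 x, T^-1 y, hence near T^-k x,
   T^-k y for all k >= 1.  As y - x has tiny internal coordinate, the pairs of
   patches near T^-k x, T^-k y lie in a finite set for all k <= N.  Two of these
   pairs coincide, say k < k'; inflating them k times transports the agreement
   at x, y to an agreement at T^-(k'-k) x, T^-(k'-k) y: a contradiction. *)
Lemma recognizability : locally_derivable (stuple_image T P) P.
Proof.
have aI := cp_automorphism_inv aM.
have [[MG _ _] vM hM] := aI.
have [B B0 hB] := window_bounded wW.
have [k0 ik0] := window_interior wW.
have [rho rho0 hrho] := lattice_strip_dense (open_interior (W k0)) ik0.
(* [inflate_agreement] gives up c; the remaining c + [rho] covers a displacement of norm c and the
   distance to the nearby lattice point. *)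
pose C := c + c + rho.
have [s [sG hs]] := @lattice_box R S C (B + B + 1).
(* One table records the patches at both members g and g + eta of the pair; N counts the possible
   tables. *)
pose patch (g eta : E) : {ffun bool * 'I_l * 'I_(size s) -> bool} :=
  [ffun p : bool * 'I_l * 'I_(size s) =>
    `[< P p.1.2 (pv ((if p.1.1 then g + eta else g) + s`_(p.2 : 'I_(size s)))) >]].
have [N NE] : exists N, N = #|{ffun bool * 'I_l * 'I_(size s) -> bool}| by eexists.
have [CA CA0 hCA] := linear_bounded (A^-1)%VF.
have [CT CT0 hCT] := linear_bounded T.
(* Deflating stretches internal coordinates by at most 1 + CA per step, so that of eta stays at most
   1 for N steps. *)
pose e := ((1 + CA) ^+ N)^-1.
have CA1 : 0 < 1 + CA by rewrite addr_gt0.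
have e0 : 0 < e by rewrite invr_gt0 exprn_gt0.
have [r0 hr0] := close_return wW mP e0.
(* The first term is the radius of [close_return]; the second bounds how far from x the transported
   points land after at most N inflations. *)
pose r := `|r0| + (1 + CT) ^+ N * (c + rho + rho).
have r_ge : 0 <= (1 + CT) ^+ N * (c + rho + rho).
  by rewrite mulr_ge0 ?exprn_ge0 ?addr_ge0// ltW.
apply/locally_derivableP; exists r; first by rewrite addr_ge0.
have kTe : lker T = 0%VS by exact/eqP.
move=> x y ag k1; rewrite !(stuple_imageE kTe); apply: contrapT => nk.
have [eta [Geta yE eta_e]] : exists g, [/\ G g, y = x + pv g & `|ph g| <= e].
  apply: hr0; apply: agree_at_le ag; apply: le_trans (ler_norm _) _.
  by rewrite lerDl.
have /choice[g hg] := fun k => hrho (iter k Ti x).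
pose etak k := iter k (M^-1)%VF eta.
have Getak k : G (etak k).
  rewrite /etak; elim: k => //= k Gk.
  by rewrite -MG; eexists; first exact: Gk.
have vetak k : pv (etak k) = iter k Ti (pv eta).
  by rewrite /etak; elim: k => //= k <-.
have hetak k : (k <= N)%N -> `|ph (etak k)| <= 1.
  move=> kN; have -> : ph (etak k) = iter k (A^-1)%VF (ph eta).
    by rewrite /etak; elim: (k) => //= j <-.
  apply: le_trans (iter_norm_le (C := 1 + CA) _ _ _ _) _; first exact: ltW.
    by move=> z; apply: le_trans (hCA z) _; rewrite ler_wpM2r// lerDr.
  have : (1 + CA) ^+ N * `|ph eta| <= 1.
    by rewrite -ler_pdivlMl ?exprn_gt0// mulr1.
  apply: le_trans; rewrite ler_wpM2r//; apply: ler_weXn2l => //.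
  by rewrite lerDl ltW.
have hgk k : `|ph (g k)| <= B.
  have [_ /interior_subset] := hg k; move=> /hB Wg _; exact: Wg.
have patch_agree a a' (Ga : G a) (Ga' : G a') : `|ph a| <= B + 1 -> `|ph a'| <= B + 1 ->
    (forall i m, m \in s -> P i (pv (a + m)) <-> P i (pv (a' + m))) ->
    agree_at P (pv a) P (pv a') C.
  have [m1 _] := mP.
  have half b b' : G b -> `|ph b| <= B + 1 ->
      (forall i m, m \in s -> P i (pv (b + m)) -> P i (pv (b' + m))) ->
      forall i u, `|u| <= C -> P i (pv b + u) -> P i (pv b' + u).
    move=> Gb bB hs' i u uC Pbu; have [p [Gp pu Wp]] := m1 _ _ Pbu.
    have [m [Gm pE]] : exists m, G m /\ p = b + m.
      by exists (p - b); split; [exact: (latticeB latG)|rewrite addrC subrK].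
    have um : u = pv m by apply: (@addrI _ (pv b)); rewrite pu pE linearD.
    rewrite um -linearD; apply: hs'; last by rewrite -pE -pu.
    apply: hs => //; first by rewrite -um.
    have -> : ph m = ph p + 0 - ph b by rewrite addr0 pE linearD/= addrAC subrr add0r.
    have := ler_normB (ph p + 0) (ph b); have := hB _ _ Wp; lra.
  move=> aB a'B h i u uC; split.
    by apply: (half a a') => // j m ms; exact: (h j m ms).1.
  by apply: (half a' a) => // j m ms; exact: (h j m ms).2.
have : ~ injective (fun k : 'I_N.+1 => patch (g k) (etak k)).
  by move=> /leq_card; rewrite card_ord -NE ltnn.
move=> /existsNP[k /existsNP[k' /not_implyP[ekk nkk]]].
wlog lt_kk : k k' ekk nkk / (k < k')%N.
  move=> wl; have [lt|gt|eq] := ltngtP k k'.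
  - exact: (wl k k').
  - by apply: (wl k' k) => // /esym.
  - by apply: nkk; exact: val_inj.
have kN : (k <= N)%N by rewrite -ltnS.
have k'N : (k' <= N)%N by rewrite -ltnS.
have [_ _ xg] := hg k; have [_ _ xg'] := hg k'.
have [Ggk _ _] := hg k; have [Ggk' _ _] := hg k'.
have entry b i m : m \in s ->
    P i (pv ((if b then g k + etak k else g k) + m)) <->
    P i (pv ((if b then g k' + etak k' else g k') + m)).
  move=> ms; have ms' : (index m s < size s)%N by rewrite index_mem.
  have := congr1 (fun f : {ffun bool * 'I_l * 'I_(size s) -> bool} => f (b, i, Ordinal ms')) ekk.
  rewrite !ffunE/= nth_index// => h.
  by split => h'; apply/asboolP; [rewrite -h|rewrite h]; exact/asboolP.


have agx : agree_at P (pv (g k)) P (pv (g k')) C.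
  apply: patch_agree => // [||i m ms].
  - by rewrite (le_trans (hgk k))// lerDl.
  - by rewrite (le_trans (hgk k'))// lerDl.
  exact: (entry false).
have agy : agree_at P (pv (g k + etak k)) P (pv (g k' + etak k')) C.
  apply: patch_agree => [||||i m ms]; do ?exact: (latticeD latG).
  - rewrite linearD (le_trans (ler_normD _ _))// lerD//; [exact: hgk|exact: hetak].
  - rewrite linearD (le_trans (ler_normD _ _))// lerD//; [exact: hgk|exact: hetak].
  exact: (entry true).
pose j := (k' - k.+1)%N.
have k'E : k' = (k + j.+1)%N :> nat by rewrite /j -subSn// subnKC// ltnW.
apply: (deflate_disagreement nk (j := j)) => i u uc.
have TT z : iter k T (iter k' Ti z) = iter j.+1 Ti z.
  by rewrite k'E ssrnat.iterD lker0_iterK.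
(* w is the displacement from T^k of the lattice point near T^-k' x; the same w is then used at the
   index k and for y. *)
pose w := iter j.+1 Ti x + u - iter k T (pv (g k')).
have wE : iter k T (pv (g k')) + w = iter j.+1 Ti x + u.
  by rewrite /w addrC subrK.
have wC : `|iter k Ti w| <= C - c.
  have -> : iter k Ti w = (iter k' Ti x - pv (g k')) + iter k Ti u.
    rewrite /w -TT iter_linB iter_linD !lker0_iterVK//.
    by rewrite addrAC.
  apply: le_trans (ler_normD _ _) _.
  have := iter_contr1 k u; rewrite /C; move: xg' uc; lra.
have w'r : `|iter k T (pv (g k)) + w - x| <= r.
  have -> : iter k T (pv (g k)) + w - x =
      iter k T (pv (g k) - iter k Ti x + iter k Ti w).
    by rewrite iter_linD iter_linB !lker0_iterK// addrAC.
  apply: le_trans (iter_norm_le (C := 1 + CT) _ _ _ _) _.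
  - by rewrite addr_ge0// ltW.
  - by move=> z; apply: le_trans (hCT z) _; rewrite ler_wpM2r// lerDr.
  rewrite /r ler_wpDl// ler_pM ?exprn_ge0 ?addr_ge0 ?(ltW CT0)//.
    by apply: ler_weXn2l => //; rewrite lerDl ltW.
  apply: le_trans (ler_normD _ _) _; rewrite distrC.
  move: xg wC; rewrite /C; lra.
have Px z q : iter k T (pv (g q + etak q)) + z = iter k T (pv (g q)) + z + iter k T (iter q Ti (pv eta)).
  by rewrite linearD/= vetak iter_linD addrAC.
(* Three transports: [agx] carries the value at T^-(j+1) x + u to a point within r of x, [ag]
   carries it over to y, and [agy] brings it back to T^-(j+1) y + u. *)
rewrite -wE -(inflate_agreement agx wC) -[X in P i X <-> _](subrK x) [X in P i X <-> _]addrC.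
rewrite (ag i _ w'r) yE addrAC.
have -> : x + (iter k T (pv (g k)) + w - x) = iter k T (pv (g k)) + w by rewrite addrC subrK.
have -> : iter k T (pv (g k)) + w + pv eta = iter k T (pv (g k + etak k)) + w.
  by rewrite Px lker0_iterK.
rewrite (inflate_agreement agy wC) Px wE TT iter_linD.
by rewrite addrAC.
Qed.

End Recognizability.

(** * Inflation acting on a fibre *)

Section Orbits.
Context {T : Type} (F : set T) (f : T -> T).
Hypotheses (finF : finite_set F) (fF : forall x, F x -> F (f x)).

Lemma iter_stable n x : F x -> F (iter n f x).
Proof. by move=> Fx; elim: n => //= n; exact: fF. Qed.

Lemma eventually_periodic x : F x ->
  exists i n, (0 < n)%N /\ iter n f (iter i f x) = iter i f x.
Proof.
move=> Fx; apply: contrapT => np.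
have inj : injective (fun i => iter i f x).
  suff lt_neq i j : (i < j)%N -> iter i f x <> iter j f x.
    move=> i j eij; have [lt|lt|//] := ltngtP i j; first by case: (lt_neq _ _ lt).
    by case: (lt_neq _ _ lt).
  move=> ij eij; apply: np; exists i, (j - i)%N; rewrite subn_gt0; split => //.
  by rewrite -iterD subnK// ltnW.
apply: infinite_nat.
have fr : finite_set ((fun i => iter i f x) @` [set: nat]).
  by apply: (sub_finite_set _ finF) => _ [i _ <-]; exact: iter_stable.
by rewrite -(eq_finite_set (inj_card_eq (in2W inj))).
Qed.

Lemma periodic_of_inj x : F x -> (forall y z, F y -> F z -> f y = f z -> y = z) ->
  exists2 n, (0 < n)%N & iter n f x = x.
Proof.
move=> Fx finj; have [i [n [n0 e]]] := eventually_periodic Fx.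
exists n => //; elim: i e => // i IH; rewrite -iterD addnS/= iterD => /finj e.
by apply: IH; apply: e; do ?apply: iter_stable.
Qed.

Lemma iter_mul_period n a x : iter n f x = x -> iter (n * a) f x = x.
Proof. by move=> e; elim: a => [|a IH]; rewrite ?muln0// mulnS iterD IH. Qed.

End Orbits.

Section LimitFibres.
Context {R : realType} {S : cp_scheme R} {l : nat}.
Local Notation E := (ambient S).
Local Notation V := (subvs_of (phys S)).
Local Notation H := (subvs_of (internal S)).
Variables (W : stuple l H) (M : 'End(E)) (L : 'End(V)) (A : 'End(H)).
Hypotheses (wW : window W) (aM : cp_automorphism M L A).

Let kL : lker L = 0%VS. Proof. by case: aM => -[]. Qed.
Let kA : lker A = 0%VS. Proof. by case: aM => -[]. Qed.

Lemma stuple_image_iterD a b k (X : stuple k V) :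
  stuple_image (iter (a + b) L) X =
  stuple_image (iter a L) (stuple_image (iter b L) X).
Proof.
by rewrite stuple_image_comp; congr stuple_image; apply/funext => x; rewrite /= iterD.
Qed.

Lemma window_image_iter p : window (stuple_image (iter p A) W).
Proof.
by rewrite stuple_image_iter; apply: window_image => //; exact: lfun_iter_ker.
Qed.

Lemma mld_image_iter p k k' (X : stuple k V) (Y : stuple k' V) : mld X Y ->
  mld (stuple_image (iter p L) X) (stuple_image (iter p L) Y).
Proof. by rewrite !stuple_image_iter; apply: mld_image; exact: lfun_iter_ker. Qed.

Lemma lids_translate p (P : stuple l V) v :
  lids (iter p L) P -> lids (iter p L) (stuple_translate v P).
Proof.
rewrite /lids !stuple_image_iter stuple_image_translate; last exact: lfun_iter_ker.
exact: mld_translate.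
Qed.

Lemma lids_constructable p P : limit_pattern W P -> lids (iter p L) P ->
  mutually_constructable W (stuple_image (iter p A) W).
Proof.
move=> lP [d1 d2]; have mP := limit_model wW lP.
have mP' : model (stuple_image (iter p A) W) 0 (stuple_image (iter p L) P).
  rewrite !stuple_image_iter -(linear0 (lfun_iter p A)).
  exact: (model_image (cp_automorphism_iter p aM)).
have wW' := window_image_iter p.
apply/seteqP; split.
  exact: (constructable_of_locally_derivable wW' wW mP' mP d2).
exact: (constructable_of_locally_derivable wW wW' mP mP' d1).
Qed.

Variable p : nat.
Hypotheses (p0 : (0 < p)%N) (finF : finite_set (limit_pattern W)).
Local Notation W' := (stuple_image (iter p A) W).

(** L^p sends limits for W to limits for A^p(W), with shifts multiplied by A^p; a joint limit leads
    back to the window W. *)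
Lemma successor_exists : exists f : stuple l V -> stuple l V,
  forall P, limit_pattern W P -> joint_limit W' (stuple_image (iter p L) P) W (f P).
Proof.
have /choice[f hf] : forall P, exists Q, limit_pattern W P ->
    joint_limit W' (stuple_image (iter p L) P) W Q.
  move=> P; have [lP|nlP] := pselect (limit_pattern W P); last by exists P.
  have [|Q JQ] := @joint_limit_exists _ _ _ _ W' W (stuple_image (iter p L) P)
    (window_image_iter p) wW; last by exists Q.
  rewrite !stuple_image_iter.
  exact: (limit_pattern_image (cp_automorphism_iter p aM)).
by exists f.
Qed.

(** An abstract relation D, so that the same induction serves MLD and one-sided derivability. *)
Lemma iterate_relation (D : stuple l V -> stuple l V -> Prop) (f : stuple l V -> stuple l V) :
  (forall P, D P P) -> (forall P Q T, D P Q -> D Q T -> D P T) ->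
  (forall a P Q, D P Q -> D (stuple_image (iter a L) P) (stuple_image (iter a L) Q)) ->
  (forall P, limit_pattern W P -> limit_pattern W (f P)) ->
  (forall P, limit_pattern W P -> D (stuple_image (iter p L) P) (f P)) ->
  forall n P, limit_pattern W P -> D (stuple_image (iter (p * n) L) P) (iter n f P).
Proof.
move=> Dr Dt Di fF fD; elim=> [|n IH] P lP.
  rewrite muln0 (_ : stuple_image _ P = P); first exact: Dr.
  by apply/funext => k; rewrite /stuple_image image_id.
rewrite mulnS addnC stuple_image_iterD iterSr.
by apply: Dt (IH _ (fF _ lP)); apply: Di; exact: fD.
Qed.

Lemma constructable_lids P : limit_pattern W P -> mutually_constructable W W' ->
  exists2 m, (1 <= m)%N & lids (iter m L) P.
Proof.
move=> lP mW; have [f fJ] := successor_exists.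
have wW' := window_image_iter p.
have cW : constructable W W' by rewrite /constructable mW.
have cW' : constructable W' W by rewrite /constructable mW.
have fF Q : limit_pattern W Q -> limit_pattern W (f Q).
  by move=> /fJ /joint_limit2.
have [|n n0 e] := periodic_of_inj finF fF lP.
  (* Injectivity: L^p Q and L^p Q' are joint limits with the same image pattern, from which the
     window A^p(W) is constructable, so they coincide; L^p is then undone. *)
  move=> Q Q' /fJ J /fJ J' e; rewrite e in J.
  have := joint_limit_unique wW wW' cW' (joint_limit_sym J) (joint_limit_sym J').
  rewrite !stuple_image_iter => eQ; apply/funext => k.
  have kLp : lker (lfun_iter p L) = 0%VS by exact: lfun_iter_ker.
  apply/seteqP; split => x Qx.
    have : stuple_image (lfun_iter p L) Q k (lfun_iter p L x) by exists x.
    by rewrite eQ stuple_imageE// lker0_lfunK//; exact/eqP.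
  have : stuple_image (lfun_iter p L) Q' k (lfun_iter p L x) by exists x.
  by rewrite -eQ stuple_imageE// lker0_lfunK//; exact/eqP.
exists (p * n)%N; first by rewrite muln_gt0 p0.
have := @iterate_relation (fun X Y => mld X Y) f (@mld_refl _ _ _)
  (fun X Y Z => @mld_trans _ _ _ _ _ X Y Z) (fun a X Y => @mld_image_iter a _ _ X Y) fF.
rewrite /lids -{2}e; apply => // Q lQ; have J := fJ _ lQ.
split; last exact: (joint_limit_derivable wW' wW cW J).
exact: (joint_limit_derivable wW wW' cW' (joint_limit_sym J)).
Qed.

Lemma constructable_expansive_lids : expansive L -> constructable W W' ->
  exists2 P, limit_pattern W P & exists2 m, (1 <= m)%N & lids (iter m L) P.
Proof.
move=> exL cW; have [f fJ] := successor_exists.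
have wW' := window_image_iter p.
have fF Q : limit_pattern W Q -> limit_pattern W (f Q).
  by move=> /fJ /joint_limit2.
have [P1 lP1] := limit_pattern_exists wW.
have [i [n [n0 e]]] := eventually_periodic finF fF lP1.
pose P := iter i f P1; have lP : limit_pattern W P by exact: iter_stable.
have [J hJ] := expansive_contract kL exL.
(* A multiple of the period that is also at least J, so that L^-m halves norms as [recognizability]
   requires. *)
pose m := (p * (n * J.+1))%N.
have m0 : (0 < m)%N by rewrite !muln_gt0 p0 n0.
have Jm : (J <= m)%N.
  by rewrite /m mulnA; apply: leq_trans (leqnSn J) _; rewrite leq_pmull// muln_gt0 p0.
have dP : locally_derivable P (stuple_image (iter m L) P).
  rewrite -{1}(iter_mul_period J.+1 (e : iter n f P = P)).
  apply: (@iterate_relation (fun X Y => locally_derivable Y X) f) => //.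
  - by move=> X; exact: locally_derivable_refl.
  - by move=> X Y Z XY YZ; exact: (locally_derivable_trans YZ XY).
  - move=> a X Y XY; rewrite !stuple_image_iter.
    by apply: locally_derivable_image => //; exact: lfun_iter_ker.
  - by move=> X lX; exact: (joint_limit_derivable wW' wW cW (fJ _ lX)).
exists P => //; exists m => //; split => //.
have aMm := cp_automorphism_iter m aM.
have kLm : lker (lfun_iter m L) = 0%VS by exact: lfun_iter_ker.
rewrite stuple_image_iter in dP *.
have [c c0 hc] := (locally_derivableP _ _).1 dP.
apply: (recognizability wW (limit_model wW lP) aMm _ c0).
- move=> x; have -> : ((lfun_iter m L)^-1)%VF x = iter m (L^-1)%VF x.
    apply: (elimT lker0P (introT eqP kLm)).
    rewrite lker0_lfunVK; last exact/eqP.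
    by rewrite lfun_iterE lker0_iterK//; exact/eqP.
  exact: hJ.
- move=> x y hxy; apply: hc => k u uc; rewrite !stuple_imageE//; exact: hxy.
Qed.

End LimitFibres.

(** * From the torus parametrisation to limit patterns, and the equivalences *)

Section FibresOfTheHull.
Context {R : realType} {S : cp_scheme R} {l : nat}.
Local Notation V := (subvs_of (phys S)).
Local Notation H := (subvs_of (internal S)).
Variables (W : stuple l H) (tau : stuple l V -> set (ambient S)).
Hypotheses (wW : window W) (tauP : torus_param W tau).

Lemma torus_fibreP P (v : V) (s : H) :
  cp_hull W P /\ tau P = torus_class (vsval v + vsval s) <->
  limit_pattern (stuple_translate (- s) W) (stuple_translate (- v) P).
Proof.
split => [[hP tP]|lP]; first exact: (hull_torus_limit wW tauP).
by split; [exact: (limit_cp_hull wW lP)|exact: (limit_torus wW tauP lP)].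
Qed.

Lemma torus_fibre_finite (s : H) :
  (forall x, finite_set [set P | cp_hull W P /\ tau P = torus_class x]) ->
  finite_set (limit_pattern (stuple_translate (- s) W)).
Proof.
move=> /(_ (vsval (0 : V) + vsval s)); apply: sub_finite_set => P lP.
by apply/torus_fibreP; rewrite oppr0 stuple_translate0.
Qed.

(** A single element P of the hull is enough: its partner P' lies over some [x], and Q = P' - [pv x]
    is a model for W with offset [ph x] whose image L Q is MLD to P. *)
Lemma inflation_lift (L : 'End(V)) : lker L = 0%VS ->
  (forall P, cp_hull W P -> lsub L P) ->
  exists M A t, [/\ cp_automorphism M L A,
     (M @: phys S = phys S)%VS /\ (forall v : V, M (vsval v) = vsval (L v)),
     (M @: internal S = internal S)%VS /\ (forall w : H, M (vsval w) = vsval (A w)) &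
     mutually_constructable (stuple_translate t W) (stuple_image A W)].
Proof.
move=> kL hLsub; have [P lP] := limit_pattern_exists wW.
have hP : cp_hull W P.
  by apply: (@limit_cp_hull _ _ _ W wW P 0 0); rewrite !oppr0 !stuple_translate0.
have [P' [dP' [liP' _] mP'P]] := hLsub P hP.
have hP' : cp_hull W P'.
  have [t nst [_ liP]] := hP; exists t => //; split => //.
  exact: locally_indistinguishable_trans liP.
have [tau1 _ _] := tauP; have [x tx] := tau1 P' hP'.
have lQ : limit_pattern (stuple_translate (- proj_int S x) W)
                        (stuple_translate (- proj_phys S x) P').
  by apply/torus_fibreP; rewrite proj_sum.
set Q := stuple_translate _ P' in lQ.
have mP := limit_model wW lP.
have mQ : model W (proj_int S x) Q.
  have := model_translate (proj_int S x) (limit_model (window_translate _ wW) lQ).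
  by rewrite stuple_translateK add0r.
have mldQP : mld (stuple_image L Q) P.
  rewrite /Q stuple_image_translate// -[P]stuple_translate0.
  exact: mld_translate.
have [M [A [aM hV hH]]] := inflation_automorphism wW wW mP mQ kL mldQP.
exists M, A, (A (proj_int S x)); split => //.
have [[_ _ kA] _ _] := aM.
have mLQ := model_image aM mQ.
(* Comparing windows requires equal offsets: L Q has offset A ([ph x]), and P acquires the same one
   when W is translated by it. This is the origin of the translate of W. *)
have := model_translate (A (proj_int S x)) mP; rewrite add0r => mP''.
have w1 := window_translate (A (proj_int S x)) wW.
have w2 := window_image kA wW.
have [d1 d2] := mldQP.
apply/seteqP; split.
  exact: (constructable_of_locally_derivable w2 w1 mLQ mP'' d2).
exact: (constructable_of_locally_derivable w1 w2 mP'' mLQ d1).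
Qed.

End FibresOfTheHull.

Unset Implicit Arguments.

Theorem theorem3p9 (R : realType) (S : cp_scheme R) (l : nat)
  (W : stuple l (subvs_of (internal S)))
  (hW : window W)
  (L : 'End(subvs_of (phys S)))
  (hL : lker L = 0%VS)
  (hLsub : forall P, cp_hull W P -> lsub L P)
  (tau : stuple l (subvs_of (phys S)) -> set (ambient S))
  (htau : torus_param W tau)
  (hfin : forall x, finite_set [set P | cp_hull W P /\ tau P = torus_class x]) :
  exists (M : 'End(ambient S)) (A : 'End(subvs_of (internal S))),
    [/\ [/\ M @` lattice S = lattice S,
            (M @: phys S = phys S)%VS /\
              (forall v : subvs_of (phys S), M (vsval v) = vsval (L v)),
            (M @: internal S = internal S)%VS /\
              (forall w : subvs_of (internal S), M (vsval w) = vsval (A w)) &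
            exists t, mutually_constructable (stuple_translate t W)
                                             (stuple_image A W)] &
        forall s : subvs_of (internal S),
          let condA := forall (v : subvs_of (phys S)) P, cp_hull W P ->
            tau P = torus_class (vsval v + vsval s) ->
            exists2 m, (1 <= m)%N & lids (iter m L) P in
          let condB := exists (v : subvs_of (phys S)) P, [/\ cp_hull W P,
            tau P = torus_class (vsval v + vsval s) &
            exists2 m, (1 <= m)%N & lids (iter m L) P] in
          let cond4c := exists2 p, (1 <= p)%N &
            mutually_constructable (stuple_translate (- s) W)
              (stuple_image (iter p A) (stuple_translate (- s) W)) in
          let cond4d := exists2 p, (1 <= p)%N &
            constructable (stuple_translate (- s) W)
              (stuple_image (iter p A) (stuple_translate (- s) W)) in
          [/\ condA <-> condB, condB <-> cond4c &
              expansive L -> (condB <-> cond4d)]].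
Proof.
have [M [A [t [aM hV hH mt]]]] := inflation_lift hW htau hL hLsub.
have [[MG _ _] _ _] := aM.
exists M, A; split; first by split => //; exists t.
move=> s condA condB cond4c cond4d.
have wWs := window_translate (- s) hW.
have finF := torus_fibre_finite hW htau s hfin.
have fibre v P := torus_fibreP hW htau P v s.
have fibre0 P : limit_pattern (stuple_translate (- s) W) P ->
    cp_hull W P /\ tau P = torus_class (vsval (0 : subvs_of (phys S)) + vsval s).
  by move=> lP; apply/fibre; rewrite oppr0 stuple_translate0.
(* Here (A) could be vacuous were the fibre empty; a limit pattern for W - s supplies an element,
   with v = 0. *)
have AB : condA -> condB.
  move=> hA; have [P /fibre0[hP tP]] := limit_pattern_exists wWs.
  by exists 0, P; split => //; exact: (hA 0).
have Bc : condB -> cond4c.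
  move=> [v [P [hP tP [m m0 lm]]]]; exists m => //.
  have lP : limit_pattern (stuple_translate (- s) W) (stuple_translate (- v) P).
    exact/fibre.
  exact: (lids_constructable wWs aM lP (lids_translate aM _ lm)).
have cA : cond4c -> condA.
  move=> [p p0 mp] v P hP tP.
  have lP : limit_pattern (stuple_translate (- s) W) (stuple_translate (- v) P).
    exact/fibre.
  have [m m0 lm] := constructable_lids wWs aM p0 finF lP mp.
  exists m => //; rewrite -(stuple_translateK P v).
  exact: (lids_translate aM).
have dB : expansive L -> cond4d -> condB.
  move=> exL [p p0 cp].
  have [P /fibre0[hP tP] hm] := constructable_expansive_lids wWs aM p0 finF exL cp.
  by exists 0, P.
split; first by split => [/AB|/Bc/cA].
  by split => [/Bc|/cA/AB].
move=> exL; split => [/Bc[p p0 mp]|]; last exact: dB.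
by exists p => //; rewrite /constructable mp.
Qed.
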